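(* Let $h=(h_1,h_2)$ with $h_1,h_2>0$, let $c\in\mathbb C\setminus\{0\}$, and assume that $c\log h_2\neq-\log h_1$. Then the operator $P:H^{-\infty}_{L_h}(\Omega)\to H^{-\infty}_{L_h}(\Omega)$ given by $$P=\frac{\partial}{\partial x_1}+c\frac{\partial}{\partial x_2}$$ is globally $L_h$-hypoelliptic.
   Context: $\Omega=(0,1)^2$ and $L_h=\partial_{x_1}^2+\partial_{x_2}^2$ on $\Omega$ with boundary conditions (BC), for $j=1,2$: $h_jf|_{x_j=0}=f|_{x_j=1}$ and $h_j\,\partial_{x_j}f|_{x_j=0}=\partial_{x_j}f|_{x_j=1}$, and domain $\mathrm{Dom}(L_h)=\{f\in L^2(\Omega):L_hf\in L^2(\Omega),\ f\text{ satisfies (BC)}\}$. Write $h^x=h_1^{x_1}h_2^{x_2}$. For $\xi\in\mathbb Z^2$, $u_\xi(x)=h^xe^{2\pi ix\cdot\xi}$ and $v_\xi(x)=h^{-x}e^{2\pi ix\cdot\xi}$ are biorthogonal systems of eigenfunctions of $L_h$ and its adjoint $L_h^*$, with eigenvalues $\lambda_\xi=(\log h_1+2\pi i\xi_1)^2+(\log h_2+2\pi i\xi_2)^2$ and $\overline{\lambda_\xi}$. Weight: $\langle\xi\rangle=(1+|\lambda_\xi|^2)^{1/4}$. $H^\infty_{L_h}(\overline\Omega)=\bigcap_{k\ge1}\mathrm{Dom}(L_h^k)$ with seminorms $\max_{j\le k}\|L_h^j\varphi\|_{L^2(\Omega)}$ (also written $H^\infty_{L_h}(\Omega)$); $H^\infty_{L_h^*}(\overline\Omega)$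 likewise; $H^{-\infty}_{L_h}(\Omega)$ is the space of continuous linear functionals on $H^\infty_{L_h^*}(\overline\Omega)$, containing $H^\infty_{L_h}(\overline\Omega)$ via $\langle\psi,\varphi\rangle=\int_\Omega\psi\varphi\,dx$. The $L_h$-Fourier transform is $\widehat f(\xi)=\int_\Omega f\overline{v_\xi}\,dx$, $\widehat w(\xi)=\langle w,\overline{v_\xi}\rangle$ for distributions. Standing fact: it is a bijective homeomorphism from $H^\infty_{L_h}(\overline\Omega)$ onto the rapidly decaying sequences $\mathcal S(\mathbb Z^2)$ and from $H^{-\infty}_{L_h}(\Omega)$ onto the sequences of moderate (polynomial) growth $\mathcal S'(\mathbb Z^2)$, both measured by $\langle\xi\rangle$ (so $H^\infty_{L_h}(\overline\Omega)=\{h^xg:g\in C^\infty(\mathbb T^2)\}$). Derivatives act on $H^{-\infty}_{L_h}(\Omega)$ by duality, $\langle\partial_{x_j}w,\varphi\rangle=-\langle w,\partial_{x_j}\varphi\rangle$, so that $\widehat{\partial_{x_j}w}(\xi)=(\log h_j+2\pi i\xi_j)\widehat w(\xi)$. $P$ is globally $L_h$-hypoelliptic if $w\in H^{-\infty}_{L_h}(\Omega)$ and $Pw\in H^\infty_{L_h}(\overline\Omega)$ imply $w\in H^\infty_{L_h}(\overline\Omega)$. *)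

(* Defs.v *)
From HB Require Import structures.
From mathcomp Require Import all_boot all_order all_algebra.
From mathcomp Require Import complex.
From mathcomp Require Import all_classical all_reals all_analysis.

Set Implicit Arguments.
Unset Strict Implicit.
Unset Printing Implicit Defensive.

Import Order.TTheory GRing.Theory Num.Theory.
Import numFieldNormedType.Exports.

Local Open Scope classical_set_scope.
Local Open Scope complex_scope.
Local Open Scope ring_scope.

Section function_spaces.
Variable R : realType.
Local Notation C := R[i].

(* Elements of L^2 are represented by functions on the whole plane; only their
   values on Omega matter, and every notion below (except those for test
   functions) depends only on the class modulo a.e. equality on Omega, among
   functions measurable on Omega. *)
Definition fct := R * R -> C.

Definition reF (f : fct) : R * R -> R := fun x => complex.Re (f x).
Definition imF (f : fct) : R * R -> R := fun x => complex.Im (f x).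

Definition Omega : set (R * R) := `]0, 1[ `*` `]0, 1[.

Definition leb2 := ((@lebesgue_measure R) \x (@lebesgue_measure R))%E.

Definition cint (f : fct) : C :=
  (\int[leb2]_(x in Omega) reF f x) +i* (\int[leb2]_(x in Omega) imF f x).

Definition sqmod (f : fct) : R * R -> R := fun x => reF f x ^+ 2 + imF f x ^+ 2.

Definition L2 (f : fct) : Prop :=
  [/\ measurable_fun Omega (reF f), measurable_fun Omega (imF f) &
      (\int[leb2]_(x in Omega) (sqmod f x)%:E < +oo)%E].

Definition L2norm (f : fct) : R :=
  Num.sqrt (\int[leb2]_(x in Omega) sqmod f x).

Definition L2inner (f g : fct) : C := cint (fun x => f x * conjc (g x)).

(* the bilinear pairing: no complex conjugation *)
Definition pairing (f g : fct) : C := cint (fun x => f x * g x).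

Definition rpd1 (g : R * R -> R) : R * R -> R :=
  fun x => derive1 (fun t : R => g (t, x.2)) x.1.
Definition rpd2 (g : R * R -> R) : R * R -> R :=
  fun x => derive1 (fun t : R => g (x.1, t)) x.2.

Fixpoint rCk (k : nat) (g : R * R -> R) : Prop :=
  match k with
  | 0%N => continuous g
  | k'.+1 =>
      [/\ continuous g,
          forall x : R * R, derivable (fun t : R => g (t, x.2)) x.1 1,
          forall x : R * R, derivable (fun t : R => g (x.1, t)) x.2 1,
          rCk k' (rpd1 g) & rCk k' (rpd2 g)]
  end.

(* Restrictions to the closed square of smooth functions are the functions
   that are smooth up to the boundary. *)
Definition smooth (f : fct) : Prop :=
  forall k : nat, rCk k (reF f) /\ rCk k (imF f).

Definition pd1 (f : fct) : fct := fun x => rpd1 (reF f) x +i* rpd1 (imF f) x.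
Definition pd2 (f : fct) : fct := fun x => rpd2 (reF f) x +i* rpd2 (imF f) x.

Definition laplacian (f : fct) : fct := fun x => pd1 (pd1 f) x + pd2 (pd2 f) x.

Definition test_function (f : fct) : Prop :=
  smooth f /\
  exists K : set (R * R),
    [/\ compact K, K `<=` Omega & forall x, ~ K x -> f x = 0].

(* (Unbounded) operators on L^2 are given by their graphs, closed under a.e.
   equality of measurable functions; [opval A f] is a representative of A f, and 0 off the domain. *)
Definition operator := fct -> fct -> Prop.

Definition dom (A : operator) : set fct := [set f | exists g, A f g].

Definition opval (A : operator) (f : fct) : fct :=
  xget (fun=> 0) [set g | A f g].

Definition dom_pow (A : operator) (k : nat) : set fct :=
  [set f | forall j, (j < k)%N -> dom A (iter j (opval A) f)].

Definition adjoint (A : operator) : operator := fun f g =>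
  [/\ L2 f, L2 g &
      forall phi psi, A phi psi -> L2inner psi f = L2inner phi g].

Definition Hinf (A : operator) : set fct :=
  \bigcap_(k in [set k | (1 <= k)%N]) dom_pow A k.

Definition seminorm (A : operator) (k : nat) (f : fct) : R :=
  \big[Num.max/0]_(j < k.+1) L2norm (iter j (opval A) f).

(* g is the derivative of f in the sense of distributions on Omega, D being
   [pd1] or [pd2] and both f and g belonging to L^2. *)
Definition weak_derivative (D : fct -> fct) : operator := fun f g =>
  [/\ L2 f, L2 g &
      forall chi, test_function chi -> pairing f (D chi) = - pairing g chi].

Definition weak_laplacian (f g : fct) : Prop :=
  forall chi, test_function chi -> pairing f (laplacian chi) = pairing g chi.

Definition classical_BC (h : R * R) (f : fct) : Prop :=
  forall t : R, 0 <= t <= 1 ->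
  [/\ h.1%:C * f (0, t) = f (1, t),
      h.1%:C * pd1 f (0, t) = pd1 f (1, t),
      h.2%:C * f (t, 0) = f (t, 1) &
      h.2%:C * pd2 f (t, 0) = pd2 f (t, 1)].

(* Functions f in L^2 with Laplacian g in L^2 need not have boundary values in
   the pointwise sense, so the boundary conditions are read through Green's
   formula: the boundary integral
     \int_{bd Omega} (f d_n phi - d_n f phi) = \int_Omega (f Lap phi - g phi)
   has to vanish for all phi smooth up to the boundary satisfying the
   transposed boundary conditions, which are those with 1/h in place of h. For
   f smooth up to the boundary this amounts to [classical_BC h f]. *)
Definition weak_BC (h : R * R) (f g : fct) : Prop :=
  forall phi, smooth phi -> classical_BC (h.1^-1, h.2^-1) phi ->
  pairing f (laplacian phi) = pairing g phi.

Definition Lop (h : R * R) : operator := fun f g =>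
  [/\ L2 f, L2 g, weak_laplacian f g & weak_BC h f g].

Definition Hinf_L (h : R * R) : set fct := Hinf (Lop h).
Definition Hinf_Lstar (h : R * R) : set fct := Hinf (adjoint (Lop h)).

(* Only the restriction of a functional to H^oo_{L_h^*} is meaningful. *)
Definition functional := fct -> C.

Definition linear_on (S : set fct) (w : functional) : Prop :=
  forall (a : C) (phi psi : fct), S phi -> S psi ->
  w (fun x => a * phi x + psi x) = a * w phi + w psi.

(* The seminorms increase with k, so finite intersections of seminorm balls
   need not be considered; continuity forces w to be invariant under a.e.
   equality. *)
Definition continuous_on (A : operator) (w : functional) : Prop :=
  forall phi0, Hinf A phi0 -> forall eps : R, 0 < eps ->
  exists (k : nat) (delta : R), 0 < delta /\
    forall phi, Hinf A phi ->
      seminorm A k (fun x => phi x - phi0 x) < delta ->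
      `|w phi - w phi0| < eps%:C.

Definition Hminf_L (h : R * R) : set functional :=
  [set w | linear_on (Hinf_Lstar h) w /\ continuous_on (adjoint (Lop h)) w].

Definition in_Hinf_L (h : R * R) (w : functional) : Prop :=
  exists2 f, Hinf_L h f &
    forall phi, Hinf_Lstar h phi -> w phi = pairing f phi.

Definition dual_derivative (D : fct -> fct) (w : functional) : functional :=
  fun phi => - w (opval (weak_derivative D) phi).

Definition globally_hypoelliptic (h : R * R) (P : functional -> functional) :=
  forall w, Hminf_L h w -> in_Hinf_L h (P w) -> in_Hinf_L h w.

Definition Pop (c : C) (w : functional) : functional :=
  fun phi => dual_derivative pd1 w phi + c * dual_derivative pd2 w phi.

End function_spaces.

(* Main.v *)
Require Import Defs.
From HB Require Import structures.
From mathcomp Require Import all_boot all_order all_algebra.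
From mathcomp Require Import complex.
From mathcomp Require Import all_classical all_reals all_analysis.
From mathcomp Require Import measurable_realfun.
From mathcomp Require Import ring lra zify.
Set Implicit Arguments.
Unset Strict Implicit.
Unset Printing Implicit Defensive.
Import Order.TTheory GRing.Theory Num.Theory.
Import numFieldNormedType.Exports.
Import Normc.
Local Open Scope classical_set_scope.
Local Open Scope complex_scope.
Local Open Scope ring_scope.
Local Notation Re := complex.Re.
Local Notation Im := complex.Im.

(** Why the theorem holds. Put k = (ln h_1, ln h_2). The functions
    u_xi(x) = h^x e^{2 pi i x.xi} ([qexp k xi]) are eigenfunctions of L_h, and
    v_xi(x) = h^{-x} e^{2 pi i x.xi} ([qexp (opp2 k) xi]) are eigenfunctions of
    its adjoint. A functional w is governed by the numbers w(v_xi), and the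
    operator multiplies them by a symbol: if P w is the function g, testing on
    v_xi gives sigma(xi) w(v_xi) = - <g, v_xi> with
    sigma(xi) = (- ln h_1 + 2 pi i xi_1) + c (- ln h_2 + 2 pi i xi_2).
    No small denominators can occur ([symbol_lower_bound]): for real c the real
    part of sigma is the constant - (ln h_1 + c ln h_2), nonzero by
    hypothesis, and for non-real c the modulus of sigma tends to infinity. So
    sigma is bounded away from 0 outside a finite set of frequencies, and the
    rapid decay of the coefficients of g passes to the numbers w(v_xi)
    ([rapid_div]). Then f = sum_xi w(v_{-xi}) u_xi converges, lies in the
    space of smooth functions of L_h, and w is the pairing with f.

    This uses that the smooth functions of an operator are exactly the sums,
    up to null sets, of series with rapidly decaying coefficients. That is
    derived once, for any operator that the family [qexp k] diagonalizes
    ([diagonal], [Hinf_of_qseries], [qseries_of_Hinf]), and applied to L_h, by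
    Green's formula ([diagonal_Lop]), and to its adjoint, by duality
    ([diagonal_adjoint]). Partial sums over boxes of frequencies converge
    uniformly with an error of order 1/N ([qseries_approx]), so integrals and
    seminorms can be computed term by term; continuity of w then yields
    w phi = sum_xi b_xi w(v_xi) when phi = sum_xi b_xi v_xi
    ([functional_approx]).

    Operators act through an arbitrarily chosen representative, so each value
    has to be determined almost everywhere. For L_h and its adjoint this rests
    on completeness of the exponentials ([fourier_complete]), for weak
    derivatives on density of the test functions ([test_function_dense]).
    Both follow from one criterion ([ae0_of_real_approx]): an integrable
    function vanishes a.e. as soon as it annihilates bounded functions that
    converge pointwise to the indicators of boxes. Trigonometric polynomials
    of this kind are obtained by applying the polynomials
    (1 - q^n)^(n 2^n), which converge to the indicator of q < 1/2, to an
    affine function q of a cosine; test functions of this kind are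
    1 - (1 - b)^n with b a bump built from exp(-1/t). *)

(** * Integration on the open unit square *)
Section Integrals.
Context {R : realType}.
Implicit Types (f g phi : fct R) (u v : R * R -> R).
Local Notation C := R[i].
Local Notation Omega := (@Omega R).
Local Notation leb2 := (@leb2 R).

Lemma Re_add (z w : C) : Re (z + w) = Re z + Re w.
Proof. by case: z; case: w. Qed.
Lemma Im_add (z w : C) : Im (z + w) = Im z + Im w.
Proof. by case: z; case: w. Qed.
Lemma Re_mul (z w : C) : Re (z * w) = Re z * Re w - Im z * Im w.
Proof. by case: z; case: w. Qed.
Lemma Im_mul (z w : C) : Im (z * w) = Re z * Im w + Im z * Re w.
Proof. by case: z; case: w. Qed.
Lemma Re_opp (z : C) : Re (- z) = - Re z. Proof. by case: z. Qed.
Lemma Im_opp (z : C) : Im (- z) = - Im z. Proof. by case: z. Qed.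
Lemma complex_ext (z w : C) : Re z = Re w -> Im z = Im w -> z = w.
Proof. by case: z => a b; case: w => c d /= -> ->. Qed.

Lemma conjcM (z w : C) : conjc (z * w) = conjc z * conjc w.
Proof. by case: z => a b; case: w => c d; apply: complex_ext => /=; ring. Qed.

Lemma sqr_normcE (z : C) : normc z ^+ 2 = Re z ^+ 2 + Im z ^+ 2.
Proof. by case: z => a b /=; rewrite sqr_sqrtr// addr_ge0// sqr_ge0. Qed.

Lemma normc_nneg (z : C) : 0 <= normc z.
Proof. by case: z => a b /=; rewrite sqrtr_ge0. Qed.

Lemma Re_le_normc (z : C) : `|Re z| <= normc z.
Proof.
rewrite -(ler_pXn2r (n := 2)) ?nnegrE ?normc_nneg// real_normK ?num_real//.
by rewrite sqr_normcE lerDl sqr_ge0.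
Qed.

Lemma Im_le_normc (z : C) : `|Im z| <= normc z.
Proof.
rewrite -(ler_pXn2r (n := 2)) ?nnegrE ?normc_nneg// real_normK ?num_real//.
by rewrite sqr_normcE lerDr sqr_ge0.
Qed.

Lemma normc_le_ReIm (z : C) : normc z <= `|Re z| + `|Im z|.
Proof.
rewrite -(ler_pXn2r (n := 2)) ?nnegrE ?normc_nneg ?addr_ge0// sqr_normcE.
rewrite sqrrD !real_normK ?num_real// addrAC lerDl.
by rewrite mulrn_wge0// mulr_ge0.
Qed.

Lemma normc_triangle (z w : C) : normc (z + w) <= normc z + normc w.
Proof. exact: le_normcD. Qed.

Lemma normc_opp (z : C) : normc (- z) = normc z.
Proof. exact: normcN. Qed.

Lemma normc_triangleB (z w : C) : normc (z - w) <= normc z + normc w.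
Proof. by rewrite (le_trans (normc_triangle _ _))// normc_opp. Qed.

Lemma normc_real (r : R) : normc r%:C = `|r|.
Proof. by rewrite /= expr0n/= addr0 sqrtr_sqr. Qed.

Local Notation T := (measurableTypeR R * measurableTypeR R)%type.

Lemma normC_lt_real (z : C) (e : R) : (`|z| < e%:C) = (normc z < e).
Proof. by rewrite normc_def ltcR; case: z. Qed.

Lemma measurable_Omega : measurable (Omega : set T).
Proof. by apply: measurableX; exact: measurable_itv. Qed.
#[local] Hint Resolve measurable_Omega : core.

Lemma leb2_Omega : leb2 Omega = 1%E.
Proof.
rewrite /leb2 [LHS]product_measure1E; [|exact: measurable_itv..].
rewrite [X in (X * _)%E](@lebesgue_measure_itv R `]0, 1[).
rewrite [X in (_ * X)%E](@lebesgue_measure_itv R `]0, 1[).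
by rewrite /= lte_fin ltr01 oppr0 adde0 mule1.
Qed.

(** [T] carries the sigma-algebra on which [leb2] is defined; it is
    convertible to the one that [L2] uses, but the two structures do not
    unify. *)
Definition rmeas u := measurable_fun (Omega : set T) (u : T -> R).
Definition rinteg u := leb2.-integrable Omega (EFin \o u : T -> _).

Lemma rinteg_meas u : rinteg u -> rmeas u.
Proof. by move=> /(measurable_int leb2) /measurable_EFinP. Qed.

Lemma rintegD u v : rinteg u -> rinteg v -> rinteg (fun x => u x + v x).
Proof. by move=> iu iv; exact: (integrableD measurable_Omega iu iv). Qed.

Lemma rintegZ (k : R) u : rinteg u -> rinteg (fun x => k * u x).
Proof. by move=> iu; exact: (integrableZl measurable_Omega k iu). Qed.

Lemma rintegN u : rinteg u -> rinteg (fun x => - u x).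
Proof.
by move=> iu; under eq_fun do rewrite -mulN1r; exact: rintegZ.
Qed.

Lemma rintegB u v : rinteg u -> rinteg v -> rinteg (fun x => u x - v x).
Proof. by move=> iu iv; apply: rintegD => //; exact: rintegN. Qed.

Lemma rinteg_abs u : rinteg u -> rinteg (fun x => `|u x|).
Proof. by move=> iu; exact: (integrable_abse iu). Qed.

Lemma rinteg_le u v : rmeas u -> rinteg v ->
  (forall x, Omega x -> `|u x| <= v x) -> rinteg u.
Proof.
move=> mu iv uv; apply: (le_integrable measurable_Omega _ _ iv).
  exact/measurable_EFinP.
by move=> x Ox /=; rewrite lee_fin (le_trans (uv _ Ox))// ler_norm.
Qed.

Lemma rinteg_cst (k : R) : rinteg (fun=> k).
Proof.
apply/integrableP; split; first exact: measurable_cst.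
rewrite integral_cst//=.
by rewrite [X in (_ * X)%E]leb2_Omega mule1 ltry.
Qed.

Lemma rinteg_bounded u (B : R) : rmeas u ->
  (forall x, Omega x -> `|u x| <= B) -> rinteg u.
Proof. by move=> mu uB; apply: (rinteg_le mu (rinteg_cst B)). Qed.

Definition rint u : R := \int[leb2]_(x in Omega) u x.

Lemma rintD u v : rinteg u -> rinteg v ->
  rint (fun x => u x + v x) = rint u + rint v.
Proof. by move=> iu iv; exact: RintegralD. Qed.

Lemma rintZ k u : rinteg u -> rint (fun x => k * u x) = k * rint u.
Proof. by move=> iu; exact: RintegralZl. Qed.

Lemma rintN u : rinteg u -> rint (fun x => - u x) = - rint u.
Proof.
move=> iu; rewrite -mulN1r -rintZ//; congr rint.
by apply/funext => x; rewrite mulN1r.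
Qed.

Lemma rintB u v : rinteg u -> rinteg v ->
  rint (fun x => u x - v x) = rint u - rint v.
Proof. by move=> iu iv; exact: RintegralB. Qed.

Lemma rint_le u v : rinteg u -> rinteg v ->
  (forall x, Omega x -> u x <= v x) -> rint u <= rint v.
Proof. by move=> iu iv uv; exact: le_Rintegral. Qed.

Lemma rint_abs u : rinteg u -> `|rint u| <= rint (fun x => `|u x|).
Proof. by move=> iu; exact: le_normr_Rintegral. Qed.

Lemma rint_ge0 u : (forall x, Omega x -> 0 <= u x) -> 0 <= rint u.
Proof. by move=> u0; exact: Rintegral_ge0. Qed.

Lemma rint_cst (k : R) : rint (fun=> k) = k.
Proof.
by rewrite /rint [LHS]Rintegral_cst// [X in fine X]leb2_Omega mulr1.
Qed.

Lemma eq_rint u v : (forall x, Omega x -> u x = v x) -> rint u = rint v.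
Proof. by move=> uv; apply: eq_Rintegral => x; rewrite inE => /uv. Qed.

Definition aeO {V} (f g : R * R -> V) : Prop :=
  ae_eq leb2 (Omega : set T) (f : T -> V) g.

Lemma aeO_refl {V} (f : R * R -> V) : aeO f f.
Proof. exact: ae_eq_refl. Qed.

Lemma aeO_sym {V} (f g : R * R -> V) : aeO f g -> aeO g f.
Proof. exact: ae_eq_sym. Qed.

Lemma aeO_trans {V} (f g k : R * R -> V) : aeO f g -> aeO g k -> aeO f k.
Proof. exact: ae_eq_trans. Qed.

Lemma aeO_comp {V W} (F : V -> W) (f g : R * R -> V) :
  aeO f g -> aeO (F \o f) (F \o g).
Proof. exact: ae_eq_comp. Qed.

Lemma rint_ae u v : rmeas u -> rmeas v -> aeO u v -> rint u = rint v.
Proof.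
move=> mu mv uv; rewrite /rint /Rintegral; congr fine.
apply: ae_eq_integral => //; [exact/measurable_EFinP..|].
exact: (aeO_comp (EFin : R -> \bar R) uv).
Qed.

Definition cmeas f := rmeas (reF f) /\ rmeas (imF f).
Definition cinteg f := rinteg (reF f) /\ rinteg (imF f).

Lemma reF_D f g : reF (fun x => f x + g x) = (fun x => reF f x + reF g x).
Proof. by apply/funext => x; rewrite /reF Re_add. Qed.
Lemma imF_D f g : imF (fun x => f x + g x) = (fun x => imF f x + imF g x).
Proof. by apply/funext => x; rewrite /imF Im_add. Qed.
Lemma reF_M f g :
  reF (fun x => f x * g x) = (fun x => reF f x * reF g x - imF f x * imF g x).
Proof. by apply/funext => x; rewrite /reF Re_mul. Qed.
Lemma imF_M f g :
  imF (fun x => f x * g x) = (fun x => reF f x * imF g x + imF f x * reF g x).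
Proof. by apply/funext => x; rewrite /imF Im_mul. Qed.
Lemma reF_conj f : reF (fun x => conjc (f x)) = reF f.
Proof. by apply/funext => x; rewrite /reF; case: (f x). Qed.
Lemma imF_conj f : imF (fun x => conjc (f x)) = (fun x => - imF f x).
Proof. by apply/funext => x; rewrite /imF; case: (f x). Qed.

Lemma rmeasD u v : rmeas u -> rmeas v -> rmeas (fun x => u x + v x).
Proof. by move=> *; exact: measurable_funD. Qed.
Lemma rmeasB u v : rmeas u -> rmeas v -> rmeas (fun x => u x - v x).
Proof. by move=> *; exact: measurable_funB. Qed.
Lemma rmeasM u v : rmeas u -> rmeas v -> rmeas (fun x => u x * v x).
Proof. by move=> *; exact: measurable_funM. Qed.
Lemma rmeasN u : rmeas u -> rmeas (fun x => - u x).
Proof. by move=> ?; exact: measurableT_comp. Qed.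
Lemma rmeas_cst (k : R) : rmeas (fun=> k).
Proof. exact: measurable_cst. Qed.
Lemma rmeas_lim (u : nat -> R * R -> R) v : (forall n, rmeas (u n)) ->
  (forall x, Omega x -> u ^~ x @ \oo --> v x) -> rmeas v.
Proof. by move=> mu uv; exact: (measurable_fun_cvg mu). Qed.

Lemma cmeasD f g : cmeas f -> cmeas g -> cmeas (fun x => f x + g x).
Proof.
by move=> [? ?] [? ?]; split; rewrite ?reF_D ?imF_D; exact: rmeasD.
Qed.
Lemma cmeasM f g : cmeas f -> cmeas g -> cmeas (fun x => f x * g x).
Proof.
move=> [? ?] [? ?]; split; rewrite ?reF_M ?imF_M.
  by apply: rmeasB; exact: rmeasM.
by apply: rmeasD; exact: rmeasM.
Qed.
Lemma cmeas_cst (k : C) : cmeas (fun=> k).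
Proof. by split; exact: rmeas_cst. Qed.
Lemma cmeasZ k f : cmeas f -> cmeas (fun x => k * f x).
Proof. by apply: cmeasM; exact: cmeas_cst. Qed.
Lemma cmeas_conj f : cmeas f -> cmeas (fun x => conjc (f x)).
Proof.
by move=> [? ?]; split; rewrite ?reF_conj ?imF_conj//; exact: rmeasN.
Qed.

Lemma cinteg_meas f : cinteg f -> cmeas f.
Proof. by move=> [? ?]; split; exact: rinteg_meas. Qed.

Lemma cintegD f g : cinteg f -> cinteg g -> cinteg (fun x => f x + g x).
Proof.
by move=> [? ?] [? ?]; split; rewrite ?reF_D ?imF_D; exact: rintegD.
Qed.
Lemma cintegZ k f : cinteg f -> cinteg (fun x => k * f x).
Proof.
move=> [? ?]; split; rewrite ?reF_M ?imF_M.
  by apply: rintegB; exact: rintegZ.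
by apply: rintegD; exact: rintegZ.
Qed.
Lemma cintE f : cint f = rint (reF f) +i* rint (imF f). Proof. by []. Qed.

Lemma eq_cint f g : (forall x, Omega x -> f x = g x) -> cint f = cint g.
Proof.
by move=> fg; rewrite !cintE; congr Complex; apply: eq_rint => x Ox;
  rewrite /reF /imF fg.
Qed.

Lemma cintD f g : cinteg f -> cinteg g ->
  cint (fun x => f x + g x) = cint f + cint g.
Proof.
move=> [? ?] [? ?]; rewrite !cintE reF_D imF_D !rintD//.
Qed.

Lemma cintZ k f : cinteg f -> cint (fun x => k * f x) = k * cint f.
Proof.
move=> [? ?]; rewrite !cintE reF_M imF_M rintB ?rintD; [|exact: rintegZ..].
by case: k => a b; rewrite !rintZ.
Qed.

Lemma cint_cst (k : C) : cint (fun=> k) = k.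
Proof.
by rewrite cintE; apply: complex_ext; rewrite -[RHS]rint_cst.
Qed.

Lemma cint_conj f : cinteg f -> cint (fun x => conjc (f x)) = conjc (cint f).
Proof.
by move=> [? ?]; rewrite !cintE reF_conj imF_conj rintN.
Qed.

Lemma cint0 : cint (fun=> 0 : C) = 0. Proof. exact: cint_cst. Qed.

Lemma cinteg_cst (k : C) : cinteg (fun=> k).
Proof. by split; exact: rinteg_cst. Qed.

Lemma cinteg_sum (I : Type) (s : seq I) (F : I -> fct R) :
  (forall i, cinteg (F i)) -> cinteg (fun x => \sum_(i <- s) F i x).
Proof.
move=> iF; elim: s => [|i s IH].
  by under eq_fun do rewrite big_nil; exact: cinteg_cst.
by under eq_fun do rewrite big_cons; exact: cintegD.
Qed.

Lemma cmeas_sum (I : Type) (s : seq I) (F : I -> fct R) :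
  (forall i, cmeas (F i)) -> cmeas (fun x => \sum_(i <- s) F i x).
Proof.
move=> iF; elim: s => [|i s IH].
  by under eq_fun do rewrite big_nil; exact: cmeas_cst.
by under eq_fun do rewrite big_cons; exact: cmeasD.
Qed.

Lemma cint_sum (I : Type) (s : seq I) (F : I -> fct R) :
  (forall i, cinteg (F i)) ->
  cint (fun x => \sum_(i <- s) F i x) = \sum_(i <- s) cint (F i).
Proof.
move=> iF; elim: s => [|i s IH].
  by under eq_fun do rewrite big_nil; rewrite big_nil cint0.
under eq_fun do rewrite big_cons.
by rewrite cintD ?IH ?big_cons//; exact: cinteg_sum.
Qed.

Lemma cint_ae f g : cmeas f -> cmeas g -> aeO f g -> cint f = cint g.
Proof.
move=> [? ?] [? ?] fg; rewrite !cintE; congr Complex; apply: rint_ae => //.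
  by apply: filterS fg => x e Ox; rewrite /reF e.
by apply: filterS fg => x e Ox; rewrite /imF e.
Qed.

Lemma sqmodE f x : sqmod f x = normc (f x) ^+ 2.
Proof. by rewrite sqr_normcE. Qed.

Lemma rmeas_sqmod f : cmeas f -> rmeas (sqmod f).
Proof. by move=> [? ?]; apply: rmeasD; exact: rmeasM. Qed.

Lemma L2P f : L2 f <-> cmeas f /\ rinteg (sqmod f).
Proof.
split=> [[mr mi i]|[[mr mi] /integrableP[_ i]]].
  have mf : cmeas f by [].
  split=> //; apply/integrableP; split.
    by apply/measurable_EFinP; exact: rmeas_sqmod.
  rewrite (le_lt_trans _ i)// le_eqVlt; apply/orP; left; apply/eqP.
  apply: eq_integral => x _ /=; rewrite ger0_norm//.
  by rewrite sqmodE sqr_ge0.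
split=> //; rewrite (le_lt_trans _ i)// le_eqVlt; apply/orP; left; apply/eqP.
apply: eq_integral => x _ /=; rewrite ger0_norm//.
by rewrite sqmodE sqr_ge0.
Qed.

Lemma L2_cmeas f : L2 f -> cmeas f. Proof. by move=> /L2P[]. Qed.

Lemma normcM_le (z w : C) : normc (z * w) <= normc z ^+ 2 + normc w ^+ 2.
Proof.
rewrite normcM; have := sqr_ge0 (normc z - normc w).
have := mulr_ge0 (normc_nneg z) (normc_nneg w); nra.
Qed.

Lemma cinteg_le f u : cmeas f -> rinteg u ->
  (forall x, Omega x -> normc (f x) <= u x) -> cinteg f.
Proof.
move=> [mr mi] iu fu; split; apply: (rinteg_le _ iu) => // x Ox.
  exact: le_trans (Re_le_normc _) (fu _ Ox).
exact: le_trans (Im_le_normc _) (fu _ Ox).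
Qed.

(** |zw| <= |z|^2 + |w|^2, so products of square-integrable functions are
    integrable. *)
Lemma L2M f g : L2 f -> L2 g -> cinteg (fun x => f x * g x).
Proof.
move=> /L2P[mf sf] /L2P[mg sg].
apply: (cinteg_le (cmeasM mf mg) (rintegD sf sg)) => x _.
by rewrite !sqmodE normcM_le.
Qed.

Lemma L2_cst (k : C) : L2 (fun=> k).
Proof.
apply/L2P; split; first exact: cmeas_cst.
exact: (rinteg_cst (Re k ^+ 2 + Im k ^+ 2)).
Qed.

Lemma L2_cinteg f : L2 f -> cinteg f.
Proof.
move=> Lf; have := L2M Lf (L2_cst 1).
by under eq_fun do rewrite mulr1.
Qed.

Lemma L2D f g : L2 f -> L2 g -> L2 (fun x => f x + g x).
Proof.
move=> /L2P[mf sf] /L2P[mg sg]; have m := cmeasD mf mg.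
apply/L2P; split => //.
apply: (rinteg_le (rmeas_sqmod m) (rintegZ 2 (rintegD sf sg))) => x _.
rewrite !sqmodE ger0_norm ?sqr_ge0//.
have := normc_triangle (f x) (g x); have := normc_nneg (f x + g x).
have := sqr_ge0 (normc (f x) - normc (g x)); nra.
Qed.

Lemma L2bM d f (B : R) : cmeas d -> (forall x, Omega x -> normc (d x) <= B) ->
  L2 f -> L2 (fun x => d x * f x).
Proof.
move=> md dB /L2P[mf sf]; have m := cmeasM md mf.
apply/L2P; split => //.
apply: (rinteg_le (rmeas_sqmod m) (rintegZ (B ^+ 2) sf)) => x Ox.
rewrite !sqmodE ger0_norm ?sqr_ge0// normcM exprMn ler_wpM2r ?sqr_ge0//.
by rewrite ler_pXn2r ?nnegrE ?normc_nneg// ?(le_trans (normc_nneg _) (dB _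
  Ox))// dB.
Qed.

Lemma L2_bounded d (B : R) : cmeas d ->
  (forall x, Omega x -> normc (d x) <= B) -> L2 d.
Proof.
move=> md dB; have := L2bM md dB (L2_cst 1).
by under eq_fun do rewrite mulr1.
Qed.

Lemma L2Z k f : L2 f -> L2 (fun x => k * f x).
Proof. by apply: (@L2bM (fun=> k) f (normc k)) => //; exact: cmeas_cst. Qed.

Lemma L2B f g : L2 f -> L2 g -> L2 (fun x => f x - g x).
Proof.
move=> Lf Lg; apply: L2D => //; under eq_fun do rewrite -mulN1r.
exact: L2Z.
Qed.

Lemma L2_conj f : L2 f -> L2 (fun x => conjc (f x)).
Proof.
move=> /L2P[mf sf]; apply/L2P; split; first exact: cmeas_conj.
rewrite (_ : sqmod _ = sqmod f)//; apply/funext => x.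
by rewrite /sqmod reF_conj imF_conj sqrrN.
Qed.

(** Cauchy-Schwarz replaced by the cruder bound by an L1 norm, which is
    enough because the first factor will always be uniformly small or
    bounded. *)
Lemma cint_bound phi : L2 phi -> exists2 M : R, 0 <= M &
  forall d (eps : R), cmeas d -> (forall x, Omega x -> normc (d x) <= eps) ->
  normc (cint (fun x => d x * phi x)) <= eps * M.
Proof.
move=> Lphi; have [ir ii] := L2_cinteg Lphi.
pose u x := `|reF phi x| + `|imF phi x|.
have iu : rinteg u by apply: rintegD; exact: rinteg_abs.
have u0 x : 0 <= u x by rewrite addr_ge0.
exists (2 * rint u) => [|d eps md deps].
  by rewrite mulr_ge0// rint_ge0.
have iue := rintegZ eps iu.
have dle x : Omega x -> normc (d x * phi x) <= eps * u x.
  move=> Ox; rewrite normcM ler_pM ?normc_nneg// ?deps//.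
  exact: normc_le_ReIm.
have [ir' ii'] : cinteg (fun x => d x * phi x).
  by apply: (cinteg_le _ iue) => //; apply: cmeasM => //; exact: L2_cmeas.
rewrite cintE (le_trans (normc_le_ReIm _))//= mulrCA mulr2n mulrDl mul1r.
rewrite -!rintZ// lerD// (le_trans (rint_abs _))// rint_le ?rinteg_abs// =>
  x Ox.
  exact: le_trans (Re_le_normc _) (dle _ Ox).
exact: le_trans (Im_le_normc _) (dle _ Ox).
Qed.

(** The square has measure one, so the L2 norm is at most the sup norm of any
    representative. *)
Lemma L2norm_le f (eps : R) : 0 <= eps -> cmeas f ->
  (exists2 g, aeO f g & (forall x, Omega x -> normc (g x) <= eps) /\ cmeas g) ->
  L2norm f <= eps.
Proof.
move=> e0 mf [g fg [ge mg]].
rewrite /L2norm -[leRHS]ger0_norm// -sqrtr_sqr ler_wsqrtr//.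
have <- : rint (sqmod g) = (\int[leb2]_(x in Omega) sqmod f x)%R.
  apply: rint_ae; [exact: rmeas_sqmod..|].
  exact: (aeO_comp (fun z : C => Re z ^+ 2 + Im z ^+ 2) (aeO_sym fg)).
rewrite -[leRHS]rint_cst; apply: rint_le.
- have := L2_bounded mg ge; by move=> /L2P[].
- exact: rinteg_cst.
- by move=> x Ox; rewrite sqmodE ler_pXn2r ?nnegrE ?normc_nneg ?ge.
Qed.

End Integrals.

(** * Differentiable functions and exponentials *)
Section Smooth.
Context {R : realType}.
Implicit Types (p q : R -> R) (u v : R * R -> R) (f g : fct R).
Local Notation C := R[i].

(** Derivatives are handled as a relation between a function and its
    derivative function, because the differentiation rules then compose
    without differentiability side conditions. *)
Definition has_deriv p (p' : R ->
  R) := forall t : R, is_derive t (1 : R) p (p' t).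

Fixpoint Ck (k : nat) p : Prop :=
  if k is k'.+1 then exists2 p', has_deriv p p' & Ck k' p' else continuous p.

Lemma has_deriv_cont p p' : has_deriv p p' -> continuous p.
Proof.
move=> pp' t; apply: differentiable_continuous; apply/derivable1_diffP.
by have [] := pp' t.
Qed.

Lemma Ck_cont k p : Ck k p -> continuous p.
Proof. by case: k => [//|k [p' pp' _]]; exact: has_deriv_cont pp'. Qed.

Lemma CkW k p : Ck k.+1 p -> Ck k p.
Proof.
elim: k p => [p /Ck_cont//|k IH p [p' pp' Cp']].
by exists p' => //; exact: IH.
Qed.

Lemma has_deriv_eq p p' p'' : has_deriv p p' -> (forall t, p' t = p'' t) ->
  has_deriv p p''.
Proof. by move=> pp' e t; rewrite -e. Qed.

Lemma has_deriv_ext p q p' : (forall t, p t = q t) -> has_deriv p p' ->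
  has_deriv q p'.
Proof. by move=> /funext ->. Qed.

Lemma has_derivD p q p' q' : has_deriv p p' -> has_deriv q q' ->
  has_deriv (fun t => p t + q t) (fun t => p' t + q' t).
Proof. by move=> pp' qq' t; apply: is_deriveD. Qed.

Lemma has_derivN p p' : has_deriv p p' ->
  has_deriv (fun t => - p t) (fun t => - p' t).
Proof. by move=> pp' t; apply: is_deriveN. Qed.

Lemma has_derivB p q p' q' : has_deriv p p' -> has_deriv q q' ->
  has_deriv (fun t => p t - q t) (fun t => p' t - q' t).
Proof. by move=> pp' qq'; apply: has_derivD => //; exact: has_derivN. Qed.

Lemma has_derivM p q p' q' : has_deriv p p' -> has_deriv q q' ->
  has_deriv (fun t => p t * q t) (fun t => p' t * q t + p t * q' t).
Proof.
move=> pp' qq' t.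
have := is_deriveM (pp' t) (qq' t).
by rewrite addrC /GRing.scale /= [q t * _]mulrC.
Qed.

Lemma has_deriv_cst (c : R) : has_deriv (fun=> c) (fun=> 0).
Proof. by move=> t; exact: is_derive_cst. Qed.

Lemma has_deriv_id : has_deriv id (fun=> 1).
Proof. by move=> t; exact: is_derive_id. Qed.

Lemma has_derivZ (c : R) p p' : has_deriv p p' ->
  has_deriv (fun t => c * p t) (fun t => c * p' t).
Proof.
move=> pp'; have := has_derivM (has_deriv_cst c) pp'.
by move=> H; apply: (has_deriv_eq H) => t; rewrite mul0r add0r.
Qed.

Lemma has_deriv_comp p q p' q' : has_deriv p p' -> has_deriv q q' ->
  has_deriv (fun t => p (q t)) (fun t => p' (q t) * q' t).
Proof.
move=> pp' qq' t.
have := @is_derive1_comp _ p q t (p' (q t)) (q' t).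
by apply.
Qed.

Lemma has_deriv_lin (c : R) p p' : has_deriv p p' ->
  has_deriv (fun t => p (c * t)) (fun t => c * p' (c * t)).
Proof.
move=> pp'; apply: (has_deriv_eq (has_deriv_comp pp' (has_derivZ c
  has_deriv_id))) => t.
by rewrite mulr1 mulrC.
Qed.

Lemma has_deriv_expR : has_deriv (@expR R) (@expR R).
Proof. by move=> t; exact: is_derive_expR. Qed.

Lemma CkD k p q : Ck k p -> Ck k q -> Ck k (fun t => p t + q t).
Proof.
elim: k p q => [p q cp cq t|k IH p q [p' pp' Cp'] [q' qq' Cq']].
  by apply: cvgD; [exact: cp|exact: cq].
by exists (fun t => p' t + q' t); [exact: has_derivD|exact: IH].
Qed.

Lemma Ck_cst k (c : R) : Ck k (fun=> c).
Proof.
elim: k c => [c t|k IH c]; first exact: cvg_cst.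
by exists (fun=> 0); [exact: has_deriv_cst|exact: IH].
Qed.

Lemma Ck_id k : Ck k id.
Proof.
case: k => [t|k]; first exact: cvg_id.
by exists (fun=> 1); [exact: has_deriv_id|exact: Ck_cst].
Qed.

Lemma CkM k p q : Ck k p -> Ck k q -> Ck k (fun t => p t * q t).
Proof.
elim: k p q => [p q cp cq t|k IH p q Cp Cq].
  by apply: cvgM; [exact: cp|exact: cq].
have [p' pp' Cp'] := Cp; have [q' qq' Cq'] := Cq.
exists (fun t => p' t * q t + p t * q' t); first exact: has_derivM.
by apply: CkD; apply: IH => //; exact: CkW.
Qed.

Lemma CkZ k (c : R) p : Ck k p -> Ck k (fun t => c * p t).
Proof. by apply: CkM; exact: Ck_cst. Qed.

Lemma CkX k n p : Ck k p -> Ck k (fun t => p t ^+ n).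
Proof.
move=> Cp; elim: n => [|n IH].
  by under eq_fun do rewrite expr0; exact: Ck_cst.
by under eq_fun do rewrite exprS; exact: CkM.
Qed.

Lemma Ck_comp k p q : Ck k p -> Ck k q -> Ck k (fun t => p (q t)).
Proof.
elim: k p q => [p q cp cq t|k IH p q [p' pp' Cp'] Cq].
  by apply: (continuous_comp (cq t) (cp _)).
have [q' qq' Cq'] := Cq.
exists (fun t => p' (q t) * q' t); first exact: has_deriv_comp.
by apply: CkM => //; apply: IH => //; exact: CkW.
Qed.

Definition has_pd1 u (u1 : R * R -> R) :=
  forall y, has_deriv (fun x => u (x, y)) (fun x => u1 (x, y)).
Definition has_pd2 u (u2 : R * R -> R) :=
  forall x, has_deriv (fun y => u (x, y)) (fun y => u2 (x, y)).

Lemma rpd1E u u1 : has_pd1 u u1 -> rpd1 u = u1.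
Proof.
move=> H; apply/funext => -[x y]; rewrite /rpd1 /= derive1E.
exact: (@derive_val _ _ _ _ _ _ _ (H y x)).
Qed.

Lemma rpd2E u u2 : has_pd2 u u2 -> rpd2 u = u2.
Proof.
move=> H; apply/funext => -[x y]; rewrite /rpd2 /= derive1E.
exact: (@derive_val _ _ _ _ _ _ _ (H x y)).
Qed.

Lemma rCk1 k u : rCk k.+1 u -> has_pd1 u (rpd1 u) /\ has_pd2 u (rpd2 u).
Proof.
case=> _ d1 d2 _ _; split=> [y x|x y]; apply: DeriveDef.
- exact: (d1 (x, y)).
- by rewrite /rpd1 derive1E.
- exact: (d2 (x, y)).
- by rewrite /rpd2 derive1E.
Qed.

Lemma rCkS k u u1 u2 : continuous u -> has_pd1 u u1 -> has_pd2 u u2 ->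
  rCk k u1 -> rCk k u2 -> rCk k.+1 u.
Proof.
move=> cu H1 H2 C1 C2 /=; rewrite (rpd1E H1) (rpd2E H2); split => // -[x y].
  by have [] := H1 y x.
by have [] := H2 x y.
Qed.

Lemma rCkD k u v : rCk k u -> rCk k v -> rCk k (fun x => u x + v x).
Proof.
elim: k u v => [u v cu cv t|k IH u v Cu Cv].
  by apply: cvgD; [exact: cu|exact: cv].
have [u1 u2] := rCk1 Cu; have [v1 v2] := rCk1 Cv.
case: (Cu) => cu _ _ Cu1 Cu2; case: (Cv) => cv _ _ Cv1 Cv2.
apply: (@rCkS _ _ (fun x => rpd1 u x + rpd1 v x) (fun x =>
  rpd2 u x + rpd2 v x)).
- by move=> t; apply: cvgD; [exact: cu|exact: cv].
- by move=> y; apply: has_derivD; [exact: u1|exact: v1].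
- by move=> y; apply: has_derivD; [exact: u2|exact: v2].
- exact: IH.
- exact: IH.
Qed.

Definition tensor p q : R * R -> R := fun x => p x.1 * q x.2.

Lemma tensor_cont p q : continuous p -> continuous q -> continuous (tensor p q).
Proof.
move=> cp cq [x y]; apply: cvgM.
  by apply: continuous_comp; [exact: cvg_fst|exact: cp].
by apply: continuous_comp; [exact: cvg_snd|exact: cq].
Qed.

(** All smooth functions needed here are sums of products p(x) q(y); their
    partial derivatives are again of this form, which makes the induction on
    k work. *)
Lemma rCk_tensor k p q : Ck k p -> Ck k q -> rCk k (tensor p q).
Proof.
elim: k p q => [p q cp cq|k IH p q Cp Cq]; first exact: tensor_cont.
have [p' pp' Cp'] := Cp; have [q' qq' Cq'] := Cq.
apply: (@rCkS _ _ (tensor p' q) (tensor p q')).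
- by apply: tensor_cont; exact: (@Ck_cont k.+1).
- move=> y; rewrite /tensor /=;
  apply: (has_deriv_eq (has_derivM pp' (has_deriv_cst (q y)))) => t.
  by rewrite mulr0 addr0.
- by move=> x; exact: (has_derivZ (p x) qq').
- by apply: IH => //; exact: CkW.
- by apply: IH => //; exact: CkW.
Qed.

Definition has_cderiv (P P' : R -> C) :=
  has_deriv (fun t => Re (P t)) (fun t => Re (P' t)) /\
  has_deriv (fun t => Im (P t)) (fun t => Im (P' t)).

Lemma has_cderivM (P Q P' Q' : R -> C) : has_cderiv P P' -> has_cderiv Q Q' ->
  has_cderiv (fun t => P t * Q t) (fun t => P' t * Q t + P t * Q' t).
Proof.
move=> [Pr Pi] [Qr Qi]; split.
  apply: (@has_deriv_ext (fun t => Re (P t) * Re (Q t) - Im (P t) * Im (Q t))).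
    by move=> t; rewrite Re_mul.
  apply: (has_deriv_eq (has_derivB (has_derivM Pr Qr) (has_derivM Pi Qi))) => t.
  by rewrite Re_add !Re_mul; ring.
apply: (@has_deriv_ext (fun t => Re (P t) * Im (Q t) + Im (P t) * Re (Q t))).
  by move=> t; rewrite Im_mul.
apply: (has_deriv_eq (has_derivD (has_derivM Pr Qi) (has_derivM Pi Qr))) => t.
by rewrite Im_add !Im_mul; ring.
Qed.

Lemma has_cderivD (P Q P' Q' : R -> C) : has_cderiv P P' -> has_cderiv Q Q' ->
  has_cderiv (fun t => P t + Q t) (fun t => P' t + Q' t).
Proof.
move=> [Pr Pi] [Qr Qi]; split.
  apply: (@has_deriv_ext (fun t => Re (P t) + Re (Q t))).
    by move=> t; rewrite Re_add.
  by apply: (has_deriv_eq (has_derivD Pr Qr)) => t; rewrite Re_add.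
apply: (@has_deriv_ext (fun t => Im (P t) + Im (Q t))).
  by move=> t; rewrite Im_add.
by apply: (has_deriv_eq (has_derivD Pi Qi)) => t; rewrite Im_add.
Qed.

Lemma has_cderiv_cst (c : C) : has_cderiv (fun=> c) (fun=> 0).
Proof. by split; exact: has_deriv_cst. Qed.

Lemma has_cderiv_eq (P P' P'' : R -> C) :
  has_cderiv P P' -> (forall t, P' t = P'' t) -> has_cderiv P P''.
Proof. by move=> H /funext <-. Qed.

Lemma has_cderivZ (c : C) (P P' : R -> C) : has_cderiv P P' ->
  has_cderiv (fun t => c * P t) (fun t => c * P' t).
Proof.
move=> H; apply: (has_cderiv_eq (has_cderivM (has_cderiv_cst c) H)) => t.
by rewrite mul0r add0r.
Qed.

Definition has_cpd1 f g := forall y, has_cderiv (fun x => f (x,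
  y)) (fun x => g (x, y)).
Definition has_cpd2 f g := forall x, has_cderiv (fun y => f (x,
  y)) (fun y => g (x, y)).

Lemma pd1E f g : has_cpd1 f g -> pd1 f = g.
Proof.
move=> H; apply/funext => x; rewrite /pd1.
rewrite (@rpd1E (reF f) (reF g)) 1?(@rpd1E (imF f) (imF g)).
- by rewrite /reF /imF; case: (g x).
- by move=> y; have [] := H y.
- by move=> y; have [] := H y.
Qed.

Lemma pd2E f g : has_cpd2 f g -> pd2 f = g.
Proof.
move=> H; apply/funext => x; rewrite /pd2.
rewrite (@rpd2E (reF f) (reF g)) 1?(@rpd2E (imF f) (imF g)).
- by rewrite /reF /imF; case: (g x).
- by move=> y; have [] := H y.
- by move=> y; have [] := H y.
Qed.

Lemma smooth_D f : smooth f -> has_cpd1 f (pd1 f) /\ has_cpd2 f (pd2 f).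
Proof.
move=> /(_ 1%N)[/rCk1[a b] /rCk1[c d]]; split=> t; split.
- exact: a. - exact: c. - exact: b. - exact: d.
Qed.

Definition ccont f := continuous (reF f) /\ continuous (imF f).

Lemma smooth_cont f : smooth f -> ccont f.
Proof. by move=> /(_ 0%N)[]. Qed.

Lemma smooth_pd1 f : smooth f -> smooth (pd1 f).
Proof. by move=> sf k; have [[_ _ _ ? _] [_ _ _ ? _]] := sf k.+1. Qed.

Lemma smooth_pd2 f : smooth f -> smooth (pd2 f).
Proof. by move=> sf k; have [[_ _ _ _ ?] [_ _ _ _ ?]] := sf k.+1. Qed.

Lemma smoothD f g : smooth f -> smooth g -> smooth (fun x => f x + g x).
Proof.
move=> sf sg k; have [? ?] := sf k; have [? ?] := sg k.
by rewrite reF_D imF_D; split; exact: rCkD.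
Qed.

Lemma smooth_laplacian f : smooth f -> smooth (laplacian f).
Proof.
move=> sf; apply: smoothD; first exact/smooth_pd1/smooth_pd1.
exact/smooth_pd2/smooth_pd2.
Qed.

Lemma ccontD f g : ccont f -> ccont g -> ccont (fun x => f x + g x).
Proof.
move=> [a b] [c d]; rewrite /ccont reF_D imF_D.
by split=> t; apply: cvgD; [exact: a|exact: c|exact: b|exact: d].
Qed.
Lemma ccontM f g : ccont f -> ccont g -> ccont (fun x => f x * g x).
Proof.
move=> [a b] [c d]; rewrite /ccont reF_M imF_M.
split=> t.
  by apply: cvgB; apply: cvgM; [exact: a|exact: c|exact: b|exact: d].
by apply: cvgD; apply: cvgM; [exact: a|exact: d|exact: b|exact: c].
Qed.
Lemma ccont_cst (k : C) : ccont (fun=> k).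
Proof. by split=> t; exact: cvg_cst. Qed.
Lemma ccontZ (k : C) f : ccont f -> ccont (fun x => k * f x).
Proof. by apply: ccontM; exact: ccont_cst. Qed.

Definition cexp (a : C) (t : R) : C :=
  (expR (Re a * t) * cos (Im a * t)) +i* (expR (Re a * t) * sin (Im a * t)).

Lemma cexpD (a b : C) t : cexp (a + b) t = cexp a t * cexp b t.
Proof.
apply: complex_ext; rewrite ?Re_mul ?Im_mul /= Re_add Im_add !mulrDl expRD ?cosD
  ?sinD;
  ring.
Qed.

Lemma cexp_conj a t : conjc (cexp a t) = cexp (conjc a) t.
Proof. by case: a => a b; rewrite /cexp /= mulNr cosN sinN mulrN. Qed.

Lemma cexp0 t : cexp 0 t = 1.
Proof. by rewrite /cexp /= !mul0r expR0 cos0 sin0 mulr1 mulr0. Qed.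

Lemma cexpa0 a : cexp a 0 = 1.
Proof. by rewrite /cexp /= !mulr0 expR0 cos0 sin0 mulr1 mulr0. Qed.

Lemma normc_cexp a t : normc (cexp a t) = expR (Re a * t).
Proof.
rewrite /normc /cexp !exprMn -mulrDr cos2Dsin2 mulr1 sqrtr_sqr.
by rewrite ger0_norm// expR_ge0.
Qed.

(** A family closed under differentiation that contains the real and
    imaginary parts of every exponential. *)
Definition exp_cos_sin (a b A B : R) (t : R) :=
  expR (a * t) * (A * cos (b * t) + B * sin (b * t)).

Lemma has_deriv_exp_cos_sin a b A B : has_deriv (exp_cos_sin a b A B)
  (exp_cos_sin a b (a * A + b * B) (a * B - b * A)).
Proof.
have Dc : has_deriv (fun t => cos (b * t)) (fun t => b * - sin (b * t)).
  by apply: (@has_deriv_lin b cos (fun t => - sin t)) => t;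
    exact: is_derive_cos.
have Ds : has_deriv (fun t => sin (b * t)) (fun t => b * cos (b * t)).
  by apply: (@has_deriv_lin b sin cos) => t; exact: is_derive_sin.
have De := has_deriv_lin a has_deriv_expR.
apply: (has_deriv_eq (has_derivM De (has_derivD (has_derivZ A Dc) (has_derivZ B
  Ds)))) => t.
by rewrite /exp_cos_sin; ring.
Qed.

Lemma Ck_exp_cos_sin k a b A B : Ck k (exp_cos_sin a b A B).
Proof.
elim: k A B => [A B|k IH A B];
  first exact: (has_deriv_cont (@has_deriv_exp_cos_sin a b A B)).
by eexists; [exact: has_deriv_exp_cos_sin|exact: IH].
Qed.

Lemma Re_cexp a : (fun t => Re (cexp a t)) = exp_cos_sin (Re a) (Im a) 1 0.
Proof. by apply/funext => t; rewrite /exp_cos_sin /=; ring. Qed.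
Lemma Im_cexp a : (fun t => Im (cexp a t)) = exp_cos_sin (Re a) (Im a) 0 1.
Proof. by apply/funext => t; rewrite /exp_cos_sin /=; ring. Qed.

Lemma has_cderiv_cexp a : has_cderiv (cexp a) (fun t => a * cexp a t).
Proof.
split; rewrite ?Re_cexp ?Im_cexp;
  apply: (has_deriv_eq (@has_deriv_exp_cos_sin _ _ _ _)) => t.
  by rewrite Re_mul /exp_cos_sin /=; ring.
by rewrite Im_mul /exp_cos_sin /=; ring.
Qed.

Definition pexp (a b : C) : fct R := fun x => cexp a x.1 * cexp b x.2.

Lemma smooth_pexp a b : smooth (pexp a b).
Proof.
move=> k; rewrite /pexp.
have Cr c : Ck k (fun t => Re (cexp c t)) by rewrite Re_cexp;
  exact: Ck_exp_cos_sin.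
have Ci c : Ck k (fun t => Im (cexp c t)) by rewrite Im_cexp;
  exact: Ck_exp_cos_sin.
split.
  rewrite (_ : reF _ = fun x => tensor (fun t => Re (cexp a t)) (fun t =>
    Re (cexp b t)) x
     + tensor (fun t => -1 * Im (cexp a t)) (fun t => Im (cexp b t)) x).
    by apply: rCkD; apply: rCk_tensor => //; exact: CkZ.
  by apply/funext => x; rewrite /reF Re_mul /tensor; ring.
rewrite (_ : imF _ = fun x => tensor (fun t => Re (cexp a t)) (fun t =>
  Im (cexp b t)) x
   + tensor (fun t => Im (cexp a t)) (fun t => Re (cexp b t)) x).
  by apply: rCkD; apply: rCk_tensor.
by apply/funext => x; rewrite /imF Im_mul /tensor; ring.
Qed.

Lemma has_cpd1_pexp a b : has_cpd1 (pexp a b) (fun x => a * pexp a b x).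
Proof.
move=> y; rewrite /pexp /=.
apply: (has_cderiv_eq (has_cderivM (has_cderiv_cexp a) (has_cderiv_cst (cexp b
  y)))) => t.
by rewrite mulr0 addr0 mulrA.
Qed.

Lemma has_cpd2_pexp a b : has_cpd2 (pexp a b) (fun x => b * pexp a b x).
Proof.
move=> x; rewrite /pexp /=.
apply: (has_cderiv_eq (has_cderivZ (cexp a x) (has_cderiv_cexp b))) => t.
by rewrite mulrCA.
Qed.

Lemma has_cpd1Z (c : C) f g : has_cpd1 f g ->
  has_cpd1 (fun x => c * f x) (fun x => c * g x).
Proof. by move=> H y; exact: has_cderivZ. Qed.
Lemma has_cpd2Z (c : C) f g : has_cpd2 f g ->
  has_cpd2 (fun x => c * f x) (fun x => c * g x).
Proof. by move=> H y; exact: has_cderivZ. Qed.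

Lemma pd1_pexp a b : pd1 (pexp a b) = fun x => a * pexp a b x.
Proof. exact/pd1E/has_cpd1_pexp. Qed.
Lemma pd2_pexp a b : pd2 (pexp a b) = fun x => b * pexp a b x.
Proof. exact/pd2E/has_cpd2_pexp. Qed.

Lemma laplacian_pexp a b : laplacian (pexp a b) = fun x =>
  (a ^+ 2 + b ^+ 2) * pexp a b x.
Proof.
apply/funext => x; rewrite /laplacian pd1_pexp pd2_pexp.
rewrite (pd1E (has_cpd1Z a (has_cpd1_pexp a b))) (pd2E (has_cpd2Z b
  (has_cpd2_pexp a b))).
by rewrite mulrDl !expr2 !mulrA.
Qed.

Lemma pexpD a b c d x : pexp (a + b) (c + d) x = pexp a c x * pexp b d x.
Proof. by rewrite /pexp !cexpD; ring. Qed.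

Lemma pexp00 x : pexp 0 0 x = 1.
Proof. by rewrite /pexp !cexp0 mulr1. Qed.

Lemma pexp_conj a b x : conjc (pexp a b x) = pexp (conjc a) (conjc b) x.
Proof. by rewrite /pexp -!cexp_conj; exact: (rmorphM (@conjc R)). Qed.

Lemma classical_BC_pexp (h : R * R) a b : cexp a 1 = h.1%:C ->
  cexp b 1 = h.2%:C ->
  classical_BC h (pexp a b).
Proof.
move=> ea eb t _; rewrite pd1_pexp pd2_pexp /pexp /= ea eb !cexpa0.
by split; ring.
Qed.

End Smooth.

(** * Integration by parts *)
Section IBP.
Context {R : realType}.
Implicit Types (p q : R -> R) (u v : R * R -> R) (f g : fct R).
Local Notation C := R[i].
Local Notation Omega := (@Omega R).
Local Notation leb2 := (@leb2 R).
Local Notation M := (measurableTypeR R).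
Local Notation T := (measurableTypeR R * measurableTypeR R)%type.

(** The plane is second countable: an open set is the union of the open boxes
    with rational corners that it contains. *)
Lemma open_measurable_prod (U : set (R * R)) : open U -> measurable (U : set T).
Proof.
move=> oU.
pose bx (i : (rat * rat) * (rat * rat)) : set (R * R) :=
  `](ratr i.1.1), (ratr i.1.2)[ `*` `](ratr i.2.1), (ratr i.2.2)[.
pose F i := if `[< bx i `<=` U >] then bx i else set0.
have -> : U = \bigcup_i F i.
  apply/seteqP; split => [[x y] Uxy|z [i _]]; last first.
    by rewrite /F; case: asboolP => // s /s.
  have /nbhs_ballP[e /= e0 eU] := open_nbhs_nbhs (conj oU Uxy).
  have half (t : R) : exists ab : rat * rat,
      (t \in `](ratr ab.1), (ratr ab.2)[) /\
      (forall s, s \in `](ratr ab.1), (ratr ab.2)[ -> ball t e s).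
    have /rat_in_itvoo[a] : t - e < t by lra.
    have /rat_in_itvoo[b] : t < t + e by lra.
    rewrite !in_itv /= => /andP[b1 b2] /andP[a1 a2].
    exists (a, b); rewrite in_itv /= a2 b1; split => // s.
    rewrite in_itv /= => /andP[s1 s2].
    by rewrite /ball /= /ball_ ltr_norml; apply/andP; split; lra.
  have [abx [x1 x2]] := half x; have [aby [y1 y2]] := half y.
  exists (abx, aby) => //; rewrite /F asboolT /bx.
    by split.
  move=> [s t] [/= sx ty]; apply: eU; split => /=; [exact: x2|exact: y2].
apply: countable_bigcupT_measurable; first exact: countableP.
move=> i; rewrite /F; case: ifP => // _.
by apply: measurableX; exact: measurable_itv.
Qed.

Lemma cont_measurable u : continuous u -> measurable_fun setT (u : T -> R).
Proof.
move=> /continuousP cu; apply: (measurability _ (RGenOpens.measurableE R)).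
move=> _ [_ [a [b ->] <-]]; rewrite setTI.
by apply: open_measurable_prod; apply: cu; exact: interval_open.
Qed.

Lemma cont_rmeas u : continuous u -> rmeas u.
Proof. by move=> cu; apply: measurable_funTS; exact: cont_measurable. Qed.

Lemma cont_bounded u : continuous u ->
  exists B : R, forall x, Omega x -> `|u x| <= B.
Proof.
move=> cu.
have cK : compact (`[0, 1]%classic `*` `[0, 1]%classic : set (R * R)).
  by apply: compact_setX; exact: segment_compact.
have : bounded_set (u @` (`[0, 1]%classic `*` `[0, 1]%classic)).
  apply: compact_bounded; apply: continuous_compact => //.
  exact: continuous_subspaceT.
move=> [B [_ /(_ (B + 1))]] H; exists (B + 1) => -[x y] [/= xI yI].
apply: H; first by rewrite ltrDl.
exists (x, y) => //; split => /=; exact: subset_itv_oo_cc.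
Qed.

Lemma cont_rinteg u : continuous u -> rinteg u.
Proof.
move=> cu; have [B uB] := cont_bounded cu.
exact: (rinteg_bounded (cont_rmeas cu) uB).
Qed.

(** Fundamental theorem of calculus for a function with equal endpoint
    values. *)
Lemma integral_oo01 p p' : has_deriv p p' -> continuous p' -> p 1 = p 0 ->
  (\int[lebesgue_measure]_(x in `]0%R, 1%R[) (p' x)%:E = 0)%E.
Proof.
move=> pp' cp' p10.
have mp' : measurable_fun setT p' by exact: continuous_measurable_fun.
rewrite integral_itv_obnd_cbnd; last first.
  by apply/measurable_EFinP; exact: measurable_funTS.
rewrite integral_itv_bndo_bndc; last first.
  by apply/measurable_EFinP; exact: measurable_funTS.
rewrite (@continuous_FTC2 _ p' p 0 1)// ?p10 ?subee//.
- exact: continuous_subspaceT.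
- split=> [x _| |]; first by have [] := pp' x.
    by apply: cvg_at_right_filter; exact: (has_deriv_cont pp').
  by apply: cvg_at_left_filter; exact: (has_deriv_cont pp').
- by move=> x _; rewrite derive1E; exact: (@derive_val _ _ _ _ _ _ _ (pp' x)).
Qed.

Lemma rinteg_patch u : rinteg u ->
  leb2.-integrable setT ((EFin \o u) \_ Omega : T -> _).
Proof. by move=> iu; exact: (proj1 (integrable_mkcond _ measurable_Omega) iu).
  Qed.

(** By Fubini, integrate in the first variable along each horizontal line;
    the periodicity of [u] kills the line integral. All integrations by parts
    below are instances of this lemma and of its twin. *)
Lemma rint_pd1 u u1 : has_pd1 u u1 -> continuous u1 ->
  (forall y, 0 <= y <= 1 -> u (1, y) = u (0, y)) -> rint u1 = 0.
Proof.
move=> D cu1 u01; rewrite /rint /Rintegral integral_mkcond.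
have iu := rinteg_patch (cont_rinteg cu1).
rewrite [X in fine X](_ : _ = \int[lebesgue_measure]_y
   fubini_G lebesgue_measure ((EFin \o u1) \_ Omega : T -> _) y)%E; last first.
  by rewrite integral21_prod_meas1.
rewrite integral0_eq// => y _; rewrite /fubini_G.
have [y01|y01] := boolP (y \in `]0, 1[%R).
  rewrite [LHS](_ : _ = \int[lebesgue_measure]_(x in `]0%R, 1%R[) (u1 (x,
    y))%:E)%E.
    apply: (@integral_oo01 (fun x => u (x, y))); first exact: D.
      move=> x; apply: (@continuous_comp _ _ _ (fun x => (x, y)) u1).
        exact: (cvg_pair (@cvg_id _ (nbhs x)) (@cvg_cst _ y _ (nbhs x) _)).
      exact: cu1.
    by apply: u01; move: y01; rewrite in_itv /= => /andP[/ltW -> /ltW ->].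
  rewrite [RHS]integral_mkcond; apply: eq_integral => x _.
  rewrite !patchE; have [x01|x01] := boolP (x \in `]0, 1[%classic).
    by rewrite mem_set//; split => //=; move: x01; rewrite inE.
  by rewrite memNset//= => -[/= x01'] _; move/negP: x01; apply; exact: mem_set.
rewrite integral0_eq// => x _; rewrite patchE memNset//= => -[/= _].
by apply/negP.
Qed.

Lemma rint_pd2 u u2 : has_pd2 u u2 -> continuous u2 ->
  (forall x, 0 <= x <= 1 -> u (x, 1) = u (x, 0)) -> rint u2 = 0.
Proof.
move=> D cu1 u01; rewrite /rint /Rintegral integral_mkcond.
have iu := rinteg_patch (cont_rinteg cu1).
rewrite [X in fine X](_ : _ = \int[lebesgue_measure]_y
   fubini_F lebesgue_measure ((EFin \o u2) \_ Omega : T -> _) y)%E; last first.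
  by rewrite integral12_prod_meas1.
rewrite integral0_eq// => x _; rewrite /fubini_F.
have [x01|x01] := boolP (x \in `]0, 1[%R).
  rewrite [LHS](_ : _ = \int[lebesgue_measure]_(y in `]0%R, 1%R[) (u2 (x,
    y))%:E)%E.
    apply: (@integral_oo01 (fun y => u (x, y))); first exact: D.
      move=> y; apply: (@continuous_comp _ _ _ (fun y => (x, y)) u2).
        exact: (cvg_pair (@cvg_cst _ x _ (nbhs y) _) (@cvg_id _ (nbhs y))).
      exact: cu1.
    by apply: u01; move: x01; rewrite in_itv /= => /andP[/ltW -> /ltW ->].
  rewrite [RHS]integral_mkcond; apply: eq_integral => y _.
  rewrite !patchE; have [y01|y01] := boolP (y \in `]0, 1[%classic).
    by rewrite mem_set//; split => //=; move: y01; rewrite inE.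
  by rewrite memNset//= => -[/= _ y01']; move/negP: y01; apply; exact: mem_set.
rewrite integral0_eq// => y _; rewrite patchE memNset//= => -[/= x01' _].
by move: x01; rewrite x01'.
Qed.

Lemma ccont_cinteg f : ccont f -> cinteg f.
Proof. by move=> [? ?]; split; exact: cont_rinteg. Qed.

Lemma ccont_L2 f : ccont f -> L2 f.
Proof.
move=> [cr ci]; have [Br rB] := cont_bounded cr;
  have [Bi iB] := cont_bounded ci.
apply: (@L2_bounded _ _ (Br + Bi)); first by split; exact: cont_rmeas.
move=> x Ox; rewrite (le_trans (normc_le_ReIm _))// lerD//.
  exact: rB.
exact: iB.
Qed.

Lemma cint_pd1 f g : has_cpd1 f g -> ccont g ->
  (forall y, 0 <= y <= 1 -> f (1, y) = f (0, y)) -> cint g = 0.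
Proof.
move=> D [cr ci] f01; rewrite cintE.
rewrite (@rint_pd1 (reF f) (reF g)) ?(@rint_pd1 (imF f) (imF g))//.
- by move=> y; have [] := D y.
- by move=> y y01; rewrite /imF f01.
- by move=> y; have [] := D y.
- by move=> y y01; rewrite /reF f01.
Qed.

Lemma cint_pd2 f g : has_cpd2 f g -> ccont g ->
  (forall x, 0 <= x <= 1 -> f (x, 1) = f (x, 0)) -> cint g = 0.
Proof.
move=> D [cr ci] f01; rewrite cintE.
rewrite (@rint_pd2 (reF f) (reF g)) ?(@rint_pd2 (imF f) (imF g))//.
- by move=> y; have [] := D y.
- by move=> y y01; rewrite /imF f01.
- by move=> y; have [] := D y.
- by move=> y y01; rewrite /reF f01.
Qed.

Lemma ccont_pexp a b : ccont (@pexp R a b).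
Proof. exact/smooth_cont/smooth_pexp. Qed.

(** E phi_xx - a^2 E phi is the x-derivative of E phi_x - a E phi, and this
    function takes equal values on opposite sides: the factor h_1 gained by E
    cancels the factor 1/h_1 gained by phi and phi_x. The same in y. *)
Lemma green_pexp (h : R * R) a b (phi : fct R) : 0 < h.1 -> 0 < h.2 ->
  cexp a 1 = h.1%:C -> cexp b 1 = h.2%:C ->
  smooth phi -> classical_BC (h.1^-1, h.2^-1) phi ->
  pairing (pexp a b) (laplacian phi) =
    (a ^+ 2 + b ^+ 2) * pairing (pexp a b) phi.
Proof.
move=> h1 h2 ea eb sphi bc.
have cE := ccont_pexp a b.
have cphi := smooth_cont sphi.
have [d1 d2] := smooth_D sphi.
have [d11 _] := smooth_D (smooth_pd1 sphi).
have [_ d22] := smooth_D (smooth_pd2 sphi).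
have c11 := smooth_cont (smooth_pd1 (smooth_pd1 sphi)).
have c22 := smooth_cont (smooth_pd2 (smooth_pd2 sphi)).
have hC (k : R) : 0 < k -> k%:C * (k^-1)%:C = 1 :> C.
  by move=> k0; rewrite -rmorphM /= divff ?gt_eqF.
have e1 : cint (fun x => pexp a b x * pd1 (pd1 phi) x + - a ^+ 2 * (pexp a b x *
  phi x)) = 0.
  apply: (@cint_pd1 (fun x => pexp a b x * pd1 phi x + (- a) * (pexp a b x * phi
    x))).
  - move=> y.
    apply: (has_cderiv_eq (has_cderivD (has_cderivM (has_cpd1_pexp a b y) (d11
      y)) (has_cderivZ (- a) (has_cderivM (has_cpd1_pexp a b y) (d1 y))))) => t.
    by ring.
  - by apply: ccontD; [exact: ccontM|apply: ccontZ; exact: ccontM].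
  - move=> y /bc[/= <- <- _ _]; rewrite /pexp /= ea cexpa0.
    have := hC h.1 h1; set k := (h.1)%:C; set k' := (h.1^-1)%:C => kk.
    by ring: kk.
have e2 : cint (fun x => pexp a b x * pd2 (pd2 phi) x + - b ^+ 2 * (pexp a b x *
  phi x)) = 0.
  apply: (@cint_pd2 (fun x => pexp a b x * pd2 phi x + (- b) * (pexp a b x * phi
    x))).
  - move=> y.
    apply: (has_cderiv_eq (has_cderivD (has_cderivM (has_cpd2_pexp a b y) (d22
      y)) (has_cderivZ (- b) (has_cderivM (has_cpd2_pexp a b y) (d2 y))))) => t.
    by ring.
  - by apply: ccontD; [exact: ccontM|apply: ccontZ; exact: ccontM].
  - move=> y /bc[/= _ _ <- <-]; rewrite /pexp /= eb cexpa0.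
    have := hC h.2 h2; set k := (h.2)%:C; set k' := (h.2^-1)%:C => kk.
    by ring: kk.
have iE := ccont_cinteg (ccontM cE cphi).
have i1 := ccont_cinteg (ccontM cE c11).
have i2 := ccont_cinteg (ccontM cE c22).
move: e1 e2; rewrite !cintD//; [|exact: cintegZ..].
rewrite !cintZ// => e1 e2.
rewrite /pairing [LHS](_ : _ = cint (fun x =>
  pexp a b x * pd1 (pd1 phi) x + pexp a b x * pd2 (pd2 phi) x)).
  rewrite cintD//.
  move: e1 e2; generalize (cint (fun x => pexp a b x * pd1 (pd1 phi) x)).
  generalize (cint (fun x => pexp a b x * pd2 (pd2 phi) x)).
  generalize (cint (fun x => pexp a b x * phi x)) => P B A e1 e2.
  apply/eqP; rewrite -subr_eq0; apply/eqP; rewrite -[RHS](addr0 0) -{1}e1 -e2.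
  by ring.
by congr cint; apply/funext => x; rewrite /laplacian mulrDr.
Qed.

(** A nonconstant periodic exponential is a derivative of a periodic
    function. *)
Lemma cint_pexp_period a b : cexp a 1 = 1 -> cexp b 1 = 1 ->
  (a != 0) || (b != 0) ->
  cint (@pexp R a b) = 0.
Proof.
move=> ea eb /orP[a0|b0].
  suff : a * cint (pexp a b) = 0 by move/eqP;
    rewrite mulf_eq0 (negbTE a0) => /eqP.
  rewrite -cintZ; last exact/ccont_cinteg/ccont_pexp.
  apply: (cint_pd1 (has_cpd1_pexp a b)); first exact/ccontZ/ccont_pexp.
  by move=> y _; rewrite /pexp /= ea cexpa0.
suff : b * cint (pexp a b) = 0 by move/eqP;
  rewrite mulf_eq0 (negbTE b0) => /eqP.
rewrite -cintZ; last exact/ccont_cinteg/ccont_pexp.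
apply: (cint_pd2 (has_cpd2_pexp a b)); first exact/ccontZ/ccont_pexp.
by move=> y _; rewrite /pexp /= eb cexpa0.
Qed.
End IBP.

(** * Vanishing almost everywhere *)
Section Density.
Context {R : realType}.
Implicit Types (u v : R * R -> R).
Local Notation Omega := (@Omega R).
Local Notation leb2 := (@leb2 R).
Local Notation M := (measurableTypeR R).
Local Notation T := (measurableTypeR R * measurableTypeR R)%type.

Definition open_box (a b c d : R) : set (R * R) := `]a, b[ `*` `]c, d[.

Definition open_boxes : set (set (R * R)) :=
  [set A | exists a b c d : R, A = open_box a b c d].

Lemma measurable_open_box a b c d : measurable (open_box a b c d : set T).
Proof. by apply: measurableX; exact: measurable_itv. Qed.

Lemma bigcup_sym_itv : \bigcup_n `](- n%:R : R), n%:R[%classic = setT.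
Proof.
apply/seteqP; split => // x _; exists (Num.bound `|x|) => //=.
rewrite in_itv /= -ltr_norml.
exact: archi_boundP (normr_ge0 x).
Qed.

(** Preimages of intervals under the two projections are increasing unions of
    boxes, so both projections are measurable for the generated sigma-
    algebra. *)
Lemma measurable_open_boxes : @measurable _ T = <<s open_boxes >>.
Proof.
apply/seteqP; split; last first.
  apply: smallest_sub; first exact: sigma_algebra_measurable.
  by move=> _ [a [b [c [d ->]]]]; exact: measurable_open_box.
rewrite measurable_prod_measurableType.
apply: smallest_sub; first exact: smallest_sigma_algebra.
move=> _ [A mA [B mB <-]].
pose S := g_sigma_algebraType open_boxes.
have mfst : measurable_fun setT (fst : S -> R).
  apply: (measurability _ (RGenOpens.measurableE R)).
  move=> _ [_ [a [b ->] <-]]; rewrite setTI.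
  have -> : (fst : S -> R) @^-1` `]a, b[%classic =
      \bigcup_n (open_box a b (- n%:R) n%:R : set S).
    rewrite /open_box -setX_bigcupr bigcup_sym_itv.
    by apply/seteqP; split => [[x y]|[x y] []] //= ?; split.
  apply: bigcupT_measurable => n; apply: sub_sigma_algebra.
  by exists a, b, (- n%:R), n%:R.
have msnd : measurable_fun setT (snd : S -> R).
  apply: (measurability _ (RGenOpens.measurableE R)).
  move=> _ [_ [a [b ->] <-]]; rewrite setTI.
  have -> : (snd : S -> R) @^-1` `]a, b[%classic =
      \bigcup_n (open_box (- n%:R) n%:R a b : set S).
    rewrite /open_box -setX_bigcupl bigcup_sym_itv.
    by apply/seteqP; split => [[x y]|[x y] []] //= ?; split.
  apply: bigcupT_measurable => n; apply: sub_sigma_algebra.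
  by exists (- n%:R), n%:R, a, b.
have := measurableI _ _ (mfst measurableT A mA) (msnd measurableT B mB).
by rewrite !setTI.
Qed.

(** Open boxes are stable under intersection and generate the sigma-algebra,
    so by Dynkin's theorem the integral over every measurable set vanishes. *)
Lemma ae0_of_boxes u : rinteg u ->
  (forall a b c d, 0 <= a -> a < b -> b <= 1 -> 0 <= c -> c < d -> d <= 1 ->
    (\int[leb2]_(x in open_box a b c d) (u x)%:E = 0)%E) ->
  aeO u (fun=> 0).
Proof.
move=> iu box0.
have iS (E : set T) : measurable E ->
  leb2.-integrable (Omega `&` E) (EFin \o u : T -> _).
  move=> mE; apply: (integrableS _ _ _ iu) => //; first exact: measurable_Omega.
    by apply: measurableI => //; exact: measurable_Omega.
have OmegaE : Omega = open_box 0 1 0 1 by [].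
have all0 (E : set T) : measurable E ->
    (\int[leb2]_(x in Omega `&` E) (u x)%:E = 0)%E.
  move=> mE.
  apply: (dynkin_induction (G := open_boxes) (P := fun E : set T =>
    (\int[leb2]_(x in Omega `&` E) (u x)%:E = 0)%E)).
  - exact: measurable_open_boxes.
  - move=> _ _ [a [b [c [d ->]]]] [a' [b' [c' [d' ->]]]].
    exists (Num.max a a'), (Num.min b b'), (Num.max c c'), (Num.min d d').
    rewrite /open_box -setXI; congr (_ `*` _); apply/seteqP; split => x /=;
      by rewrite !in_itv /= gt_max lt_min => *; lra.
  - by rewrite setIT OmegaE; apply: box0; rewrite ?ltr01.
  - move=> _ [a [b [c [d ->]]]] /=.
    have -> : Omega `&` open_box a b c d =
        open_box (Num.max 0 a) (Num.min 1 b) (Num.max 0 c) (Num.min 1 d).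
      rewrite OmegaE /open_box -setXI; congr (_ `*` _); apply/seteqP;
        split => x /=;
        by rewrite !in_itv /= gt_max lt_min => *; lra.
    have [ab|ba] := ltP (Num.max 0 a) (Num.min 1 b); last first.
      by rewrite /open_box set_itv_ge ?bnd_simp -?leNgt// set0X integral_set0.
    have [cd|dc] := ltP (Num.max 0 c) (Num.min 1 d); last first.
      by rewrite /open_box (@set_itv_ge _ _ _ (BLeft (Num.min 1 d))) ?bnd_simp
        -?leNgt// setX0 integral_set0.
    by apply: box0; rewrite ?le_max ?ge_min ?lexx.
  - move=> S mS S0.
    have := @integral_setU_EFin _ _ _ leb2 (Omega `&` S) (Omega `&` ~` S) u.
    rewrite -setIUr setUv setIT => H.
    have := H; rewrite OmegaE box0 ?ltr01// -OmegaE S0 add0e => <- //.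
    + by apply: measurableI => //; exact: measurable_Omega.
    + by apply: measurableI; [exact: measurable_Omega|exact: measurableC].
    + exact: rinteg_meas.
    + by apply/disj_setPS => x [[_ ?] [_]].
  - move=> F mF tF F0; rewrite setI_bigcupr integral_bigcup.
    + by rewrite eseries0// => i _ _; exact: F0.
    + exact: trivIset_setIl.
    + by move=> k; exact: (@measurableI _ T _ _ measurable_Omega (mF k)).
    + by rewrite -setI_bigcupr; apply: iS; exact: bigcupT_measurable.
  - by rewrite -measurable_open_boxes.
have := @integral_ae_eq _ _ _ leb2 Omega measurable_Omega (fun=> 0%E) (EFin \o
  u) iu.
move=> H; have := H (measurable_cst _); move=> {}H.
have : ae_eq leb2 Omega (EFin \o u : T -> _) (fun=> 0%E).
  apply: H => E EO mE; rewrite integral0 -[in LHS](setIidr EO); exact: all0.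
by apply: filterS => x /= e Ox; have [] := e Ox.
Qed.

Lemma integral_of_rint0 u : rinteg u -> rint u = 0 ->
  (\int[leb2]_(x in Omega) (u x)%:E = 0)%E.
Proof.
move=> iu u0; rewrite -[LHS]fineK;
  last exact: (integrable_fin_num measurable_Omega iu).
by rewrite [fine _]u0.
Qed.

(** [t a b n] approximates the indicator of the open interval from a to b,
    boundedly and at every point of (0, 1); a may be 0 and b may be 1. *)
Definition itv_approx (t : R -> R -> nat -> R -> R) : Prop :=
  forall a b : R, 0 <= a -> a < b -> b <= 1 ->
  [/\ forall n, continuous (t a b n),
      forall n (x : R), 0 < x < 1 -> `|t a b n x| <= 1 &
      forall x : R, 0 < x < 1 ->
        t a b n x @[n --> \oo] --> ((x \in `]a, b[)%:R : R)].

(** Dominated convergence passes from the approximations to the indicator of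
    a box. *)
Lemma ae0_of_approx t u : itv_approx t -> rinteg u ->
  (forall a b c d n, 0 <= a -> a < b -> b <= 1 -> 0 <= c -> c < d -> d <= 1 ->
    rint (fun x => u x * tensor (t a b n) (t c d n) x) = 0) ->
  aeO u (fun=> 0).
Proof.
move=> tP iu H; apply: ae0_of_boxes => // a b c d a0 ab b1 c0 cd d1.
have [cab bab lab] := tP _ _ a0 ab b1; have [ccd bcd lcd] := tP _ _ c0 cd d1.
have sub : open_box a b c d `<=` Omega.
  move=> [x y] [/=]; rewrite !in_itv /= => /andP[? ?] /andP[? ?].
  by split; rewrite /= in_itv /=; apply/andP; split; lra.
pose f_ n (x : T) : \bar R := (u x * tensor (t a b n) (t c d n) x)%:E.
have mt n : rmeas (tensor (t a b n) (t c d n)).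
  by apply: cont_rmeas; exact: tensor_cont.
have [] := @dominated_convergence _ _ _ leb2 Omega measurable_Omega f_
  ((EFin \o u) \_ (open_box a b c d)) (abse \o (EFin \o u)).
- by move=> n; apply/measurable_EFinP; apply: rmeasM => //; exact: rinteg_meas.
- apply/(measurable_restrict _ (measurable_open_box a b c d)) => //.
    exact: measurable_Omega.
  apply: (@measurable_funS _ _ _ _ Omega);
    [exact: measurable_Omega|exact: subIsetl|].
  by apply/measurable_EFinP; exact: rinteg_meas.
- apply: aeW => -[x y] [/= x01 y01].
  have x01' : 0 < x < 1 by move: x01; rewrite in_itv.
  have y01' : 0 < y < 1 by move: y01; rewrite in_itv.
  have L : u (x, y) * (t a b n x * t c d n y) @[n --> \oo] -->
      u (x, y) * ((x \in `]a, b[)%:R * (y \in `]c, d[)%:R).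
    by apply: cvgM; [exact: cvg_cst|apply: cvgM; [exact: lab|exact: lcd]].
  have -> : ((EFin \o u) \_ (open_box a b c d)) (x, y) =
      (u (x, y) * ((x \in `]a, b[)%:R * (y \in `]c, d[)%:R))%:E.
    rewrite patchE; have [xab|xab] := boolP (x \in `]a, b[); last first.
      by rewrite memNset ?mul0r ?mulr0// => -[/=]; rewrite (negbTE xab).
    have [ycd|ycd] := boolP (y \in `]c, d[); last first.
      by rewrite memNset ?mulr0// => -[/= _]; rewrite (negbTE ycd).
    by rewrite mem_set//= !mulr1.
  by apply: cvg_EFin; [exact: nearW|exact: L].
- exact: integrable_abse.
- apply: aeW => -[x y] n [/= x01 y01]; rewrite /f_ lee_fin /tensor /=.
  rewrite normrM ler_piMr// normrM mulr_ile1//.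
    by rewrite bab; move: x01; rewrite in_itv.
  by rewrite bcd; move: y01; rewrite in_itv.
move=> _ _.
rewrite (_ : (fun _ => _) = fun=> 0%E); last first.
  apply/funext => n; apply: integral_of_rint0; last exact: H.
  apply: (rinteg_le _ (rinteg_abs iu)); first by apply: rmeasM => //;
    exact: rinteg_meas.
  move=> [x y] [/= x01 y01].
  rewrite normrM ler_piMr// /tensor /= normrM mulr_ile1//.
    by rewrite bab; move: x01; rewrite in_itv.
  by rewrite bcd; move: y01; rewrite in_itv.
move=> L; have := cvg_unique _ L (cvg_cst (0%E : \bar R)).
rewrite -integral_mkcondr (setIidr sub) => ->//.
Qed.
End Density.

(** * Completeness of the exponentials *)
Section Fourier.
Context {R : realType}.
Implicit Types (u v : R * R -> R) (f g : fct R).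
Local Notation C := R[i].
Local Notation Omega := (@Omega R).

Lemma bernoulli_sub (y : R) n : 0 <= y <= 1 -> 1 - n%:R * y <= (1 - y) ^+ n.
Proof.
move=> /andP[y0 y1]; elim: n => [|n IH]; first by rewrite mul0r subr0 expr0.
rewrite exprS -natr1.
have p0 : 0 <= (1 - y) ^+ n by rewrite exprn_ge0// subr_ge0.
have n0 : 0 <= n%:R * (y * y) by rewrite mulr_ge0// mulr_ge0.
have : (1 - y) * (1 - n%:R * y) <= (1 - y) * (1 - y) ^+ n.
  by rewrite ler_wpM2l// subr_ge0.
nra.
Qed.

Lemma bernoulli_add (y : R) n : 0 <= y -> 1 + n%:R * y <= (1 + y) ^+ n.
Proof.
move=> y0; elim: n => [|n IH]; first by rewrite mul0r addr0 expr0.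
rewrite exprS -natr1.
have n0 : 0 <= n%:R * (y * y) by rewrite mulr_ge0// mulr_ge0.
have : (1 + y) * (1 + n%:R * y) <= (1 + y) * (1 + y) ^+ n.
  by rewrite ler_wpM2l// addr_ge0.
nra.
Qed.

Lemma bernoulli_inv (y : R) n : 0 <= y <= 1 ->
  (1 - y) ^+ n * (1 + n%:R * y) <= 1.
Proof.
move=> /andP[y0 y1].
have a0 : 0 <= (1 - y) ^+ n by rewrite exprn_ge0// subr_ge0.
rewrite (le_trans (ler_wpM2l a0 (bernoulli_add n y0)))// -exprMn.
by rewrite exprn_ile1//; nra.
Qed.

(** n w^n (1 - w) is at most (1 - w) (1 + w + ... + w^(n-1)). *)
Lemma natX_bound (w : R) n : 0 <= w <= 1 ->
  n%:R * w ^+ n * (1 - w) <= 1 - w ^+ n.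
Proof.
move=> /andP[w0 w1]; elim: n => [|n IH]; first by rewrite !mul0r expr0 subrr.
have p0 : 0 <= w ^+ n by rewrite exprn_ge0.
have p1 : w ^+ n <= 1 by rewrite exprn_ile1.
rewrite exprS -natr1.
have : w * (n%:R * w ^+ n * (1 - w)) <= w * (1 - w ^+ n) by rewrite ler_wpM2l.
have : w * w ^+ n <= 1 by rewrite mulr_ile1.
set X := w ^+ n in p0 p1 *; set N := n%:R; nra.
Qed.

(** With w the square root of z, n w^n stays bounded while w^n tends to 0. *)
Lemma cvg_natX (z : R) : 0 <= z < 1 -> n%:R * z ^+ n @[n --> \oo] --> (0 : R).
Proof.
move=> /andP[z0 z1]; pose w := Num.sqrt z.
have ww : w * w = z by rewrite -expr2 sqr_sqrtr.
have w0 : 0 <= w by exact: sqrtr_ge0.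
have w1 : w < 1 by rewrite -(ltr_pXn2r (n := 2)) ?nnegrE// expr2 ww expr1n.
have L : geometric (1 - w)^-1 w n @[n --> \oo] --> (0 : R).
  by apply: cvg_geometric; rewrite ger0_norm.
apply: (squeeze_cvgr _ (cvg_cst (0 : R)) L); apply: nearW => n.
rewrite mulr_ge0 ?exprn_ge0//= /geometric /= -ww exprMn mulrA.
rewrite ler_wpM2r ?exprn_ge0// -[leRHS]mul1r ler_pdivlMr ?subr_gt0//.
have w01 : 0 <= w <= 1 by rewrite w0 ltW.
by rewrite (le_trans (natX_bound n w01))// gerBl exprn_ge0.
Qed.

(** The exponent makes n 2^n q^n = n (2q)^n tend to infinity for every q >=
    1/2, which forces the limit 0 there. With exponent 2^n the limit at q =
    1/2 would be 1/e. *)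
Definition threshold (q : R) n := (1 - q ^+ n) ^+ (n * 2 ^ n).

Lemma threshold01 q n : 0 <= q <= 1 -> 0 <= threshold q n <= 1.
Proof.
move=> /andP[q0 q1]; have a0 : 0 <= q ^+ n by rewrite exprn_ge0.
have a1 : q ^+ n <= 1 by rewrite exprn_ile1.
by rewrite /threshold exprn_ge0 ?subr_ge0// exprn_ile1// ?subr_ge0// gerBl.
Qed.

(** Bernoulli's inequality from below when 2q < 1; from above, the power is
    at most 1 / (1 + n (2q)^n). *)
Lemma threshold_lim (q : R) : 0 <= q <= 1 ->
  threshold q n @[n --> \oo] --> ((q < 2^-1)%R%:R : R).
Proof.
move=> q01; have /andP[q0 q1] := q01.
have qn n : 0 <= q ^+ n <= 1 by rewrite exprn_ge0// exprn_ile1.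
have E n : (n * 2 ^ n)%N%:R * q ^+ n = n%:R * (2 * q) ^+ n.
  by rewrite natrM natrX -mulrA -exprMn.
have [ql|qg] := ltP q 2^-1.
  have L : 1 - n%:R * (2 * q) ^+ n @[n --> \oo] --> (1 : R).
    rewrite -[X in _ --> X]subr0; apply: cvgB; first exact: cvg_cst.
    by apply: cvg_natX; apply/andP; split; lra.
  apply: (squeeze_cvgr _ L (cvg_cst (1 : R))); apply: nearW => n.
  have /andP[_ ->] := threshold01 n q01; rewrite andbT.
  by rewrite -E; exact: bernoulli_sub.
apply: (squeeze_cvgr _ (cvg_cst (0 : R)) cvg_harmonic); apply: nearW => n.
have /andP[-> _] := threshold01 n q01 => /=.
rewrite /harmonic /= -[leRHS]mul1r ler_pdivlMr ?ltr0n//.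
have /andP[t0 _] := threshold01 n q01.
apply: le_trans (bernoulli_inv (n * 2 ^ n) (qn n)).
rewrite /threshold ler_wpM2l// E -natr1 addrC lerD2l ler_peMr// exprn_ege1//.
by lra.
Qed.

Definition tau (m : int) : C := 0 +i* (2 * pi * m%:~R).

Lemma tauD m n : tau (m + n) = tau m + tau n.
Proof.
by apply: complex_ext; rewrite ?Re_add ?Im_add /= ?addr0// intrD mulrDr.
Qed.

Lemma tau0 : tau 0 = 0.
Proof. by rewrite /tau mulr0z mulr0. Qed.

(** Trigonometric polynomials of period 1, as finite sums of monomials. *)
Inductive trig : (R -> C) -> Prop :=
| trig_mono (c : C) m : trig (fun t => c * cexp (tau m) t)
| trigD p q : trig p -> trig q -> trig (fun t => p t + q t).

Lemma trig_ext p q : (forall t, p t = q t) -> trig p -> trig q.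
Proof. by move=> /funext ->. Qed.

Lemma trigM p q : trig p -> trig q -> trig (fun t => p t * q t).
Proof.
elim => {p} [c m|p p' _ IH _ IH'] tq; last first.
  apply: (@trig_ext (fun t => p t * q t + p' t * q t)) => [t|].
    by rewrite mulrDl.
  by apply: trigD; [exact: IH|exact: IH'].
elim: tq => {q} [d n|q q' _ IH _ IH'].
  apply: (@trig_ext (fun t => (c * d) * cexp (tau (m + n)) t)) => [t|].
    by rewrite tauD cexpD; ring.
  exact: trig_mono.
apply: (@trig_ext (fun t => c * cexp (tau m) t * q t + c * cexp (tau m) t * q'
  t)) => [t|].
  by rewrite mulrDr.
exact: trigD.
Qed.

Definition rtrig (p : R -> R) := trig (fun t => (p t)%:C).

Lemma rtrig_ext p q : (forall t, p t = q t) -> rtrig p -> rtrig q.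
Proof. by move=> /funext ->. Qed.

Lemma rtrigD p q : rtrig p -> rtrig q -> rtrig (fun t => p t + q t).
Proof.
move=> tp tq; apply: (@trig_ext (fun t => (p t)%:C + (q t)%:C)) => [t|].
  by rewrite rmorphD.
exact: trigD.
Qed.

Lemma rtrigM p q : rtrig p -> rtrig q -> rtrig (fun t => p t * q t).
Proof.
move=> tp tq; apply: (@trig_ext (fun t => (p t)%:C * (q t)%:C)) => [t|].
  by rewrite rmorphM.
exact: trigM.
Qed.

Lemma rtrig_cst (c : R) : rtrig (fun=> c).
Proof.
apply: (@trig_ext (fun t => c%:C * cexp (tau 0) t)) => [t|];
  last exact: trig_mono.
by rewrite tau0 cexp0 mulr1.
Qed.

Lemma rtrigX p n : rtrig p -> rtrig (fun t => p t ^+ n).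
Proof.
move=> tp; elim: n => [|n IH]; first exact: rtrig_cst.
by under eq_fun do rewrite exprS; exact: rtrigM.
Qed.

Lemma rtrig_cos (x0 : R) : rtrig (fun t => cos (2 * pi * (t - x0))).
Proof.
(* c e_1 and its conjugate add up to twice the shifted cosine. *)
pose c : C := cos (2 * pi * x0) +i* (- sin (2 * pi * x0)).
pose k := (2^-1)%:C : C.
apply: (@trig_ext (fun t => (k * c) * cexp (tau 1) t + (k * conjc c) * cexp (tau
  (-1)) t)) => [t|].
  have -> : tau (-1) = conjc (tau 1) by rewrite /tau /= mulrN.
  rewrite -cexp_conj /c /k /cexp /tau /= !mulr1 !mul0r expR0 !mul1r.
  have -> : 2 * pi * (t - x0) = 2 * pi * t - 2 * pi * x0 by ring.
  rewrite cosB; apply: complex_ext; rewrite ?Re_add ?Im_add ?Re_mul ?Im_mul /=.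
    by field.
  by ring.
by apply: trigD; exact: trig_mono.
Qed.

(** An affine function of cos (2 pi (t - (a + b) / 2)), with values in [0, 1]
    and normalized so that it is below 1/2 exactly on the arc from a to b. *)
Definition arc_level (a b : R) (t : R) : R :=
  2^-1 + (cos (pi * (b - a)) - cos (2 * pi * (t - (a + b) / 2))) / 4.

Lemma arc_level01 a b t : 0 <= arc_level a b t <= 1.
Proof.
rewrite /arc_level; have := cos_geN1 (pi * (b - a));
  have := cos_le1 (pi * (b - a)).
have := cos_geN1 (2 * pi * (t - (a + b) / 2)).
have := cos_le1 (2 * pi * (t - (a + b) / 2)).
by move=> *; apply/andP; split; lra.
Qed.

(** The cosine is decreasing on [0, pi], so the condition compares the
    distance s of t to the midpoint, measured on the circle, with half the
    length. For s > 1/2 that distance is 1 - s, and the arc cannot wrap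
    around because the interval lies in [0, 1]. *)
Lemma arc_level_lt a b t : 0 <= a -> a < b -> b <= 1 -> 0 < t < 1 ->
  (arc_level a b t < 2^-1) = (t \in `]a, b[).
Proof.
move=> a0 ab b1 /andP[t0 t1].
have -> : (arc_level a b t < 2^-1) =
    (cos (pi * (b - a)) < cos (2 * pi * (t - (a + b) / 2))).
  by apply/idP/idP; rewrite /arc_level => *; lra.
pose s := `|t - (a + b) / 2|.
have -> : cos (2 * pi * (t - (a + b) / 2)) = cos (2 * pi * s).
  rewrite -[in LHS]cos_norm normrM ger0_norm// mulr_ge0//; exact: pi_ge0.
have -> : (t \in `]a, b[) = (s < (b - a) / 2).
  by rewrite in_itv /= /s ltr_norml; apply/idP/idP => /andP[? ?]; apply/andP;
    split; lra.
have s0 : 0 <= s by exact: normr_ge0.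
have ss : s < 1 - (b - a) / 2.
  by rewrite /s ltr_norml; apply/andP; split; lra.
have pp := @pi_gt0 R.
have key r : 0 <= r -> r <= 2^-1 ->
    (cos (pi * (b - a)) < cos (2 * pi * r)) = (r < (b - a) / 2).
  move=> r0 r1; rewrite ltr_cos ?in_itv /=; last 2 first.
  - by apply/andP; split; nra.
  - by apply/andP; split; nra.
  by apply/idP/idP => ?; nra.
have [sl|sg] := leP s 2^-1; first exact: key.
have -> : cos (2 * pi * s) = cos (2 * pi * (1 - s)).
  rewrite -[LHS]cosN -[LHS]cosD2pi; congr cos.
  by rewrite -mulr_natl; ring.
rewrite key; [|lra|lra].
by apply/idP/idP => ?; lra.
Qed.

Definition trig_approx (a b : R) n (t : R) := threshold (arc_level a b t) n.

Lemma rtrig_approx a b n : rtrig (trig_approx a b n).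
Proof.
have tq : rtrig (arc_level a b).
  apply: rtrigD; first exact: rtrig_cst.
  apply: rtrigM; last exact: rtrig_cst.
  apply: rtrigD; first exact: rtrig_cst.
  apply: (@rtrig_ext (fun t => -1 * cos (2 * pi * (t - (a + b) / 2)))) => [t|].
    by rewrite mulN1r.
  by apply: rtrigM; [exact: rtrig_cst|exact: rtrig_cos].
apply: rtrigX; apply: rtrigD; first exact: rtrig_cst.
apply: (@rtrig_ext (fun t => -1 * arc_level a b t ^+ n)) => [t|].
  by rewrite mulN1r.
by apply: rtrigM; [exact: rtrig_cst|exact: rtrigX].
Qed.

Lemma trig_cont p : trig p ->
  continuous (fun t => Re (p t)) /\ continuous (fun t => Im (p t)).
Proof.
elim => {p} [c m|p q _ [pr pi] _ [qr qi]].
  have [dr di] := has_cderivZ c (has_cderiv_cexp (tau m)).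
  by split; [exact: (has_deriv_cont dr)|exact: (has_deriv_cont di)].
split.
  by under eq_fun do rewrite Re_add; move=> t; apply: cvgD;
    [exact: pr|exact: qr].
by under eq_fun do rewrite Im_add; move=> t; apply: cvgD; [exact: pi|exact: qi].
Qed.

Lemma rtrig_cont p : rtrig p -> continuous p.
Proof. by move=> /trig_cont[]. Qed.

Lemma itv_approx_trig : itv_approx trig_approx.
Proof.
move=> a b a0 ab b1; split.
- by move=> n; exact/rtrig_cont/rtrig_approx.
- move=> n x _; have /andP[? ?] := threshold01 n (arc_level01 a b x).
  by rewrite ger0_norm.
- by move=> x x01; rewrite -(arc_level_lt a0 ab b1 x01);
  exact: threshold_lim (arc_level01 a b x).
Qed.

Definition ctensor (p q : R -> C) : fct R := fun x => p x.1 * q x.2.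

Lemma cinteg_bM f g : ccont g -> cinteg f -> cinteg (fun x => f x * g x).
Proof.
move=> cg [fr fi]; have [[gr gi] [Br gBr] [Bi gBi]] :
  [/\ ccont g, exists B : R, forall x, Omega x -> `|reF g x| <= B &
               exists B : R, forall x, Omega x -> `|imF g x| <= B].
  by case: (cg) => ? ?; split => //; exact: cont_bounded.
apply: (@cinteg_le _ _ (fun x => (Br + Bi) * (`|reF f x| + `|imF f x|))).
- by apply: cmeasM; [split; exact: rinteg_meas|split; exact: cont_rmeas].
- by apply: rintegZ; apply: rintegD; exact: rinteg_abs.
move=> x Ox; rewrite normcM mulrC ler_pM ?normc_nneg ?normc_le_ReIm//.
by rewrite (le_trans (normc_le_ReIm _))// lerD ?gBr ?gBi.
Qed.

Lemma ctensor_ccont p q : trig p -> trig q -> ccont (ctensor p q).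
Proof.
move=> /trig_cont[pr pi] /trig_cont[qr qi].
have H (g r : R * R -> R) : (forall x, g x = r x) -> continuous r ->
  continuous g.
  by move=> /funext ->.
split.
  apply: (H _ (fun x => tensor (fun t => Re (p t)) (fun t => Re (q t)) x
                - tensor (fun t => Im (p t)) (fun t => Im (q t)) x)) => [x|x].
    by rewrite /reF /ctensor Re_mul.
  by apply: cvgB; exact: tensor_cont.
apply: (H _ (fun x => tensor (fun t => Re (p t)) (fun t => Im (q t)) x
              + tensor (fun t => Im (p t)) (fun t => Re (q t)) x)) => [x|x].
  by rewrite /imF /ctensor Im_mul.
by apply: cvgD; exact: tensor_cont.
Qed.

Lemma cint_trig0 f p q : cinteg f ->
  (forall m n, cint (fun x => f x * pexp (tau m) (tau n) x) = 0) ->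
  trig p -> trig q -> cint (fun x => f x * ctensor p q x) = 0.
Proof.
move=> inf f0 tp; elim: tp q => {p} [c m|p p' tp IH tp' IH'] q tq; last first.
  rewrite -[RHS](addr0 0) -{1}(IH _ tq) -(IH' _ tq) -cintD.
  - by congr cint; apply/funext => x; rewrite /ctensor mulrDl mulrDr.
  - by apply: cinteg_bM => //; exact: ctensor_ccont.
  - by apply: cinteg_bM => //; exact: ctensor_ccont.
elim: tq => {q} [d n|q q' tq IH tq' IH'].
  rewrite -[RHS](mulr0 (c * d)) -(f0 m n) -cintZ.
    by congr cint; apply/funext => x; rewrite /ctensor /pexp; ring.
  by apply: cinteg_bM => //; exact: ccont_pexp.
have tm := trig_mono c m.
rewrite -[RHS](addr0 0) -{1}IH -IH' -cintD.
- by congr cint; apply/funext => x; rewrite /ctensor mulrDr mulrDr.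
- by apply: cinteg_bM => //; exact: ctensor_ccont.
- by apply: cinteg_bM => //; exact: ctensor_ccont.
Qed.

Lemma aeO_complex f g : aeO (reF f) (reF g) -> aeO (imF f) (imF g) -> aeO f g.
Proof.
apply: filterS2 => x e1 e2 Ox; apply: complex_ext; [exact: e1|exact: e2].
Qed.

(** Real test functions separate the real and imaginary parts of f. *)
Lemma ae0_of_real_approx t f : itv_approx t -> cinteg f ->
  (forall a b c d n, 0 <= a -> a < b -> b <= 1 -> 0 <= c -> c < d -> d <= 1 ->
    cint (fun x => f x * (tensor (t a b n) (t c d n) x)%:C) = 0) ->
  aeO f (fun=> 0).
Proof.
move=> tP [fr fi] H; apply: aeO_complex.
  apply: (ae0_of_approx tP fr) => a b c d n a0 ab b1 c0 cd d1.
  have [+ _] := eqP (introT eqP (H a b c d n a0 ab b1 c0 cd d1)).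
  move=> e; rewrite -[RHS]e; apply: eq_rint => x _.
  by rewrite /reF Re_mul /= mulr0 subr0.
apply: (ae0_of_approx tP fi) => a b c d n a0 ab b1 c0 cd d1.
have [_ +] := eqP (introT eqP (H a b c d n a0 ab b1 c0 cd d1)).
move=> e; rewrite -[RHS]e; apply: eq_rint => x _.
by rewrite /imF Im_mul /= mulr0 add0r.
Qed.

(** A function orthogonal to all exponentials annihilates all products of
    trigonometric polynomials, and these approximate indicators of boxes. *)
Lemma fourier_complete f : cinteg f ->
  (forall m n, cint (fun x => f x * pexp (tau m) (tau n) x) = 0) ->
  aeO f (fun=> 0).
Proof.
move=> inf f0; apply: (ae0_of_real_approx itv_approx_trig inf) =>
  a b c d n _ _ _ _ _ _.
rewrite -[RHS](cint_trig0 inf f0 (rtrig_approx a b n) (rtrig_approx c d n)).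
by congr cint; apply/funext => x; rewrite /ctensor /tensor -rmorphM.
Qed.

(** The factor [pexp al be] never vanishes, so it can be absorbed into f. *)
Lemma pexp_complete al be f : cinteg f ->
  (forall m n, cint (fun x => f x * pexp (al + tau m) (be + tau n) x) = 0) ->
  aeO f (fun=> 0).
Proof.
move=> inf f0.
have cE : ccont (pexp al be) by exact: ccont_pexp.
have := @fourier_complete (fun x => f x * pexp al be x) (cinteg_bM cE inf).
move=> H; have {}H : aeO (fun x => f x * pexp al be x) (fun=> 0).
  apply: H => m n; rewrite -(f0 m n); congr cint; apply/funext => x.
  by rewrite pexpD mulrA.
apply: filterS H => x e Ox; have := e Ox.
move=> /(congr1 (fun z => z * pexp (- al) (- be) x)).
by rewrite mul0r -mulrA -pexpD !subrr pexp00 mulr1.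
Qed.
End Fourier.

(** * Test functions and weak derivatives *)
Section Bump.
Context {R : realType}.
Implicit Types (u v : R * R -> R) (f g : fct R).
Local Notation C := R[i].
Local Notation Omega := (@Omega R).

(** t^(-n) exp (-1/t), extended by 0: a family whose span is closed under
    differentiation. *)
Definition flat (n : nat) (t : R) : R :=
  if 0 < t then t^-1 ^+ n * expR (- t^-1) else 0.

(** With u = 1/t this says u^(n+2) exp (-u) <= (n+2)!, one term of the
    exponential series. The square leaves room for a zero derivative at the
    origin. *)
Lemma flat_le n (t : R) : 0 < t -> flat n t <= n.+2`!%:R * t ^+ 2.
Proof.
move=> t0; rewrite /flat t0; set w := t^-1.
have w0 : 0 < w by rewrite invr_gt0.
have := expR_ge1Dxn n.+1 (ltW w0).
set F : R := n.+2`!%:R => H.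
have F0 : 0 < F by rewrite ltr0n fact_gt0.
have {}H : w ^+ n.+2 <= F * expR w.
  by rewrite mulrC -ler_pdivrMr// (le_trans _ H)// lerDr.
have -> : t ^+ 2 = w ^- 2 by rewrite /w exprVn invrK.
rewrite ler_pdivlMr ?exprn_gt0// mulrAC -exprD addn2.
by rewrite expRN ler_pdivrMr ?expR_gt0.
Qed.

Lemma flat_ge0 n t : 0 <= flat n t.
Proof.
rewrite /flat; case: ifP => // t0.
by rewrite mulr_ge0 ?expR_ge0// exprn_ge0// invr_ge0 ltW.
Qed.

Lemma flat_norm n (t : R) : `|flat n t| <= n.+2`!%:R * t ^+ 2.
Proof.
rewrite ger0_norm ?flat_ge0//; case: (ltP 0 t) => [/flat_le//|t0].
by rewrite /flat ltNge t0 /= mulr_ge0 ?sqr_ge0.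
Qed.

Lemma is_derive_limit (p : R -> R) (t d : R) :
  (h^-1 * (p (h + t) - p t) @[h --> 0^'] --> d) -> is_derive t (1 : R) p d.
Proof.
move=> L; have E : (fun h : R =>
  h^-1 *: ((p \o shift t) (h *: (1 : R)) - p t)) =
    (fun h => h^-1 * (p (h + t) - p t)).
  by apply/funext => h /=; rewrite /GRing.scale /= mulr1.
apply: DeriveDef; first by rewrite /derivable E; apply/cvg_ex; exists d.
by rewrite /derive E; exact: cvg_lim.
Qed.

Lemma has_deriv_powexp n : has_deriv (fun x : R => x ^+ n * expR (- x))
  (fun x => n%:R * x ^+ n.-1 * expR (- x) - x ^+ n * expR (- x)).
Proof.
have De : has_deriv (fun x : R => expR (- x)) (fun x => - expR (- x)).
  apply: (@has_deriv_ext _ (fun x => expR (-1 * x))) => [t|];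
    first by rewrite mulN1r.
  by apply: (has_deriv_eq (has_deriv_lin (-1) (@has_deriv_expR R))) => t;
    rewrite !mulN1r.
have Dn : has_deriv (fun x : R => x ^+ n) (fun x => n%:R * x ^+ n.-1).
  case: n => [|n].
    by apply: (has_deriv_eq (has_deriv_cst (1 : R))) => t; rewrite mul0r.
  elim: n => [|n IH].
    by apply: (has_deriv_eq (@has_deriv_id R)) => t; rewrite mul1r expr0.
  apply: (@has_deriv_ext _ (fun x => x * x ^+ n.+1)) => [t|];
    first by rewrite -exprS.
  apply: (has_deriv_eq (has_derivM (@has_deriv_id R) IH)) => t /=.
  by rewrite mul1r mulrCA -exprS -[n.+2%:R]natr1 mulrDl mul1r addrC.
by apply: (has_deriv_eq (has_derivM Dn De)) => t; rewrite mulrN.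
Qed.

Lemma has_deriv_flat n : has_deriv (flat n) (fun t =>
  flat n.+2 t - n%:R * flat n.+1 t).
Proof.
move=> t; have [t0|t0|<-] := ltgtP 0 t.
- pose P (x : R) := x ^+ n * expR (- x).
  have N : \near t, P t^-1 = flat n t.
    have := lt_nbhsr t0; apply: filterS => s s0.
    by rewrite /flat s0.
  apply: (near_eq_is_derive N).
  have DV : is_derive t (1 : R) (fun s : R => s^-1) (- t ^- 2 *: 1).
    by have := @is_deriveV R id t 1 1 (lt0r_neq0 t0) (is_derive_id t 1).
  have := @is_derive1_comp _ P (fun s : R =>
    s^-1) t _ _ (has_deriv_powexp n t^-1) DV.
  rewrite /flat t0 => H; apply: is_derive_eq H _.
  rewrite /GRing.scale /= mulr1 -exprVn.
  by case: n {N P} => [|n] /=; rewrite ?exprS; ring.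
- have N : \near t, (fun=> 0 : R) t = flat n t.
    have := lt_nbhsl t0; apply: filterS => s s0.
    by rewrite /flat ltNge (ltW s0).
  apply: (near_eq_is_derive N).
  rewrite /flat ltNge (ltW t0) /= mulr0 subr0; exact: is_derive_cst.
(* At the origin the difference quotient is at most (n + 2)! |h|. *)
rewrite {2 3}/flat ltxx mulr0 subr0; apply: is_derive_limit.
have f0 : flat n 0 = 0 by rewrite /flat ltxx.
rewrite f0; pose K : R := n.+2`!%:R.
have L : K * `|h| @[h --> (0 : R)^'] --> (0 : R).
  rewrite -[X in _ --> X](mulr0 K); apply: cvgM; first exact: cvg_cst.
  have LN : `|h| @[h --> (0 : R)] --> `|(0 : R)| by exact: norm_continuous.
  by apply: cvg_within_filter; move: LN; rewrite normr0.
apply/norm_cvg0P.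
apply: (squeeze_cvgr _ (cvg_cst (0 : R)) L).
apply: filterS (nbhs_dnbhs_neq (0 : R)) => h h0.
rewrite normr_ge0 /= addr0 subr0 normrM normfV ler_pdivrMl ?normr_gt0//.
rewrite (le_trans (flat_norm n h))// -/K -(real_normK (num_real h)).
by rewrite expr2 mulrCA.
Qed.

Lemma Ck_flat k n : Ck k (flat n).
Proof.
elim: k n => [n|k IH n]; first exact: (has_deriv_cont (@has_deriv_flat n)).
exists (fun t => flat n.+2 t - n%:R * flat n.+1 t); first exact: has_deriv_flat.
have -> : (fun t => flat n.+2 t - n%:R * flat n.+1 t) =
    (fun t => flat n.+2 t + (- n%:R) * flat n.+1 t).
  by apply/funext => t; rewrite mulNr.
by apply: CkD => //; exact: CkZ.
Qed.

Lemma flat0_gt0 t : 0 < t -> 0 < flat 0 t.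
Proof. by move=> t0; rewrite /flat t0 expr0 mul1r expR_gt0. Qed.

Lemma flat0_le1 t : flat 0 t <= 1.
Proof.
rewrite /flat; case: ifP => // t0.
by rewrite expr0 mul1r -expR0 ler_expR oppr_le0 invr_ge0 ltW.
Qed.

Definition bump (a b t : R) : R := flat 0 (t - a) * flat 0 (b - t).

Lemma bump01 a b t : 0 <= bump a b t <= 1.
Proof. by rewrite /bump mulr_ge0 ?flat_ge0// mulr_ile1 ?flat_ge0 ?flat0_le1.
  Qed.

Lemma Ck_bump k a b : Ck k (bump a b).
Proof.
have Csub c : Ck k (fun t => t + (- c)) by apply: CkD;
  [exact: Ck_id|exact: Ck_cst].
have Crev c : Ck k (fun t => c - t).
  have -> : (fun t => c - t) = (fun t => c + (-1) * t).
    by apply/funext => t; rewrite mulN1r.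
  by apply: CkD; [exact: Ck_cst|apply: CkZ; exact: Ck_id].
by apply: CkM; [apply: (Ck_comp (Ck_flat k 0))|apply: (Ck_comp (Ck_flat k 0))].
Qed.

Lemma bump_out a b t : t <= a \/ b <= t -> bump a b t = 0.
Proof.
rewrite /bump /flat; case=> H.
  by rewrite [X in if X then _ else _]ltNge subr_le0 H mul0r.
by rewrite [X in _ * (if X then _ else _)]ltNge subr_le0 H mulr0.
Qed.

(** The margin removed at both ends keeps the support of the approximation
    compact in (0, 1) even if a = 0 or b = 1; the 3 keeps it below half of
    the length. *)
Definition shrink (a b : R) (n : nat) : R := (b - a) / n.+3%:R.

Definition bump_approx (a b : R) (n : nat) (t : R) : R :=
  1 - (1 - bump (a + shrink a b n) (b - shrink a b n) t) ^+ n.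

Lemma shrink_bounds a b n : a < b ->
  0 < shrink a b n /\ shrink a b n < (b - a) / 2.
Proof.
move=> ab; rewrite /shrink; split; first by rewrite divr_gt0 ?subr_gt0.
by rewrite ltr_pM2l ?subr_gt0// ltf_pV2 ?posrE// ltr_nat.
Qed.

Lemma Ck_bump_approx k a b n : Ck k (bump_approx a b n).
Proof.
have H (c : R) p : Ck k p -> Ck k (fun t => c - p t).
  move=> Cp; have -> : (fun t => c - p t) = (fun t => c + (-1) * p t).
    by apply/funext => t; rewrite mulN1r.
  by apply: CkD; [exact: Ck_cst|exact: CkZ].
by apply: (H); apply: CkX; apply: (H); exact: Ck_bump.
Qed.

Lemma bump_approx_out a b n t :
  t <= a + shrink a b n \/ b - shrink a b n <= t -> bump_approx a b n t = 0.
Proof. by move=> H; rewrite /bump_approx bump_out// subr0 expr1n subrr. Qed.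

Lemma cvg_shrink a b : shrink a b n @[n --> \oo] --> (0 : R).
Proof.
rewrite -[X in _ --> X](mulr0 (b - a)); apply: cvgM; first exact: cvg_cst.
have := @cvg_harmonic R; rewrite -(cvg_shiftn 2) => H.
by under eq_fun do rewrite -addn2 addSn.
Qed.

(** Inside the interval the bumps stay above some c > 0 from some n on, and
    (1 - c)^n tends to 0; outside, every bump vanishes. *)
Lemma itv_approx_bump : itv_approx bump_approx.
Proof.
move=> a b a0 ab b1; split.
- by move=> n; exact: (Ck_cont (Ck_bump_approx 0 a b n)).
- move=> n x _; have /andP[c0 c1] := bump01 (a + shrink a b n) (b - shrink a b
  n) x.
  have d0 : 0 <= 1 - bump (a + shrink a b n) (b - shrink a b n) x by lra.
  have d1 : 1 - bump (a + shrink a b n) (b - shrink a b n) x <= 1 by lra.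
  rewrite /bump_approx ger0_norm; first by rewrite gerBl exprn_ge0.
  by rewrite subr_ge0 exprn_ile1.
move=> x x01; have [|xout] := boolP (x \in `]a, b[); last first.
  under eq_fun => n.
    rewrite bump_approx_out; last first.
      have [s0 _] := shrink_bounds n ab.
      move: xout; rewrite in_itv /= negb_and -!leNgt => /orP[]H; [left|right];
        lra.
    over.
  exact: cvg_cst.
rewrite in_itv /= => /andP[ax xb].
have cf : continuous (flat 0) by exact: (Ck_cont (Ck_flat 0 0)).
have L : bump (a + shrink a b n) (b - shrink a b n) x @[n --> \oo] --> bump a b
  x.
  apply: cvgM.
    apply: (@continuous_cvg _ _ _ _ _ _ (flat 0)); first exact: cf.
    rewrite -[X in _ --> x - X]addr0; apply: cvgB; first exact: cvg_cst.
    by apply: cvgD; [exact: cvg_cst|exact: cvg_shrink].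
  apply: (@continuous_cvg _ _ _ _ _ _ (flat 0)); first exact: cf.
  rewrite -[X in _ --> X - x]subr0; apply: cvgB; last exact: cvg_cst.
  by apply: cvgB; [exact: cvg_cst|exact: cvg_shrink].
pose c := bump a b x / 2.
have c0 : 0 < bump a b x by rewrite mulr_gt0// flat0_gt0// subr_gt0.
have cc : c < bump a b x by rewrite /c; lra.
have /andP[_ b1'] := bump01 a b x.
have G : geometric 1 (1 - c) n @[n --> \oo] --> (0 : R).
  by apply: cvg_geometric; rewrite ger0_norm /c; lra.
have G1 : 1 - geometric 1 (1 - c) n @[n --> \oo] --> (1 : R).
  by rewrite -[X in _ --> X]subr0; apply: cvgB; [exact: cvg_cst|exact: G].
apply: (squeeze_cvgr _ G1 (cvg_cst (1 : R))).
have Hn : \forall n \near \oo, c < bump (a + shrink a b n) (b - shrink a b n) x.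
  exact: (cvgr_gt _ L).
apply: filterS Hn => n cn.
have /andP[d0 d1] := bump01 (a + shrink a b n) (b - shrink a b n) x.
rewrite /bump_approx /geometric /= mul1r lerD2l lerN2 gerBl.
rewrite exprn_ge0 ?subr_ge0// andbT; apply: lerXn2r; rewrite ?nnegrE; lra.
Qed.

Definition bump2 (a b c d : R) n : fct R :=
  fun x => (tensor (bump_approx a b n) (bump_approx c d n) x)%:C.

Lemma test_bump2 a b c d n : 0 <= a -> a < b -> b <= 1 ->
  0 <= c -> c < d -> d <= 1 -> test_function (bump2 a b c d n).
Proof.
move=> a0 ab b1 c0 cd d1; split.
  move=> k; split; first exact: (rCk_tensor (Ck_bump_approx k a b n)
    (Ck_bump_approx k c d n)).
  have -> : imF (bump2 a b c d n) = tensor (fun=> 0) (fun=> 0).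
    by apply/funext => x; rewrite /tensor mulr0.
  by apply: rCk_tensor; exact: Ck_cst.
have [s0 s1] := shrink_bounds n ab; have [r0 r1] := shrink_bounds n cd.
exists (`[a + shrink a b n, b - shrink a b n] `*` `[c + shrink c d n,
  d - shrink c d n]).
split.
- by apply: compact_setX; exact: segment_compact.
- move=> [x y] [/=]; rewrite !in_itv /= => /andP[? ?] /andP[? ?].
  by split; rewrite /= in_itv /=; apply/andP; split; lra.
move=> [x y] nK; rewrite /bump2 /tensor /=.
have [/andP[x1 x2]|xo] := boolP (a + shrink a b n <= x <= b - shrink a b n);
  last first.
  rewrite bump_approx_out ?mul0r//.
  by move: xo; rewrite negb_and -!ltNge => /orP[/ltW|/ltW]; [left|right].
rewrite (@bump_approx_out c d) ?mulr0//.
have [/andP[y1 y2]|] := boolP (c + shrink c d n <= y <= d - shrink c d n).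
  by exfalso; apply: nK; split; rewrite /= in_itv /= ?x1 ?x2 ?y1 ?y2.
by rewrite negb_and -!ltNge => /orP[/ltW|/ltW]; [left|right].
Qed.

Lemma test_function_dense f : cinteg f ->
  (forall chi, test_function chi -> pairing f chi = 0) -> aeO f (fun=> 0).
Proof.
move=> inf H; apply: (ae0_of_real_approx itv_approx_bump inf).
by move=> a b c d n *; apply: H; exact: test_bump2.
Qed.

Lemma weak_derivative_unique D f g g' :
  weak_derivative D f g -> weak_derivative D f g' -> aeO g g'.
Proof.
move=> [_ Lg H] [_ Lg' H'].
have ig : cinteg (fun x => g x - g' x) by apply: L2_cinteg; exact: L2B.
have := test_function_dense ig.
move=> K; have {}K : aeO (fun x => g x - g' x) (fun=> 0).
  apply: K => chi tchi.
  have Lchi : L2 chi by apply: ccont_L2; apply: smooth_cont; case: tchi.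
  have := H chi tchi; rewrite (H' chi tchi) => /oppr_inj e.
  rewrite /pairing [LHS](_ : _ = cint (fun x =>
    g x * chi x + -1 * (g' x * chi x))).
    rewrite cintD ?cintZ; [|exact: L2M..|apply: cintegZ; exact: L2M].
    by move: e; rewrite /pairing => ->; rewrite mulN1r subrr.
  by congr cint; apply/funext => x; rewrite mulrBl mulN1r.
by apply: filterS K => x e Ox; apply/eqP; rewrite -subr_eq0 e.
Qed.

Lemma test_boundary chi (x : R * R) : test_function chi -> ~ Omega x ->
  chi x = 0.
Proof. by move=> [_ [K [_ KO H]]] nO; apply: H => /KO. Qed.

(** The product with a test function vanishes on the boundary, so the
    integral of its derivative is zero. *)
Lemma weak_derivative1_pexp a b : weak_derivative (@pd1 R) (pexp a b) (fun x =>
  a * pexp a b x).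
Proof.
have cE := ccont_pexp a b; split; first exact: ccont_L2.
  by apply: ccont_L2; exact: ccontZ.
move=> chi tchi; have sc : smooth chi by case: tchi.
have cc := smooth_cont sc; have [d1 _] := smooth_D sc.
have c1 := smooth_cont (smooth_pd1 sc).
apply/eqP; rewrite -subr_eq0 opprK; apply/eqP; rewrite /pairing -cintD.
- apply: (@cint_pd1 _ (fun x => pexp a b x * chi x)).
  + by move=> y; apply: (has_cderiv_eq (has_cderivM (has_cpd1_pexp a b y) (d1
    y))) => t; rewrite addrC.
  + by apply: ccontD; apply: ccontM => //; exact: ccontZ.
  move=> y _; rewrite !(test_boundary tchi) ?mulr0// => -[/=];
    rewrite !in_itv /=.
    by rewrite ltxx.
  by rewrite ltxx andbF.
- by apply: ccont_cinteg; exact: ccontM.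
- by apply: ccont_cinteg; apply: ccontM => //; exact: ccontZ.
Qed.

Lemma weak_derivative2_pexp a b : weak_derivative (@pd2 R) (pexp a b) (fun x =>
  b * pexp a b x).
Proof.
have cE := ccont_pexp a b; split; first exact: ccont_L2.
  by apply: ccont_L2; exact: ccontZ.
move=> chi tchi; have sc : smooth chi by case: tchi.
have cc := smooth_cont sc; have [_ d1] := smooth_D sc.
have c1 := smooth_cont (smooth_pd2 sc).
apply/eqP; rewrite -subr_eq0 opprK; apply/eqP; rewrite /pairing -cintD.
- apply: (@cint_pd2 _ (fun x => pexp a b x * chi x)).
  + by move=> y; apply: (has_cderiv_eq (has_cderivM (has_cpd2_pexp a b y) (d1
    y))) => t; rewrite addrC.
  + by apply: ccontD; apply: ccontM => //; exact: ccontZ.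
  move=> x _; rewrite !(test_boundary tchi) ?mulr0// => -[/= _];
    rewrite !in_itv /=.
    by rewrite ltxx.
  by rewrite ltxx andbF.
- by apply: ccont_cinteg; exact: ccontM.
- by apply: ccont_cinteg; apply: ccontM => //; exact: ccontZ.
Qed.
End Bump.

(** * Series with rapidly decaying coefficients *)
Section Series.
Context {R : realType}.
Implicit Types (f g : fct R) (k : R * R) (xi eta : int * int).
Local Notation C := R[i].
Local Notation Omega := (@Omega R).

Definition zrange (N : nat) : seq int := [seq (i%:Z - N%:Z)%R | i <- iota 0
  N.*2.+1].

Lemma mem_zrange N (m : int) : (m \in zrange N) = (`|m| <= N)%N.
Proof.
apply/mapP/idP => [[i + ->]|H].
  by rewrite mem_iota => /andP[_ +]; lia.
exists `|(m + N%:Z)%R|%N; last by lia.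
by rewrite mem_iota; lia.
Qed.

Lemma uniq_zrange N : uniq (zrange N).
Proof. by rewrite map_inj_uniq ?iota_uniq// => i j /addIr []. Qed.

Definition box (N : nat) : seq (int * int) :=
  [seq (m, n) | m <- zrange N, n <- zrange N].

Lemma mem_box N xi : (xi \in box N) = (`|xi.1| <= N)%N && (`|xi.2| <= N)%N.
Proof.
case: xi => m n; apply/allpairsP/idP =>
  [[[p q] [/= pm qn [-> ->]]]|/andP[pm qn]].
  by rewrite -!mem_zrange pm qn.
by exists (m, n); rewrite !mem_zrange.
Qed.

Lemma uniq_box N : uniq (box N).
Proof.
by apply: allpairs_uniq; rewrite ?uniq_zrange// => -[? ?] [? ?] _ _ [-> ->].
Qed.

Lemma size_box N : size (box N) = (N.*2.+1 * N.*2.+1)%N.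
Proof. by rewrite size_allpairs size_map size_iota. Qed.

Lemma box_sub (N M : nat) : (N <= M)%N ->
  perm_eq [seq xi <- box M | xi \in box N] (box N).
Proof.
move=> NM; apply: uniq_perm; [exact/filter_uniq/uniq_box|exact: uniq_box|].
move=> xi; rewrite mem_filter; apply/andP/idP => [[]//|xN]; split => //.
by move: xN; rewrite !mem_box; lia.
Qed.

Lemma sum_box_sub (V : nmodType) (F : int * int ->
  V) (N M : nat) : (N <= M)%N ->
  \sum_(xi <- box M | xi \in box N) F xi = \sum_(xi <- box N) F xi.
Proof. by move=> NM; rewrite -big_filter; exact/perm_big/box_sub. Qed.

Lemma sum_box_opp (V : nmodType) (F : int * int -> V) (N : nat) :
  \sum_(xi <- box N) F (- xi.1, - xi.2) = \sum_(xi <- box N) F xi.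
Proof.
rewrite -(big_map (fun xi : int * int => (- xi.1, - xi.2)) predT F).
apply: perm_big; apply: uniq_perm; rewrite ?uniq_box//.
  rewrite map_inj_uniq ?uniq_box// => -[a b] [c d] /= [/eqP + /eqP].
  by rewrite !eqr_opp => /eqP -> /eqP ->.
move=> [m n]; apply/mapP/idP => [[[a b] ab [-> ->]]|H].
  by move: ab; rewrite !mem_box /= !abszN.
by exists (- m, - n); rewrite /= ?opprK//; move: H; rewrite !mem_box /= !abszN.
Qed.

Definition weight xi : R := 1 + xi.1%:~R ^+ 2 + xi.2%:~R ^+ 2.

Lemma weight_ge1 xi : 1 <= weight xi.
Proof. by rewrite /weight -addrA lerDl addr_ge0 ?sqr_ge0. Qed.

Lemma weight_gt0 xi : 0 < weight xi.
Proof. exact: lt_le_trans ltr01 (weight_ge1 xi). Qed.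

Lemma weight_out N xi : xi \notin box N -> N.+1%:R ^+ 2 <= weight xi.
Proof.
rewrite mem_box negb_and -!ltnNge => H.
have sq (m : int) : (N < `|m|)%N -> N.+1%:R ^+ 2 <= m%:~R ^+ 2 :> R.
  move=> Nm; rewrite -[leRHS]real_normK ?num_real// ler_pXn2r ?nnegrE//.
  by rewrite -intr_norm -[`|m|]/(Posz `|m|%N) -pmulrn ler_nat.
have s1 := sqr_ge0 (xi.1%:~R : R); have s2 := sqr_ge0 (xi.2%:~R : R).
rewrite /weight; case/orP: H => /sq; lra.
Qed.

Definition rapid (a : int * int -> C) : Prop :=
  forall p : nat, exists B : R, forall xi, normc (a xi) * weight xi ^+ p <= B.

Lemma rapidD (a b : int * int -> C) :
  rapid a -> rapid b -> rapid (fun xi => a xi + b xi).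
Proof.
move=> ra rb p; have [A aA] := ra p; have [B bB] := rb p.
exists (A + B) => xi; have r0 : 0 <=
  weight xi ^+ p by rewrite exprn_ge0// ltW// weight_gt0.
rewrite (le_trans _ (lerD (aA xi) (bB xi)))// -mulrDl ler_wpM2r//.
exact: normc_triangle.
Qed.

Lemma rapidZ (c : C) (a : int * int -> C) : rapid a ->
  rapid (fun xi => c * a xi).
Proof.
move=> ra p; have [B aB] := ra p; exists (normc c * B) => xi.
by rewrite normcM -mulrA ler_wpM2l ?normc_nneg.
Qed.

Lemma rapid_le (a b : int * int -> C) : rapid a ->
  (forall xi, normc (b xi) <= normc (a xi)) -> rapid b.
Proof.
move=> ra ba p; have [A aA] := ra p; exists A => xi.
by rewrite (le_trans _ (aA xi))// ler_wpM2r// exprn_ge0// ltW// weight_gt0.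
Qed.

Lemma rapid_opp_index (a : int * int -> C) : rapid a ->
  rapid (fun xi => a (- xi.1, - xi.2)).
Proof.
move=> ra p; have [A aA] := ra p; exists A => -[m n].
by have := aA (- m, - n); rewrite /weight /= !rmorphN /= !sqrrN.
Qed.

Definition cut_box (N : nat) (a : int * int ->
  C) xi : C := if xi \in box N then a xi else 0.

Lemma rapid_cut_box N (a : int * int -> C) : rapid (cut_box N a).
Proof.
move=> p; exists (\sum_(xi <- box N) normc (a xi) * weight xi ^+ p) => xi.
have t0 eta : 0 <= normc (a eta) * weight eta ^+ p.
  by rewrite mulr_ge0 ?normc_nneg// exprn_ge0// ltW// weight_gt0.
rewrite /cut_box; case: ifP => xN; last by rewrite normc0 mul0r sumr_ge0.
by rewrite (bigD1_seq xi xN (uniq_box N)) lerDl sumr_ge0.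
Qed.

(** s N plus and minus K / (N + 1) are monotone sequences with the same
    limit, which gives convergence and the rate at once. *)
Lemma telescoping_cvg (s : nat -> R) (K : R) :
  (forall N, `|s N.+1 - s N| <= K * (N.+1%:R^-1 - N.+2%:R^-1)) ->
  cvgn s /\ forall N, `|limn s - s N| <= K * N.+1%:R^-1.
Proof.
move=> sK.
pose up N := s N + K * N.+1%:R^-1; pose dn N := s N - K * N.+1%:R^-1.
have sK' N : s N - K * (N.+1%:R^-1 - N.+2%:R^-1) <= s N.+1 <=
    s N + K * (N.+1%:R^-1 - N.+2%:R^-1).
  by have := sK N; rewrite ler_distl.
have ni : nonincreasing_seq up.
  by apply/nonincreasing_seqP => N; have /andP[] := sK' N; rewrite /up => l r;
    move: l r; generalize (s N.+1) (s N) (N.+1%:R^-1 : R) (N.+2%:R^-1 : R) => *;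
      lra.
have nd : nondecreasing_seq dn.
  by apply/nondecreasing_seqP => N; have /andP[] := sK' N; rewrite /dn => l r;
    move: l r; generalize (s N.+1) (s N) (N.+1%:R^-1 : R) (N.+2%:R^-1 : R) => *;
      lra.
have K0 : 0 <= K.
  have : 0 <= K * (1^-1 - 2^-1) by exact: le_trans (sK 0%N).
  by rewrite pmulr_lge0//; lra.
have KN N : 0 <= K * N.+1%:R^-1 by rewrite mulr_ge0// invr_ge0.
have cK : K * N.+1%:R^-1 @[N --> \oo] --> (0 : R).
  by rewrite -[X in _ --> X](mulr0 K); apply: cvgM;
    [exact: cvg_cst|exact: cvg_harmonic].
have cup : cvgn up.
  apply: nonincreasing_is_cvgn => //; exists (dn 0%N) => _ [N _ <-].
  rewrite (le_trans (nd _ _ (leq0n N)))// /dn /up;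
    by rewrite lerD2l (le_trans _ (KN N))// oppr_le0.
have cs : cvgn s.
  have -> : s = (fun N => up N - K * N.+1%:R^-1).
    by apply/funext => N; rewrite /up addrK.
  by apply: is_cvgB => //; apply/cvg_ex; exists 0.
have Lup : limn up = limn s.
  by rewrite limD// ?(cvg_lim _ cK)// ?addr0//; apply/cvg_ex; exists 0.
have Ldn : limn dn = limn s.
  by rewrite limB// ?(cvg_lim _ cK)// ?subr0//; apply/cvg_ex; exists 0.
have cdn : cvgn dn by apply: is_cvgB => //; apply/cvg_ex; exists 0.
split=> // N; rewrite ler_distl.
have := nonincreasing_cvgn_ge ni cup N; have := nondecreasing_cvgn_le nd cdn N.
by rewrite Lup Ldn => -> ->.
Qed.

(** h^x e^{2 pi i x.xi} with k = (ln h_1, ln h_2). Negating k turns h into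
    1/h, hence the eigenfunctions of L_h into those of its adjoint. *)
Definition qexp k xi : fct R := pexp (k.1%:C + tau xi.1) (k.2%:C + tau xi.2).

Definition eigval k xi : C := (k.1%:C + tau xi.1) ^+ 2 + (k.2%:C + tau xi.2) ^+
  2.

Definition qpsum (a : int * int -> C) k N : fct R :=
  fun x => \sum_(xi <- box N) a xi * qexp k xi x.

(** The limit is taken separately in the real and imaginary parts; it exists
    on the square when [a] is rapidly decaying, by [qseries_approx]. *)
Definition qseries (a : int * int -> C) k : fct R := fun x =>
  limn (fun N => Re (qpsum a k N x)) +i* limn (fun N => Im (qpsum a k N x)).

Definition qexp_bound k : R := expR `|k.1| * expR `|k.2|.

Lemma qexp_bounded k xi x : Omega x -> normc (qexp k xi x) <= qexp_bound k.
Proof.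
case: x => x y [+ +]; rewrite -[(x, y).1]/x -[(x,
  y).2]/y => /itvP x01 /itvP y01.
rewrite -[qexp k xi _]/(cexp (k.1%:C + tau xi.1) x * cexp (k.2%:C + tau xi.2)
  y).
rewrite normcM !normc_cexp !Re_add /= !addr0.
have bnd (r t : R) : 0 <= t <= 1 -> r * t <= `|r|.
  move=> /andP[t0 t1]; rewrite (le_trans (ler_norm _))// normrM (ger0_norm t0).
  by rewrite ler_piMr.
by rewrite ler_pM ?expR_ge0// ler_expR bnd// ?x01 ?y01.
Qed.

Lemma normc_sum (I : Type) (s : seq I) (P : pred I) (F : I -> C) :
  normc (\sum_(i <- s | P i) F i) <= \sum_(i <- s | P i) normc (F i).
Proof.
elim/big_rec2 : _ => [|i x y _ H]; first by rewrite normc0.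
by rewrite (le_trans (normc_triangle _ _))// lerD2l.
Qed.

(** The step adds at most (2N + 3)^2 terms of size (N + 1)^(-4), and the
    bound is written as a telescoping difference. *)
Lemma qpsum_step (a : int * int -> C) k : rapid a -> exists2 K : R, 0 <= K &
  forall N x, Omega x ->
    normc (qpsum a k N.+1 x - qpsum a k N x) <= K * (N.+1%:R^-1 - N.+2%:R^-1).
Proof.
move=> ra; have [B aB] := ra 2%N; pose b := qexp_bound k.
have b0 : 0 <= b by rewrite mulr_ge0 ?expR_ge0.
have B0 : 0 <= B.
  by apply: le_trans (aB (0, 0));
    rewrite mulr_ge0 ?normc_nneg// exprn_ge0// ltW// weight_gt0.
(* 18 = 9 * 2, from (2n + 1)^2 <= 9 n^2 and n (n + 1) <= 2 n^2 with
   n = N + 1. *)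
exists (18 * (B * b)) => [|N x Ox]; first by rewrite mulr_ge0// mulr_ge0.
have -> : qpsum a k N.+1 x - qpsum a k N x =
    \sum_(xi <- box N.+1 | xi \notin box N) a xi * qexp k xi x.
  rewrite /qpsum (bigID (mem (box N)))/= sum_box_sub; last exact: leqnSn.
  by rewrite addrAC subrr add0r.
apply: le_trans (normc_sum _ _ _) _.
pose n : R := N.+1%:R; have n1 : 1 <= n by rewrite ler1n.
have n0 : 0 < n by lra.
have term xi : xi \notin box N -> normc (a xi * qexp k xi x) <= B / n ^+ 4 * b.
  move=> xN; rewrite normcM ler_pM ?normc_nneg ?qexp_bounded//.
  rewrite ler_pdivlMr ?exprn_gt0// (le_trans _ (aB xi))//.
  rewrite ler_wpM2l ?normc_nneg// (exprM n 2 2) ler_pXn2r ?nnegrE ?exprn_ge0//.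
    exact: weight_out.
  by rewrite ltW// weight_gt0.
have -> : N.+2%:R = n + 1 :> R by rewrite natr1.
apply: (@le_trans _ _ (\sum_(xi <- box N.+1) (B / n ^+ 4 * b))).
  rewrite big_mkcond ler_sum// => xi _; case: ifP => xN; first exact: term.
  by rewrite mulr_ge0// divr_ge0// exprn_ge0// ltW.
rewrite big_const_seq iter_addr_0 count_predT size_box -[_ *+ (_ * _)]mulr_natl
  natrM.
have -> : ((N.+1).*2.+1)%:R = 2 * n + 1 :> R.
  by rewrite -natr1 -mul2n natrM.
have -> : n^-1 - (n + 1)^-1 = (n * (n + 1))^-1.
  by field; rewrite !gt_eqF//; lra.
have -> : (2 * n + 1) * (2 * n + 1) * (B / n ^+ 4 * b) =
   (B * b) * ((2 * n + 1) ^+ 2 / n ^+ 4) by field; rewrite gt_eqF.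
have -> : 18 * (B * b) / (n * (n + 1)) = (B * b) * (18 / (n * (n + 1))).
  by rewrite [18 * _]mulrC -[LHS]mulrA.
rewrite ler_wpM2l ?mulr_ge0//.
rewrite ler_pdivrMr ?exprn_gt0// mulrAC ler_pdivlMr; last by rewrite mulr_gt0//;
  lra.
have nn : 0 <= n * n by rewrite mulr_ge0// ltW.
have h1 : (2 * n + 1) ^+ 2 <= 9 * (n * n) by nra.
have h2 : n * (n + 1) <= 2 * (n * n) by nra.
rewrite (le_trans (ler_pM (sqr_ge0 _) _ h1 h2))//; first by rewrite mulr_ge0//;
  lra.
by rewrite le_eqVlt; apply/orP; left; apply/eqP; ring.
Qed.

Lemma qseries_approx (a : int * int -> C) k : rapid a -> exists2 K : R, 0 <= K &
  forall N x, Omega x ->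
    [/\ cvgn (fun N => Re (qpsum a k N x)), cvgn (fun N => Im (qpsum a k N x)) &
        normc (qseries a k x - qpsum a k N x) <= K * N.+1%:R^-1].
Proof.
move=> /(qpsum_step k)[K K0 step]; exists (2 * K) => [|N x Ox];
  first by rewrite mulr_ge0.
have [cr lr] := @telescoping_cvg (fun N => Re (qpsum a k N x)) K
  (fun N => le_trans (eq_ind _ (fun r =>
    `|r| <= _) (Re_le_normc _) _ (etrans (Re_add _ _) (congr1 _ (Re_opp _))))
      (step N x Ox)).
have [ci li] := @telescoping_cvg (fun N => Im (qpsum a k N x)) K
  (fun N => le_trans (eq_ind _ (fun r =>
    `|r| <= _) (Im_le_normc _) _ (etrans (Im_add _ _) (congr1 _ (Im_opp _))))
      (step N x Ox)).
split => //; apply: le_trans (normc_le_ReIm _) _.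
rewrite Re_add Im_add Re_opp Im_opp /= mulrDl mul1r mulrDl.
by rewrite lerD.
Qed.

Lemma cmeas_qpsum (a : int * int -> C) k N : cmeas (qpsum a k N).
Proof.
apply: cmeas_sum => xi; apply: cmeasZ; apply: cinteg_meas.
exact/ccont_cinteg/ccont_pexp.
Qed.

Lemma cmeas_qseries (a : int * int -> C) k : rapid a -> cmeas (qseries a k).
Proof.
move=> ra; have [K _ H] := qseries_approx k ra.
split; apply: (rmeas_lim (u := fun N x => _)).
- by move=> N; exact: (cmeas_qpsum a k N).1.
- by move=> x Ox; have [] := H 0%N x Ox.
- by move=> N; exact: (cmeas_qpsum a k N).2.
- by move=> x Ox; have [] := H 0%N x Ox.
Qed.

Lemma qpsum_bounded (a : int * int -> C) k N : exists B : R,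
  forall x, Omega x -> normc (qpsum a k N x) <= B.
Proof.
exists (\sum_(xi <- box N) normc (a xi) * qexp_bound k) => x Ox.
apply: le_trans (normc_sum _ _ _) _; apply: ler_sum => xi _.
by rewrite normcM ler_wpM2l ?normc_nneg// qexp_bounded.
Qed.

Lemma L2_qpsum (a : int * int -> C) k N : L2 (qpsum a k N).
Proof.
have [B pB] := qpsum_bounded a k N.
exact: (L2_bounded (cmeas_qpsum a k N) pB).
Qed.

Lemma L2_qseries (a : int * int -> C) k : rapid a -> L2 (qseries a k).
Proof.
move=> ra; have [K _ H] := qseries_approx k ra;
  have [B pB] := qpsum_bounded a k 0.
apply: (@L2_bounded _ _ (K + B)); first exact: cmeas_qseries.
move=> x Ox; have [_ _] := H 0%N x Ox; rewrite [K * _](_ : _ = K) => [h|];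
  last by rewrite invr1 mulr1.
rewrite -[qseries a k x](subrK (qpsum a k 0 x)) (le_trans (normc_triangle _
  _))// lerD//.
exact: pB.
Qed.

(** Finite sums are series, so what holds for series applies to partial sums. *)
Lemma qseries_cut_box (a : int * int ->
  C) k N : qseries (cut_box N a) k = qpsum a k N.
Proof.
apply/funext => x; rewrite /qseries.
have H M : (N <= M)%N -> qpsum (cut_box N a) k M x = qpsum a k N x.
  move=> NM; rewrite /qpsum -(sum_box_sub _ NM) [RHS]big_mkcond.
  by apply: eq_bigr => xi _; rewrite /cut_box; case: ifP => //; rewrite mul0r.
have HN : \forall M \near \oo, qpsum (cut_box N a) k M x = qpsum a k N x.
  by exists N => // M /= NM; exact: H.
apply: complex_ext => /=; apply: cvg_lim => //; apply: cvg_near_cst;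
  by apply: filterS HN => M ->.
Qed.

Lemma qseries_lin (c : C) (a b : int * int -> C) k x : rapid a -> rapid b ->
  Omega x ->
  qseries (fun xi => c * a xi + b xi) k x = c * qseries a k x + qseries b k x.
Proof.
move=> ra rb Ox; have [_ _ /(_ 0%N x Ox)[ar ai _]] := qseries_approx k ra.
have [_ _ /(_ 0%N x Ox)[br bi _]] := qseries_approx k rb.
have E N : qpsum (fun xi => c * a xi + b xi) k N x =
  c * qpsum a k N x + qpsum b k N x.
  rewrite /qpsum mulr_sumr -big_split; apply: eq_bigr => xi _.
  by rewrite /= mulrDl mulrA.
have mk (s : nat -> R) (r : R) : cvgn s -> r * s N @[N --> \oo] --> r * limn s.
  by move=> cs; apply: cvgM; [exact: cvg_cst|exact: cs].
apply: complex_ext; rewrite ?Re_add ?Im_add ?Re_mul ?Im_mul /qseries /=;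
  apply: cvg_lim => //.
  under eq_fun do rewrite E Re_add Re_mul.
  by apply: cvgD; [apply: cvgB; exact: mk|exact: br].
under eq_fun do rewrite E Im_add Im_mul.
by apply: cvgD; [apply: cvgD; exact: mk|exact: bi].
Qed.

Lemma cint_qseries_approx (a : int * int -> C) k phi : rapid a -> L2 phi ->
  exists2 K : R, 0 <= K & forall N,
  normc (cint (fun x => qseries a k x * phi x) -
         \sum_(xi <- box N) a xi * cint (fun x =>
           qexp k xi x * phi x)) <= K * N.+1%:R^-1.
Proof.
move=> ra Lphi; have [K K0 H] := qseries_approx k ra.
have [M M0 bd] := cint_bound Lphi.
exists (K * M) => [|N]; first by rewrite mulr_ge0.
have iE xi : cinteg (fun x => qexp k xi x * phi x).
  by apply: L2M => //; exact/ccont_L2/ccont_pexp.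
have -> : \sum_(xi <- box N) a xi * cint (fun x => qexp k xi x * phi x) =
    cint (fun x => qpsum a k N x * phi x).
  rewrite [RHS](_ : _ = cint (fun x =>
    \sum_(xi <- box N) a xi * (qexp k xi x * phi x))).
    rewrite cint_sum; first by apply: eq_bigr => xi _; rewrite cintZ.
    by move=> xi; exact: cintegZ.
  congr cint; apply/funext => x; rewrite /qpsum mulr_suml.
  by apply: eq_bigr => xi _; rewrite mulrA.
have -> : cint (fun x => qseries a k x * phi x) - cint (fun x =>
  qpsum a k N x * phi x) =
    cint (fun x => (qseries a k x - qpsum a k N x) * phi x).
  have i1 : cinteg (fun x => qseries a k x * phi x) by apply: L2M => //;
    exact: L2_qseries.
  have i2 : cinteg (fun x => qpsum a k N x * phi x) by apply: L2M => //;
    exact: L2_qpsum.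
  rewrite -mulN1r -cintZ// -cintD//; last exact: cintegZ.
  by congr cint; apply/funext => x; rewrite mulrBl mulN1r.
rewrite mulrAC; apply: bd.
  by apply: L2_cmeas; apply: L2B; [exact: L2_qseries|exact: L2_qpsum].
by move=> x Ox; have [] := H N x Ox.
Qed.

Lemma eq_of_approx (X Y : C) (Z : nat -> C) (K L : R) :
  (forall N, normc (X - Z N) <= K * N.+1%:R^-1) ->
  (forall N, normc (Y - Z N) <= L * N.+1%:R^-1) -> X = Y.
Proof.
move=> XZ YZ; apply/eqP; rewrite -subr_eq0; apply/eqP/eq0_normc.
have bd N : normc (X - Y) <= (K + L) * N.+1%:R^-1.
  have -> : X - Y = (X - Z N) - (Y - Z N) by ring.
  by rewrite (le_trans (normc_triangleB _ _))// mulrDl lerD.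
apply/le_anti/andP; split; last exact: normc_nneg.
have c : (K + L) * N.+1%:R^-1 @[N --> \oo] --> (0 : R).
  by rewrite -[X in _ --> X](mulr0 (K + L)); apply: cvgM;
    [exact: cvg_cst|exact: cvg_harmonic].
rewrite -(cvg_lim _ c)//; apply: limr_ge; first by apply/cvg_ex; exists 0.
exact: nearW.
Qed.

(** Equality of two integrals of series is checked term by term. *)
Lemma cint_qseries_transfer (a b : int * int -> C) k phi psi :
  rapid a -> rapid b -> L2 phi -> L2 psi ->
  (forall xi, a xi * cint (fun x => qexp k xi x * phi x) =
              b xi * cint (fun x => qexp k xi x * psi x)) ->
  cint (fun x => qseries a k x * phi x) = cint (fun x => qseries b k x * psi x).
Proof.
move=> ra rb Lphi Lpsi E.
have [K _ HK] := cint_qseries_approx k ra Lphi;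
  have [L _ HL] := cint_qseries_approx k rb Lpsi.
apply: (eq_of_approx HK) => N; under eq_bigr => xi _ do rewrite E.
exact: HL.
Qed.
End Series.

(** * Operators diagonalized by exponentials *)
Section Diagonal.
Context {R : realType}.
Implicit Types (f g : fct R) (k : R * R) (xi eta : int * int) (A : operator R).
Local Notation C := R[i].
Local Notation Omega := (@Omega R).

Definition opp2 {V : zmodType} (k : V * V) : V * V := (- k.1, - k.2).

Lemma opp2K {V : zmodType} (k : V * V) : opp2 (opp2 k) = k.
Proof. by case: k => a b; rewrite /opp2 /= !opprK. Qed.

Lemma tauN m : tau (- m) = - tau m :> C.
Proof.
by apply: complex_ext; rewrite ?Re_opp ?Im_opp /= ?oppr0// rmorphN /= mulrN.
Qed.

Lemma tau_conj m : conjc (tau m) = tau (- m) :> C.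
Proof. by rewrite /tau /= rmorphN mulrN. Qed.

Lemma cexp_tau m : cexp (tau m) (1 : R) = 1.
Proof.
have H (n : nat) : cexp (tau n) (1 : R) = 1.
  elim: n => [|n IH]; first by rewrite tau0 cexp0.
  rewrite -addn1 PoszD tauD cexpD IH mul1r /cexp /= mul0r expR0 !mul1r !mulr1.
  by rewrite mulr_natl cos2pi sin2pi.
case: m => n; first exact: H.
by rewrite NegzE -tau_conj -cexp_conj H conjc1.
Qed.

Lemma cexp_char (r : R) m : cexp (r%:C + tau m) 1 = (expR r)%:C.
Proof.
rewrite cexpD cexp_tau mulr1 /cexp /= mul0r cos0 sin0 !mulr1 mulr0.
by [].
Qed.

Lemma char_conj (r : R) m : conjc (r%:C + tau m) = r%:C + tau (- m).
Proof.
by apply: complex_ext; rewrite -tau_conj /= ?addr0 ?add0r.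
Qed.

Lemma qexp_conj k xi x : conjc (qexp k xi x) = qexp k (opp2 xi) x.
Proof.
by rewrite /qexp pexp_conj !char_conj.
Qed.

Lemma eigval_conj k xi : conjc (eigval k xi) = eigval k (opp2 xi).
Proof.
have cE (z w : C) : conjc (z ^+ 2 + w ^+ 2) = conjc z ^+ 2 + conjc w ^+ 2.
  by rewrite !expr2; case: z => a b; case: w => c d; apply: complex_ext => /=;
    ring.
by rewrite /eigval cE !char_conj.
Qed.

Lemma eigval_opp k xi : eigval (opp2 k) (opp2 xi) = eigval k xi.
Proof. by rewrite /eigval /opp2 /= !tauN !rmorphN /= -!opprD !sqrrN. Qed.

Lemma qexp_mul k xi eta x :
  qexp k xi x * qexp (opp2 k) eta x =
    pexp (tau (xi.1 + eta.1)) (tau (xi.2 + eta.2)) x.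
Proof.
by rewrite /qexp -pexpD /opp2 /= !tauD !rmorphN /=; congr (pexp _ _ x); ring.
Qed.

Lemma tau_eq0 m : (tau m == 0 :> C) = (m == 0).
Proof.
rewrite eq_complex /= eqxx /= mulf_eq0 intr_eq0 mulf_eq0 pnatr_eq0 /=.
by rewrite gt_eqF ?pi_gt0.
Qed.

Lemma cint_qexp_mul k xi eta :
  cint (fun x => qexp k xi x * qexp (opp2 k) eta x) = (xi == opp2 eta)%:R.
Proof.
rewrite [LHS](_ : _ = cint (pexp (tau (xi.1 + eta.1)) (tau (xi.2 + eta.2))));
  last first.
  by congr cint; apply/funext => x; rewrite qexp_mul.
have [->|xe] := eqVneq xi (opp2 eta).
  rewrite /opp2 /= !addNr tau0.
  by under eq_cint => x _ do rewrite pexp00; rewrite cint_cst.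
rewrite cint_pexp_period ?cexp_tau// !tau_eq0 !addr_eq0.
by move: xe; case: (xi) => a b; rewrite xpair_eqE negb_and.
Qed.

(** The bilinear pairing, without conjugation: for the series with parameter
    k the coefficients are read off with parameter -k, at the opposite
    frequency. *)
Definition coef k f eta : C := cint (fun x => f x * qexp k eta x).

Lemma L2_qexp k xi : L2 (qexp k xi). Proof. exact/ccont_L2/ccont_pexp. Qed.

Lemma qexp_complete k f : cinteg f -> (forall eta, coef k f eta = 0) ->
  aeO f (fun=> 0).
Proof.
by move=> inf f0; apply: (pexp_complete inf) => m n; exact: (f0 (m, n)).
Qed.

Lemma coefB k f g eta : L2 f -> L2 g ->
  coef k (fun x => f x - g x) eta = coef k f eta - coef k g eta.
Proof.
move=> Lf Lg; have Le := L2_qexp k eta; rewrite /coef -mulN1r.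
rewrite -cintZ -?cintD; [|exact: L2M|apply: cintegZ|]; [|exact: L2M..].
by congr cint; apply/funext => x; rewrite mulrBl mulN1r.
Qed.

Lemma ae_eq_of_coef k f g : L2 f -> L2 g ->
  (forall eta, coef k f eta = coef k g eta) -> aeO f g.
Proof.
move=> Lf Lg E.
have := @qexp_complete k _ (L2_cinteg (L2B Lf Lg)) => H.
have {}H : aeO (fun x => f x - g x) (fun=> 0).
  by apply: H => eta; rewrite coefB// E subrr.
by apply: filterS H => x e Ox; apply/eqP; rewrite -subr_eq0 e.
Qed.

Lemma coef_ae k f g eta : L2 f -> L2 g -> aeO f g ->
  coef k f eta = coef k g eta.
Proof.
move=> Lf Lg fg; have Le := L2_qexp k eta; apply: cint_ae.
- by apply: cmeasM; exact: L2_cmeas.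
- by apply: cmeasM; exact: L2_cmeas.
- by apply: filterS fg => x e Ox; rewrite e.
Qed.

(** By [cint_qseries_transfer] the series can be truncated to a box that
    contains the one frequency which contributes. *)
Lemma coef_qseries (a : int * int -> C) k eta : rapid a ->
  coef (opp2 k) (qseries a k) eta = a (opp2 eta).
Proof.
move=> ra; pose M := (`|eta.1| + `|eta.2|)%N.
have mM : opp2 eta \in box M.
  by rewrite mem_box /opp2 /= !abszN /M; lia.
have E : coef (opp2 k) (qseries a k) eta =
  coef (opp2 k) (qseries (cut_box M a) k) eta.
  apply: cint_qseries_transfer => //;
    [exact: rapid_cut_box|exact: L2_qexp|exact: L2_qexp|].
  move=> xi; rewrite cint_qexp_mul; have [->|_] := eqVneq xi (opp2 eta).
    by rewrite /cut_box mM.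
  by rewrite !mulr0.
rewrite {}E /coef qseries_cut_box.
rewrite [LHS](_ : _ = cint (fun x =>
  \sum_(xi <- box M) a xi * (qexp k xi x * qexp (opp2 k) eta x))).
  rewrite cint_sum; last first.
    by move=> xi; apply: cintegZ; apply: L2M; exact: L2_qexp.
  rewrite (bigD1_seq (opp2 eta) mM (uniq_box M)) /= big1 => [|xi xe].
    rewrite addr0 cintZ; last by apply: L2M; exact: L2_qexp.
    by rewrite cint_qexp_mul eqxx mulr1.
  rewrite cintZ; last by apply: L2M; exact: L2_qexp.
  by rewrite cint_qexp_mul (negbTE xe) mulr0.
congr cint; apply/funext => x; rewrite /qpsum mulr_suml.
by apply: eq_bigr => xi _; rewrite mulrA.
Qed.

Lemma normc_sqr (z : C) : normc (z ^+ 2) = Re z ^+ 2 + Im z ^+ 2.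
Proof. by rewrite expr2 normcM -sqr_normcE expr2. Qed.

Lemma eigval_le_weight k : exists2 L : R, 0 <= L & forall xi,
  normc (eigval k xi) <= L * weight xi.
Proof.
exists (k.1 ^+ 2 + k.2 ^+ 2 + (2 * pi) ^+ 2).
  by rewrite addr_ge0 ?sqr_ge0// addr_ge0 ?sqr_ge0.
move=> xi; rewrite /eigval (le_trans (normc_triangle _ _))// !normc_sqr !Re_add
  !Im_add /= !add0r !addr0.
rewrite /weight !exprMn.
have := sqr_ge0 k.1; have := sqr_ge0 k.2.
have : 0 <= (2 ^+ 2 * pi ^+ 2 : R) by rewrite mulr_ge0 ?sqr_ge0.
have := sqr_ge0 (xi.1%:~R : R); have := sqr_ge0 (xi.2%:~R : R).
move: (k.1 ^+ 2) (k.2 ^+ 2) (2 ^+ 2 * pi ^+ 2 : R) => p q r.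
move: (xi.1%:~R ^+ 2 : R) (xi.2%:~R ^+ 2 : R) => s t *.
have : 0 <= p * (s + t) by rewrite mulr_ge0// addr_ge0.
have : 0 <= q * (s + t) by rewrite mulr_ge0// addr_ge0.
nra.
Qed.

(** The real part of the eigenvalue is |k|^2 - 4 pi^2 |xi|^2, so eigenvalues
    control the weight although some of them may vanish. *)
Lemma weight_le_eigval k xi : weight xi <=
  normc (eigval k xi) + (1 + k.1 ^+ 2 + k.2 ^+ 2).
Proof.
have := le_trans (ler_norm _) (eq_ind _ (fun r =>
  r <= _) (Re_le_normc (eigval k xi)) _ (esym (normrN _))).
rewrite {1}/eigval Re_add !expr2 !Re_mul !Re_add !Im_add /= !add0r !addr0
  /weight -!expr2 !exprMn.
have p2 : 1 <= (2 ^+ 2 * pi ^+ 2 : R).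
  have := @pi_ge2 R => p2; rewrite !expr2; nra.
have := sqr_ge0 (xi.1%:~R : R); have := sqr_ge0 (xi.2%:~R : R).
move: (k.1 ^+ 2) (k.2 ^+ 2) (2 ^+ 2 * pi ^+ 2 : R) p2 => p q r p2.
move: (xi.1%:~R ^+ 2 : R) (xi.2%:~R ^+ 2 : R) => s t s0 t0.
have : 0 <= (r - 1) * (s + t) by rewrite mulr_ge0 ?subr_ge0// addr_ge0.
nra.
Qed.

Lemma rapid_eigval (a : int * int -> C) k : rapid a ->
  rapid (fun xi => eigval k xi * a xi).
Proof.
move=> ra p; have [L L0 lL] := eigval_le_weight k; have [B aB] := ra p.+1.
exists (L * B) => xi; have r0 : 0 <= weight xi :> R := ltW (weight_gt0 xi).
rewrite normcM -mulrA (le_trans (ler_wpM2r _ (lL xi)))//.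
  by rewrite mulr_ge0 ?normc_nneg// exprn_ge0.
by rewrite -mulrA ler_wpM2l// mulrCA -exprS.
Qed.

(** Each factor of the weight is traded for one more power of the eigenvalue,
    up to a multiple of the previous bound. *)
Lemma rapid_of_eigval_powers (a : int * int -> C) k :
  (forall j, exists B : R, forall xi, normc (eigval k xi ^+ j * a xi) <= B) ->
    rapid a.
Proof.
move=> H.
have K p : forall j, exists B : R, forall xi,
    normc (eigval k xi ^+ j * a xi) * weight xi ^+ p <= B.
  elim: p => [|p IH] j.
    by have [B HB] := H j; exists B => xi; rewrite expr0 mulr1.
  have [B1 H1] := IH j.+1; have [B0 H0] := IH j.
  pose q : R := 1 + k.1 ^+ 2 + k.2 ^+ 2.
  have q0 : 0 <= q by rewrite addr_ge0 ?sqr_ge0// addr_ge0 ?sqr_ge0.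
  exists (B1 + q * B0) => xi.
  have X0 : 0 <= normc (eigval k xi ^+ j * a xi) * weight xi ^+ p.
    by rewrite mulr_ge0 ?normc_nneg// exprn_ge0// ltW// weight_gt0.
  rewrite exprSr mulrA (le_trans (ler_wpM2l X0 (weight_le_eigval k xi)))//.
  rewrite mulrDr lerD//; last by rewrite mulrC ler_wpM2l// H0.
  rewrite (le_trans _ (H1 xi))//.
  have -> : normc (eigval k xi ^+ j.+1 * a xi) =
      normc (eigval k xi) * normc (eigval k xi ^+ j * a xi).
    by rewrite exprS -mulrA normcM.
  by rewrite mulrC mulrA.
move=> p; have [B HB] := K p 0%N; exists B => xi.
by rewrite (le_trans _ (HB xi))// expr0 mul1r.
Qed.

(** What is needed of an operator in order to describe its smooth functions:
    it acts on coefficients by eigenvalues (second clause), and termwise on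
    every function that is a.e. equal to a series (third clause). *)
Definition diagonal A k : Prop :=
  [/\ forall f g, A f g -> L2 f /\ L2 g,
      forall f g, A f g -> forall eta,
        coef (opp2 k) g eta = eigval (opp2 k) eta * coef (opp2 k) f eta &
      forall (a : int * int -> C) f, rapid a -> L2 f -> aeO f (qseries a k) ->
        A f (qseries (fun xi => eigval k xi * a xi) k)].

Section WithDiagonal.
Variables (A : operator R) (k : R * R).
Hypothesis dA : diagonal A k.

(** Two values have the same coefficients, so completeness applies. *)
Lemma diagonal_unique f g g' : A f g -> A f g' -> aeO g g'.
Proof.
move=> Ag Ag'; have [HL Hc _] := dA.
apply: (@ae_eq_of_coef (opp2 k)); [exact: (HL _ _ Ag).2|exact: (HL _ _ Ag').2|].
by move=> eta; rewrite (Hc _ _ Ag) (Hc _ _ Ag').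
Qed.

Lemma opvalP f : dom A f -> A f (opval A f).
Proof. by move=> [g Ag]; rewrite /opval;
  exact: (xgetPex _ (ex_intro _ g Ag)). Qed.

Lemma diagonal_step (a : int * int -> C) f : rapid a -> L2 f ->
  aeO f (qseries a k) ->
  [/\ dom A f, L2 (opval A f) &
    aeO (opval A f) (qseries (fun xi => eigval k xi * a xi) k)].
Proof.
move=> ra Lf fa; have [HL _ Hs] := dA; have As := Hs a f ra Lf fa.
have df : dom A f by exists (qseries (fun xi => eigval k xi * a xi) k).
have Av := opvalP df; split => //; first exact: (HL _ _ Av).2.
exact: diagonal_unique Av As.
Qed.

Definition eigpow (a : int * int -> C) j xi : C := eigval k xi ^+ j * a xi.

Lemma rapid_eigpow (a : int * int -> C) j : rapid a -> rapid (eigpow a j).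
Proof.
move=> ra; elim: j => [|j IH].
  by apply: rapid_le ra _ => xi; rewrite /eigpow expr0 mul1r.
apply: rapid_le (rapid_eigval k IH) _ => xi.
by rewrite /eigpow exprS mulrA.
Qed.

Lemma diagonal_iter (a : int * int -> C) f j : rapid a -> L2 f ->
  aeO f (qseries a k) ->
  L2 (iter j (opval A) f) /\ aeO (iter j (opval A) f) (qseries (eigpow a j) k).
Proof.
move=> ra Lf fa; elim: j => [|j [IHL IHa]] /=.
  split=> //; rewrite (_ : eigpow a 0 = a)//.
  by apply/funext => xi; rewrite /eigpow expr0 mul1r.
have [_ L e] := diagonal_step (rapid_eigpow j ra) IHL IHa; split => //.
rewrite (_ : eigpow a j.+1 = fun xi => eigval k xi * eigpow a j xi)//.
by apply/funext => xi; rewrite /eigpow exprS mulrA.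
Qed.

(** All iterates are again a.e. equal to series, whatever representatives are
    chosen. *)
Lemma Hinf_of_qseries (a : int * int -> C) f : rapid a -> L2 f ->
  aeO f (qseries a k) -> Hinf A f.
Proof.
move=> ra Lf fa p _ j _; have [L e] := diagonal_iter j ra Lf fa.
by have [] := diagonal_step (rapid_eigpow j ra) L e.
Qed.

(** The coefficients of the j-th iterate are those of f times the j-th powers
    of the eigenvalues, and they are bounded; so those of f decay rapidly,
    and the series they define is f by completeness. *)
Lemma qseries_of_Hinf f : Hinf A f ->
  exists2 a : int * int -> C, rapid a & L2 f /\ aeO f (qseries a k).
Proof.
move=> Hf; have [HL Hc _] := dA.
have Aj j : A (iter j (opval A) f) (iter j.+1 (opval A) f).
  by apply: opvalP; exact: (Hf j.+1 isT j (leqnn _)).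
have Lf : L2 f := (HL _ _ (Aj 0%N)).1.
pose a xi := coef (opp2 k) f (opp2 xi).
have cj j eta : coef (opp2 k) (iter j (opval A) f) eta =
    eigval (opp2 k) eta ^+ j * coef (opp2 k) f eta.
  elim: j => [|j IH]; first by rewrite expr0 mul1r.
  by rewrite (Hc _ _ (Aj j)) IH exprS mulrA.
have ra : rapid a.
  apply: (@rapid_of_eigval_powers _ k) => j.
  have [M M0 bd] := cint_bound (HL _ _ (Aj j)).1.
  exists (qexp_bound (opp2 k) * M) => xi; rewrite -eigval_opp -cj /coef.
  under eq_cint => x _ do rewrite mulrC.
  apply: bd; first exact/L2_cmeas/L2_qexp.
  by move=> x Ox; exact: qexp_bounded.
exists a => //; split => //.
apply: (@ae_eq_of_coef (opp2 k)) => //; first exact: L2_qseries.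
by move=> eta; rewrite coef_qseries// /a opp2K.
Qed.

Lemma seminorm_le (a : int * int -> C) f p (eps : R) : rapid a -> L2 f ->
  aeO f (qseries a k) -> 0 <= eps ->
  (forall j, (j <= p)%N -> forall x, Omega x ->
    normc (qseries (eigpow a j) k x) <= eps) ->
  seminorm A p f <= eps.
Proof.
move=> ra Lf fa e0 H; rewrite /seminorm; apply: bigmax_le => // j _.
have [Lj ej] := diagonal_iter j ra Lf fa.
apply: L2norm_le => //; first exact: L2_cmeas.
exists (qseries (eigpow a j) k) => //; split; first by apply: H; rewrite -ltnS.
by apply: cmeas_qseries; exact: rapid_eigpow.
Qed.
End WithDiagonal.

Lemma qseries_delta k xi : exists2 a : int * int ->
  C, rapid a & qseries a k = qexp k xi.
Proof.
pose M := (`|xi.1| + `|xi.2|)%N; pose d eta : C := (eta == xi)%:R.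
have mM : xi \in box M by rewrite mem_box /M; lia.
exists (cut_box M d); first exact: rapid_cut_box.
rewrite qseries_cut_box; apply/funext => x; rewrite /qpsum.
rewrite (bigD1_seq xi mM (uniq_box M)) /= big1 => [|eta ex].
  by rewrite /d eqxx mul1r addr0.
by rewrite /d (negbTE ex) mul0r.
Qed.

End Diagonal.

(** * The operator and its adjoint *)
Section Operators.
Context {R : realType}.
Implicit Types (f g : fct R) (xi eta : int * int) (h : R * R).
Local Notation C := R[i].
Local Notation Omega := (@Omega R).

Definition log_pair h : R * R := (ln h.1, ln h.2).

(** A test function vanishes near every point outside of its compact support,
    in particular near the boundary of the square. *)
Lemma pd_out chi x : test_function chi -> ~ Omega x ->
  pd1 chi x = 0 /\ pd2 chi x = 0.
Proof.
case: x => x y [sc [K [cK KO K0]]] nO.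
have oK : open (~` K) by apply: closed_openC; apply: compact_closed => //;
  exact: norm_hausdorff.
have nK : (~` K) (x, y) by move=> /KO.
have N := open_nbhs_nbhs (conj oK nK).
have [d1 d2] := smooth_D sc.
have D0 (p p' : R -> R) (t : R) : has_deriv p p' -> (\near t, p t = 0) ->
  p' t = 0.
  move=> pp' n0; have e1 := pp' t.
  have e2 : is_derive t (1 : R) p 0.
    have N0 : \near t, (fun=> 0 : R) t = p t by apply: filterS n0 => s ->.
    by apply: (near_eq_is_derive N0); exact: is_derive_cst.
  by rewrite -(@derive_val _ _ _ _ _ _ _ e1) (@derive_val _ _ _ _ _ _ _ e2).
have N1 : \forall s \near x, (~` K) (s, y).
  exact: (cvg_pair (@cvg_id _ (nbhs x)) (@cvg_cst _ y _ (nbhs x) _) N).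
have N2 : \forall s \near y, (~` K) (x, s).
  exact: (cvg_pair (@cvg_cst _ x _ (nbhs y) _) (@cvg_id _ (nbhs y)) N).
have [d1r d1i] := d1 y; have [d2r d2i] := d2 x.
split; apply: complex_ext.
- by apply: (D0 _ _ x d1r); apply: filterS N1 => s /K0 ->.
- by apply: (D0 _ _ x d1i); apply: filterS N1 => s /K0 ->.
- by apply: (D0 _ _ y d2r); apply: filterS N2 => s /K0 ->.
- by apply: (D0 _ _ y d2i); apply: filterS N2 => s /K0 ->.
Qed.

(** This is why the boundary condition of [Lop] contains the equation in the
    interior. *)
Lemma test_BC h chi : test_function chi -> classical_BC h chi.
Proof.
move=> tc t _.
have o0 : ~ Omega (0, t) by case=> /= + _; rewrite in_itv /= ltxx.
have o1 : ~ Omega (1, t) by case=> /= + _; rewrite in_itv /= ltxx andbF.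
have o2 : ~ Omega (t, 0) by case=> /= _; rewrite in_itv /= ltxx.
have o3 : ~ Omega (t, 1) by case=> /= _; rewrite in_itv /= ltxx andbF.
rewrite !(test_boundary tc)// (pd_out tc o0).1 (pd_out tc o1).1.
by rewrite (pd_out tc o2).2 (pd_out tc o3).2 !mulr0.
Qed.

Lemma Lop_of_weak_BC h f g : L2 f -> L2 g -> weak_BC h f g -> Lop h f g.
Proof.
move=> Lf Lg bc; split=> // chi tc; apply: bc; first by case: tc.
exact: test_BC.
Qed.

Section Positive.
Variable h : R * R.
Hypotheses (h1 : 0 < h.1) (h2 : 0 < h.2).
Let k := log_pair h.

Lemma cexp_log_pair xi : cexp ((k.1)%:C + tau xi.1) 1 = h.1%:C /\
                   cexp ((k.2)%:C + tau xi.2) 1 = h.2%:C.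
Proof. by rewrite !cexp_char /k /= !lnK ?posrE. Qed.

Lemma cexp_log_pair_opp xi : cexp (((opp2 k).1)%:C + tau xi.1) 1 =
  (h.1^-1)%:C /\
                       cexp (((opp2 k).2)%:C + tau xi.2) 1 = (h.2^-1)%:C.
Proof. by rewrite !cexp_char /k /= !expRN !lnK ?posrE. Qed.

Lemma green_qexp xi phi : smooth phi -> classical_BC (h.1^-1, h.2^-1) phi ->
  cint (fun x => qexp k xi x * laplacian phi x) = eigval k xi * cint (fun x =>
    qexp k xi x * phi x).
Proof.
by move=> sphi bc; have [e1 e2] := cexp_log_pair xi;
  exact: (green_pexp h1 h2 e1 e2).
Qed.

Lemma qexp_opp_BC eta : smooth (qexp (opp2 k) eta) /\
  classical_BC (h.1^-1, h.2^-1) (qexp (opp2 k) eta).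
Proof.
split; first exact: smooth_pexp.
by have [e1 e2] := cexp_log_pair_opp eta; exact: classical_BC_pexp.
Qed.

(** Green's formula for each term. *)
Lemma Lop_qseries (a : int * int -> C) f : rapid a -> L2 f ->
  aeO f (qseries a k) ->
  Lop h f (qseries (fun xi => eigval k xi * a xi) k).
Proof.
move=> ra Lf fa; have rla := rapid_eigval k ra.
apply: Lop_of_weak_BC => //; first exact: L2_qseries.
move=> phi sphi bc.
have Lphi : L2 phi by apply/ccont_L2/smooth_cont.
have LD : L2 (laplacian phi) by apply/ccont_L2/smooth_cont/smooth_laplacian.
rewrite /pairing (@cint_ae _ _ (fun x => qseries a k x * laplacian phi x)).
- by apply: cint_qseries_transfer => // xi; rewrite green_qexp// mulrCA mulrA.
- by apply: cmeasM; exact: L2_cmeas.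
- by apply: cmeasM; [exact: cmeas_qseries|exact: L2_cmeas].
- by apply: filterS fa => x e Ox; rewrite e.
Qed.

Lemma diagonal_Lop : diagonal (Lop h) k.
Proof.
split=> [f g []//|f g [Lf Lg _ bc] eta|a f]; last exact: Lop_qseries.
have [se be] := qexp_opp_BC eta.
have := bc _ se be; rewrite /pairing => e; rewrite /coef -[LHS]e.
rewrite [LHS](_ : _ = cint (fun x =>
  eigval (opp2 k) eta * (f x * qexp (opp2 k) eta x))).
  by rewrite cintZ//; apply: L2M => //; exact: L2_qexp.
by congr cint; apply/funext => x; rewrite laplacian_pexp /= mulrCA.
Qed.

Lemma Lop_qexp xi : Lop h (qexp k xi) (fun x => eigval k xi * qexp k xi x).
Proof.
apply: Lop_of_weak_BC; [exact: L2_qexp|by apply: L2Z; exact: L2_qexp|].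
move=> phi sphi bc; rewrite /pairing green_qexp// -cintZ.
  by congr cint; apply/funext => x; rewrite mulrA.
by apply: L2M; [exact: L2_qexp|exact/ccont_L2/smooth_cont].
Qed.

Lemma L2inner_conj f g : L2 f -> L2 g ->
  conjc (L2inner f g) = cint (fun x => g x * conjc (f x)).
Proof.
move=> Lf Lg; rewrite /L2inner -cint_conj; last by apply: L2M => //;
  exact: L2_conj.
congr cint; apply/funext => x.
by rewrite conjcM conjcK mulrC.
Qed.

(** Conjugation turns the sesquilinear condition into a bilinear one, where
    the coefficients of phi and psi = L_h phi are compared frequency by
    frequency. *)
Lemma adjoint_qseries (a : int * int -> C) f : rapid a -> L2 f ->
  aeO f (qseries a (opp2 k)) ->
  adjoint (Lop h) f (qseries (fun xi => eigval (opp2 k) xi * a xi) (opp2 k)).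
Proof.
move=> ra Lf fa; have rla := rapid_eigval (opp2 k) ra.
split=> //; first exact: L2_qseries.
move=> phi psi Hpp; have [Lphi Lpsi _ _] := Hpp.
apply: (can_inj (@conjcK R)); rewrite !L2inner_conj//; last exact: L2_qseries.
have Lcphi := L2_conj Lphi; have Lcpsi := L2_conj Lpsi.
rewrite (@cint_ae _ _ (fun x => qseries a (opp2 k) x * conjc (psi x))).
- apply: cint_qseries_transfer => // xi; rewrite mulrAC [RHS]mulrC;
  congr (_ * _).
  have [_ Hc _] := diagonal_Lop.
  have := Hc _ _ Hpp (opp2 xi);
    rewrite /coef -eigval_conj => /(congr1 (@conjc R)).
  rewrite conjcM conjcK -!cint_conj; [|by apply: L2M => //; exact: L2_qexp..].
  move=> e; rewrite [LHS](_ : _ = cint (fun x =>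
    conjc (psi x * qexp (opp2 k) (opp2 xi) x))).
    rewrite e; congr (_ * _); congr cint; apply/funext => x.
    by rewrite conjcM qexp_conj opp2K mulrC.
  congr cint; apply/funext => x.
  by rewrite conjcM qexp_conj opp2K mulrC.
- by apply: cmeasM; exact: L2_cmeas.
- by apply: cmeasM; [exact: cmeas_qseries|exact: L2_cmeas].
- by apply: filterS fa => x e Ox; rewrite e.
Qed.

(** The action on coefficients is the defining relation of the adjoint,
    applied to the eigenfunctions of L_h. *)
Lemma diagonal_adjoint : diagonal (adjoint (Lop h)) (opp2 k).
Proof.
split=> [f g []//|f g [Lf Lg H] eta|a f]; last exact: adjoint_qseries.
rewrite opp2K; have := H _ _ (Lop_qexp (opp2 eta)) => /(congr1 (@conjc R)).
have Le := L2_qexp k (opp2 eta).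
rewrite !L2inner_conj//; last exact: L2Z.
rewrite /coef => e.
rewrite [LHS](_ : _ = cint (fun x => g x * conjc (qexp k (opp2 eta) x))).
  rewrite -e -cintZ; last by apply: L2M => //; exact: L2_qexp.
  congr cint; apply/funext => x.
  by rewrite conjcM eigval_conj qexp_conj !opp2K mulrCA.
by congr cint; apply/funext => x; rewrite qexp_conj opp2K.
Qed.
End Positive.
End Operators.

(** * Continuous functionals *)
Section Functional.
Context {R : realType}.
Implicit Types (f g : fct R) (xi eta : int * int).
Local Notation C := R[i].
Local Notation Omega := (@Omega R).
Variables (A : operator R) (k : R * R).
Hypothesis dA : diagonal A k.
Variable w : functional R.
Hypothesis wlin : linear_on (Hinf A) w.
Hypothesis wcont : continuous_on A w.

Lemma Hinf_comb (a : C) f g : Hinf A f -> Hinf A g ->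
  Hinf A (fun x => a * f x + g x).
Proof.
move=> /(qseries_of_Hinf dA)[p rp [Lf fp]] /(qseries_of_Hinf dA)[q rq [Lg gq]].
apply: (@Hinf_of_qseries _ _ _ dA (fun xi => a * p xi + q xi)).
- by apply: rapidD => //; exact: rapidZ.
- by apply: L2D => //; exact: L2Z.
- by apply: filterS2 fp gq => x e1 e2 Ox; rewrite e1// e2// qseries_lin.
Qed.

Lemma Hinf_qexp xi : Hinf A (qexp k xi).
Proof.
have [a ra <-] := qseries_delta k xi.
by apply: (Hinf_of_qseries dA ra); [exact: L2_qseries|exact: aeO_refl].
Qed.

Lemma Hinf0 : Hinf A (fun=> 0).
Proof.
have -> : (fun=> 0) = (fun x => -1 * qexp k (0, 0) x + qexp k (0, 0) x).
  by apply/funext => x; rewrite mulN1r addNr.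
by apply: Hinf_comb; exact: Hinf_qexp.
Qed.

Lemma functional0 : w (fun=> 0) = 0.
Proof.
have := wlin 1 Hinf0 Hinf0; rewrite !mul1r addr0.
by move=> /eqP; rewrite -subr_eq subrr => /eqP <-.
Qed.

Lemma functionalZ (c : C) f : Hinf A f -> w (fun x => c * f x) = c * w f.
Proof.
move=> Hf; have := wlin c Hf Hinf0; rewrite functional0 addr0 => <-.
by congr w; apply/funext => x; rewrite addr0.
Qed.

Lemma HinfZ (c : C) f : Hinf A f -> Hinf A (fun x => c * f x).
Proof.
move=> Hf; have := Hinf_comb c Hf Hinf0.
by under eq_fun do rewrite addr0.
Qed.

Lemma functional_comb_sum (a : int * int -> C) (s : seq (int * int)) :
  Hinf A (fun x => \sum_(xi <- s) a xi * qexp k xi x) /\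
  w (fun x => \sum_(xi <- s) a xi * qexp k xi x) =
    \sum_(xi <- s) a xi * w (qexp k xi).
Proof.
elim: s => [|xi s [IH1 IH2]].
  under [in X in X /\ _]eq_fun do rewrite big_nil.
  under [in X in _ /\ X]eq_fun do rewrite big_nil.
  by rewrite big_nil; split; [exact: Hinf0|exact: functional0].
under [in X in X /\ _]eq_fun do rewrite big_cons.
under [in X in _ /\ X]eq_fun do rewrite big_cons.
rewrite big_cons; split; first exact: (Hinf_comb (a xi) (Hinf_qexp xi) IH1).
by rewrite (wlin (a xi) (Hinf_qexp xi) IH1) IH2.
Qed.

(** The iterates of a remainder are the remainders of the series of the
    iterates, all of order 1/N; there are finitely many of them in a
    seminorm. *)
Lemma seminorm_tail (a : int * int -> C) f p : rapid a -> L2 f ->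
  aeO f (qseries a k) ->
  exists2 K : R, 0 <= K & forall N,
    seminorm A p (fun x => qpsum a k N x - f x) <= K * N.+1%:R^-1.
Proof.
move=> ra Lf fa.
have [K K0 HK] : exists2 K : R, 0 <= K & forall j, (j <= p)%N ->
  forall N x, Omega x ->
    normc (qseries (eigpow k a j) k x - qpsum (eigpow k a j) k N x) <=
      K * N.+1%:R^-1.
  elim: p => [|p [K K0 HK]].
    have [K K0 H] := qseries_approx k (rapid_eigpow k 0 ra); exists K => // j.
    by rewrite leqn0 => /eqP -> N x Ox; have [] := H N x Ox.
  have [L L0 H] := qseries_approx k (rapid_eigpow k p.+1 ra).
  exists (K + L) => [|j]; first exact: addr_ge0.
  rewrite leq_eqVlt => /orP[/eqP ->|jp] N x Ox.
    have [_ _ h] := H N x Ox; rewrite (le_trans h)// ler_wpM2r ?invr_ge0//.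
    by rewrite lerDr.
  by rewrite (le_trans (HK _ _ N x Ox))// ler_wpM2r ?invr_ge0// lerDl.
exists K => // N.
pose d xi := -1 * a xi + cut_box N a xi.
have rd : rapid d by apply: rapidD; [exact: rapidZ|exact: rapid_cut_box].
apply: (seminorm_le dA rd).
- by apply: L2B => //; exact: L2_qpsum.
- apply: filterS fa => x e Ox; rewrite e// qseries_lin//;
  last exact: rapid_cut_box.
  by rewrite qseries_cut_box mulN1r addrC.
- by rewrite mulr_ge0// invr_ge0.
move=> j jp x Ox.
have -> : eigpow k d j = (fun xi =>
  -1 * eigpow k a j xi + cut_box N (eigpow k a j) xi).
  apply/funext => xi; rewrite /eigpow /d /cut_box; case: ifP => _; last by ring.
  by ring.
rewrite qseries_lin//; [|exact: rapid_eigpow|exact: rapid_cut_box].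
rewrite qseries_cut_box mulN1r -normc_opp opprD opprK.
exact: HK.
Qed.

Lemma functional_approx (a : int * int -> C) f : rapid a -> L2 f ->
  aeO f (qseries a k) ->
  forall eps : R, 0 < eps -> exists M : nat, forall N, (M <= N)%N ->
    normc (w f - \sum_(xi <- box N) a xi * w (qexp k xi)) < eps.
Proof.
move=> ra Lf fa eps e0; have Hf := Hinf_of_qseries dA ra Lf fa.
have [p [d [d0 H]]] := wcont Hf e0.
have [K K0 HK] := seminorm_tail p ra Lf fa.
exists (Num.bound (K / d)) => N MN.
have [Hs <-] := functional_comb_sum a (box N).
rewrite -normc_opp opprB -normC_lt_real; apply: H => //.
apply: le_lt_trans (HK N) _; rewrite ltr_pdivrMr// mulrC -ltr_pdivrMr//.
apply: lt_le_trans (archi_boundP _) _; first by rewrite divr_ge0// ltW.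
by rewrite ler_nat ltnW.
Qed.

(** Functions that agree a.e. have the same expansion, so both values are
    limits of the same sums. *)
Lemma functional_ae f g : Hinf A f -> Hinf A g -> aeO f g -> w f = w g.
Proof.
move=> Hf Hg fg; have [a ra [Lf fa]] := qseries_of_Hinf dA Hf.
have [_ _ [Lg _]] := qseries_of_Hinf dA Hg.
have ga := aeO_trans (aeO_sym fg) fa.
apply/eqP; rewrite -subr_eq0; apply/eqP/eq0_normc/le_anti/andP; split;
  last first.
  exact: normc_nneg.
apply/ler_addgt0Pl => eps e0; rewrite addr0.
have e20 : 0 < eps / 2 by rewrite divr_gt0.
have [M1 H1] := functional_approx ra Lf fa e20.
have [M2 H2] := functional_approx ra Lg ga e20.
have := H1 (maxn M1 M2) (leq_maxl _ _); have := H2 (maxn M1 M2) (leq_maxr _ _).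
set Z := \sum_(xi <- _) _ => h2 h1.
have -> : w f - w g = (w f - Z) - (w g - Z) by ring.
by apply: le_trans (normc_triangleB _ _) _; lra.
Qed.
End Functional.

(** * The symbol *)
Section Main.
Context {R : realType}.
Implicit Types (f g : fct R) (xi eta : int * int).
Local Notation C := R[i].

Definition symbol (c : C) (k : R * R) xi : C :=
  (k.1%:C + tau xi.1) + c * (k.2%:C + tau xi.2).

(** For real c the real part of the symbol is a nonzero constant. Otherwise
    the real part is affine in xi_2 with a nonzero slope, so a symbol smaller
    than 1 bounds xi_2, and then its imaginary part bounds xi_1. *)
Lemma symbol_lower_bound (c : C) (k : R * R) : c * k.2%:C <> - k.1%:C ->
  exists (d : R) (N : nat), 0 < d /\
    forall xi, xi \notin box N -> d <= normc (symbol c k xi).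
Proof.
case: c => c1 c2 ck; pose r := k.1 + c1 * k.2.
have ReS xi : Re (symbol (c1 +i* c2) k xi) = r - c2 * (2 * pi * xi.2%:~R).
  by rewrite /symbol Re_add Re_mul !Re_add !Im_add /= /r; ring.
have ImS xi : Im (symbol (c1 +i* c2) k xi) =
    2 * pi * xi.1%:~R + c1 * (2 * pi * xi.2%:~R) + c2 * k.2.
  by rewrite /symbol Im_add Im_mul !Re_add !Im_add /=; ring.
have [c20|c20] := eqVneq c2 0.
  exists `|r|, 0%N; split.
    rewrite normr_gt0; apply/eqP => r0; apply: ck; apply: complex_ext.
      by rewrite Re_mul Re_opp /= mulr0 subr0; move: r0; rewrite /r; lra.
    by rewrite Im_mul Im_opp /= c20 mulr0 mul0r addr0 oppr0.
  move=> xi _; apply: le_trans (Re_le_normc _).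
  by rewrite ReS c20 mul0r subr0.
pose B2 := (1 + `|r|) / `|c2|.
pose B1 := 1 + `|c2 * k.2| + `|c1| * B2.
have c2p : 0 < `|c2| by rewrite normr_gt0.
have B20 : 0 <= B2 by rewrite divr_ge0// addr_ge0.
have B10 : 0 <= B1 by rewrite addr_ge0 ?mulr_ge0// addr_ge0.
exists 1, (Num.bound (B1 + B2)); split => // xi xN.
rewrite leNgt; apply/negP => S1; move/negP: xN; apply.
have pi2 : 1 <= 2 * pi :> R by have := @pi_ge2 R; lra.
have pip : 0 < 2 * pi :> R by lra.
have R1 := le_lt_trans (Re_le_normc _) S1;
  have I1 := le_lt_trans (Im_le_normc _) S1.
rewrite ReS in R1; rewrite ImS in I1.
have n2 : 2 * pi * `|xi.2%:~R| <= B2.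
  rewrite /B2 ler_pdivlMr//.
  have -> : 2 * pi * `|xi.2%:~R| * `|c2| = `|c2 * (2 * pi * xi.2%:~R)|.
    by rewrite !normrM (ger0_norm (ltW (@pi_gt0 R))) (@ger0_norm _ 2)//; ring.
  have -> : c2 * (2 * pi * xi.2%:~R) =
    r - (r - c2 * (2 * pi * xi.2%:~R)) by ring.
  by apply: le_trans (ler_normB _ _) _; lra.
have n2' : `|xi.2%:~R| <= B2 :> R.
  by apply: le_trans n2; rewrite ler_peMl.
have n1' : `|xi.1%:~R| <= B1 :> R.
  have h : 2 * pi * `|xi.1%:~R| <=
    1 + `|c2 * k.2| + `|c1| * (2 * pi * `|xi.2%:~R|).
    have -> : 2 * pi * `|xi.1%:~R| = `|2 * pi * xi.1%:~R| :> R.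
      by rewrite !normrM (ger0_norm (ltW (@pi_gt0 R))) (@ger0_norm _ 2).
    have -> : `|c1| * (2 * pi * `|xi.2%:~R|) = `|c1 * (2 * pi * xi.2%:~R)|.
      by rewrite !normrM (ger0_norm (ltW (@pi_gt0 R))) (@ger0_norm _ 2).
    have -> : 2 * pi * xi.1%:~R =
       (2 * pi * xi.1%:~R + c1 * (2 * pi * xi.2%:~R) + c2 * k.2) -
       (c2 * k.2 + c1 * (2 * pi * xi.2%:~R)) :> R by ring.
    apply: le_trans (ler_normB _ _) _.
    by have := ler_normD (c2 * k.2) (c1 * (2 * pi * xi.2%:~R)); lra.
  have h' : `|xi.1%:~R| <= 2 * pi * `|xi.1%:~R| :> R by rewrite ler_peMl.
  apply: le_trans h' (le_trans h _).
  by rewrite /B1 lerD2l ler_wpM2l.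
have bd (m : int) : `|m%:~R| <= B1 + B2 -> (`|m| <= Num.bound (B1 + B2))%N.
  move=> mB; have := le_lt_trans mB (archi_boundP (addr_ge0 B10 B20)).
  by rewrite -intr_norm -[`|m|]/(Posz `|m|%N) -pmulrn ltr_nat => /ltnW.
rewrite mem_box; apply/andP; split; apply: bd.
  by rewrite (le_trans n1')// lerDl.
by rewrite (le_trans n2')// lerDr.
Qed.

(** Only the finitely many frequencies in the box escape the bound, and they
    do not affect decay. *)
Lemma rapid_div (a s g : int * int -> C) (d : R) (N : nat) : 0 < d ->
  (forall xi, xi \notin box N -> d <= normc (s xi)) ->
  (forall xi, s xi * a xi = g xi) -> rapid g -> rapid a.
Proof.
move=> d0 sd E rg.
(* Inside the box the sequence has finite support, outside it is dominated by
   g / d. *)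
pose out xi : C := if xi \in box N then 0 else a xi.
have -> : a = fun xi => cut_box N a xi + out xi.
  by apply/funext => xi; rewrite /cut_box /out; case: ifP;
    rewrite ?addr0 ?add0r.
apply: rapidD; first exact: rapid_cut_box.
apply: (rapid_le (rapidZ (d^-1)%:C rg)) => xi.
rewrite normcM normc_real ger0_norm; last by rewrite invr_ge0 ltW.
rewrite -E normcM /out.
case: ifPn => xN; first by rewrite normc0 !mulr_ge0 ?normc_nneg ?invr_ge0 ?(ltW
  d0).
by rewrite mulrA ler_peMl ?normc_nneg// mulrC ler_pdivlMr// mul1r sd.
Qed.

End Main.

Theorem theorem4p5 (R : realType) (h : R * R) (c : R[i])
  (h1_gt0 : 0 < h.1) (h2_gt0 : 0 < h.2) (c_neq0 : c != 0)
  (c_log : c * (ln h.2)%:C <> - (ln h.1)%:C) :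
  globally_hypoelliptic h (Pop c).
Proof.
move=> w [wlin wcont] [g Hg Pg].
pose k := log_pair h; pose v := qexp (opp2 k).
have dL : diagonal (Lop h) k := diagonal_Lop h1_gt0 h2_gt0.
have dA : diagonal (adjoint (Lop h)) (opp2 k) := diagonal_adjoint h1_gt0 h2_gt0.
have [b rb [Lg gb]] := qseries_of_Hinf dL Hg.
(* The chosen weak derivative of v xi is a.e. equal to a multiple of v xi, hence
   lies in the domain of w and gets the value of that multiple. *)
have wd (D : fct R -> fct R) (s : R[i]) xi :
    weak_derivative D (v xi) (fun x => s * v xi x) ->
    w (opval (weak_derivative D) (v xi)) = s * w (v xi).
  move=> H; have Hv := Hinf_qexp dA xi.
  have df : dom (weak_derivative D) (v xi) by exists (fun x => s * v xi x).
  have Ho := opvalP df.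
  have e := weak_derivative_unique Ho H.
  rewrite -(functionalZ dA wlin s Hv).
  have [_ Lo _] := Ho.
  have Hsv := HinfZ dA s Hv.
  have [a ra [_ sa]] := qseries_of_Hinf dA Hsv.
  apply: (functional_ae dA wlin wcont) => //.
  by apply: (Hinf_of_qseries dA ra Lo); exact: aeO_trans e sa.
have key xi : symbol c (opp2 k) xi * w (v xi) = - b (opp2 xi).
  pose s1 := (opp2 k).1%:C + tau xi.1; pose s2 := (opp2 k).2%:C + tau xi.2.
  have e1 : w (opval (weak_derivative (@pd1 R)) (v xi)) = s1 * w (v xi).
    by apply: wd; exact: (weak_derivative1_pexp s1 s2).
  have e2 : w (opval (weak_derivative (@pd2 R)) (v xi)) = s2 * w (v xi).
    by apply: wd; exact: (weak_derivative2_pexp s1 s2).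
  have Pv : Pop c w (v xi) = - (s1 * w (v xi)) + c * - (s2 * w (v xi)).
    by congr (- _ + c * - _); [exact: e1|exact: e2].
  have := Pg (v xi) (Hinf_qexp dA xi); rewrite Pv.
  have -> : pairing g (v xi) = b (opp2 xi).
    rewrite -(coef_qseries k xi rb); apply: (@coef_ae _ (opp2 k)) => //.
    exact: L2_qseries.
  move=> <-; rewrite /symbol -/s1 -/s2; generalize (w (v xi)) => W; ring.
have [d [N [d0 sd]]] : exists (d : R) (N : nat), 0 < d /\
    forall xi, xi \notin box N -> d <= normc (symbol c (opp2 k) xi).
  apply: symbol_lower_bound; rewrite /opp2 /= !rmorphN /= mulrN => /oppr_inj.
  exact: c_log.
have rW : rapid (fun xi => w (v xi)).
  apply: (rapid_div d0 sd key).
  by have := rapidZ (-1) (rapid_opp_index rb); under eq_fun do rewrite mulN1r.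
have rW' := rapid_opp_index rW.
exists (qseries (fun xi => w (v (- xi.1, - xi.2))) k).
  by apply: (Hinf_of_qseries dL rW'); [exact: L2_qseries|exact: aeO_refl].
move=> phi Hphi; have [a ra [Lphi phia]] := qseries_of_Hinf dA Hphi.
have [K K0 HK] := cint_qseries_approx k rW' Lphi.
(* The coefficients of phi are its pairings with the u_xi. *)
have cphi xi : cint (fun x => qexp k xi x * phi x) = a (opp2 xi).
  rewrite -(coef_qseries (opp2 k) xi ra) opp2K -(coef_ae k xi Lphi (L2_qseries _
    ra) phia).
  by congr cint; apply/funext => x; rewrite mulrC.
have HK' M : normc (pairing (qseries (fun xi => w (v (- xi.1, - xi.2))) k) phi -
    \sum_(xi <- box M) a xi * w (v xi)) <= K * M.+1%:R^-1.
  rewrite -sum_box_opp; apply: le_trans (HK M).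
  rewrite le_eqVlt; apply/orP; left; apply/eqP; congr (normc (_ - _)).
  by apply: eq_bigr => xi _; rewrite cphi mulrC.
apply/eqP; rewrite -subr_eq0; apply/eqP/eq0_normc/le_anti/andP; split;
  last first.
  exact: normc_nneg.
apply/ler_addgt0Pl => eps e0; rewrite addr0.
have e20 : 0 < eps / 2 by rewrite divr_gt0.
have [M1 H1] := functional_approx dA wlin wcont ra Lphi phia e20.
pose M := maxn M1 (Num.bound (K / (eps / 2))).
have h1 := H1 M (leq_maxl _ _); have h2 := HK' M.
have h3 : K * M.+1%:R^-1 <= eps / 2.
  rewrite ler_pdivrMr// mulrC -ler_pdivrMr//.
  apply: le_trans (ltW (archi_boundP _)) _; first by rewrite divr_ge0// ltW.
  by rewrite ler_nat (leq_trans (leq_maxr M1 _)).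
move: h1 h2; set Z := \sum_(xi <- _) _; set Y := pairing _ _ => h1' h2'.
have -> : w phi - Y = (w phi - Z) - (Y - Z) by ring.
rewrite (le_trans (normc_triangleB _ _))// [leRHS](splitr eps) lerD ?(ltW
  h1')//.
exact: le_trans h2' h3.
Qed.
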